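(* Let $\Sigma$ be a planar model satisfying the Standing Assumption and let $\alpha=\dim(\Sigma)$. Then for every $\varepsilon>0$ and $m>m(\varepsilon)$, $$\lim_{n\to\infty}\mathbb P\Big(\Big\{\omega\in\Omega:\ \mathbf P_{0\le i\le n}\big(|H_m(\eta^{(T^{n'(\omega)}\omega),x,i})-\alpha|<\varepsilon\big)>1-\varepsilon\Big\}\Big)=1.$$
   Context: Planar model $\Sigma=((\Phi^{(i)})_{i\in I},(p_i)_{i\in I},\mathbb P)$: $I$ finite; $\Phi^{(i)}=(f^{(i)}_j)_{j\le k_i}$, $f^{(i)}_j(z)=\lambda_iz+t^{(i)}_j$, $\lambda_i=r_i\varphi_i$, $0<r_i<1$, $|\varphi_i|=1$; $p_i$ positive probability vectors; $\mathbb P$ on $\Omega=I^{\mathbb N}$, $T$ the shift. $\eta^{(\omega)}$ is the law of $\sum_{n\ge1}(\prod_{j<n}\lambda_{\omega_j})t^{(\omega_n)}_{u_n}$, $u_n$ independent with laws $p_{\omega_n}$. $\dim(\Sigma)$ is the a.s. constant exact dimension of $\eta^{(\omega)}$ (for ergodic $\mathbb P$). Standing Assumption: $\mathbb P$ $T$-invariant ergodic; (i) some $i_0$ with $\mathbb P(\omega_1=i_0)>0$ has not all maps in $\Phi^{(i_0)}$ equal; (ii) some $i_1$ with $\mathbb P(\omega_1=i_1)>0$ has $\varphi_{i_1}\notin\mathbb R$. Fix $R>0$ with $\overline{f^{(i)}_j(B(0,R))}\subset B(0,R)$ for all $i,j$ and $2R\min_ir_i>1/2$; $n'(\omega)$ is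 the natural number with $2R\prod_{i=1}^{n'}r_{\omega_i}\le2^{-n}\le2R\prod_{i=1}^{n'-1}r_{\omega_i}$. $H_m(\mu)=\frac1mH(\mu,\mathcal D_m)$ (log base 2, $\mathcal D_m$ dyadic squares of side $2^{-m}$). Rescaled component $\mu^{x,i}=T_D(\mu|_D/\mu(D))$ for $D=D_i(x)\in\mathcal D_i$ containing $x$, $T_D$ the homothety mapping $D$ onto $[0,1)^2$. $\mathbf P_{0\le i\le n}(\mu^{x,i}\in A)=\frac1{n+1}\sum_{i=0}^n\mu(\{x:\mu^{x,i}\in A\})$. *)

(* Defs.v *)
From HB Require Import structures.
From mathcomp Require Import all_boot all_order all_algebra.
From mathcomp Require Import all_classical all_reals all_analysis.
Set Implicit Arguments. Unset Strict Implicit. Unset Printing Implicit Defensive.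
Import Order.TTheory GRing.Theory Num.Theory.
Import numFieldNormedType.Exports.
Local Open Scope classical_set_scope.
Local Open Scope ring_scope.

(* Sequences are indexed from 0: the paper's omega_1, omega_2, ... are w 0, w 1, ... *)

Definition cylinder (I : Type) (N : nat) (a : nat -> I) : set (nat -> I) :=
  [set w | forall j, (j < N)%N -> w j = a j].

Definition cylinders (I : Type) : set (set (nat -> I)) :=
  [set C | exists N a, C = cylinder N a].

Notation Omega I := (g_sigma_algebraType (@cylinders I)).

Definition Tshift (I : Type) (w : nat -> I) : nat -> I := fun j => w j.+1.

Definition cmul (R : pzRingType) (a b : R * R) : R * R :=
  (a.1 * b.1 - a.2 * b.2, a.1 * b.2 + a.2 * b.1).
Definition cadd (R : pzRingType) (a b : R * R) : R * R := (a.1 + b.1, a.2 + b.2).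

Definition lam (R : pzRingType) (I : Type) (r : I -> R) (phi : I -> R * R) (i : I) : R * R :=
  (r i * (phi i).1, r i * (phi i).2).

Definition fij (R : pzRingType) (I : Type) (r : I -> R) (phi : I -> R * R)
  (t : I -> nat -> R * R) (i : I) (j : nat) (z : R * R) : R * R :=
  cadd (cmul (lam r phi i) z) (t i j).

Fixpoint lamprod (R : pzRingType) (I : Type) (r : I -> R) (phi : I -> R * R)
  (w : nat -> I) (n : nat) : R * R :=
  match n with
  | 0%N => (1, 0)
  | n'.+1 => cmul (lamprod r phi w n') (lam r phi (w n'))
  end.

Definition eball (R : realType) (x : R * R) (s : R) : set (R * R) :=
  [set y | (y.1 - x.1) ^+ 2 + (y.2 - x.2) ^+ 2 < s ^+ 2].

Definition valid_digits (I : Type) (k : I -> nat) (w : nat -> I) (u : nat -> nat) : Prop :=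
  forall n, (u n < k (w n))%N.

Definition coding (R : realType) (I : Type) (r : I -> R) (phi : I -> R * R)
  (t : I -> nat -> R * R) (w : nat -> I) (u : nat -> nat) : R * R :=
  let term n := cmul (lamprod r phi w n) (t (w n) (u n)) in
  ((\big[+%R/0%R]_(0 <= n <oo) (term n).1)%BIG, (\big[+%R/0%R]_(0 <= n <oo) (term n).2)%BIG).

Definition dcyl (ws : seq nat) : set (nat -> nat) :=
  [set u | forall j, (j < size ws)%N -> u j = nth 0%N ws j].

Definition cyl_weight (R : realType) (I : Type) (k : I -> nat) (p : I -> nat -> R)
  (w : nat -> I) (ws : seq nat) : R :=
  if [forall j : 'I_(size ws), (nth 0%N ws j < k (w j))%N]
  then \prod_(j < size ws) p (w j) (nth 0%N ws j) else 0.

(* eta^(w)(A) = law of sum_n (prod_{j<n} lambda_{w j}) t^{(w n)}_{u_n}, u_n independent with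
   laws p_{w n}: the (Caratheodory outer) product measure of the preimage of A under the coding map. *)
Definition etaw (R : realType) (I : Type) (k : I -> nat) (r : I -> R) (phi : I -> R * R)
  (t : I -> nat -> R * R) (p : I -> nat -> R) (w : nat -> I) (A : set (R * R)) : R :=
  fine (ereal_inf
    [set (\sum_(0 <= j <oo) (cyl_weight k p w (C j))%:E)%E | C in
      [set C : nat -> seq nat |
         [set u | valid_digits k w u /\ A (coding r phi t w u)] `<=` \bigcup_j dcyl (C j)]]).

Definition exact_dim (R : realType) (mu : set (R * R) -> R) (a : R) : Prop :=
  exists N : set (R * R), mu N = 0 /\
    forall x, ~ N x -> (ln (mu (eball x s)) / ln s) @[s --> 0^'+] --> a.

Definition dsq (R : realType) (m : nat) (d : int * int) : set (R * R) :=
  [set y | (d.1%:~R * 2 ^- m <= y.1 < (d.1 + 1)%:~R * 2 ^- m) /\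
           (d.2%:~R * 2 ^- m <= y.2 < (d.2 + 1)%:~R * 2 ^- m)].

Definition dcell (R : realType) (m : nat) (x : R * R) : int * int :=
  (Num.floor (x.1 * 2 ^+ m), Num.floor (x.2 * 2 ^+ m)).

Definition TD (R : realType) (m : nat) (d : int * int) (y : R * R) : R * R :=
  ((y.1 - d.1%:~R * 2 ^- m) * 2 ^+ m, (y.2 - d.2%:~R * 2 ^- m) * 2 ^+ m).

Definition component (R : realType) (mu : set (R * R) -> R) (x : R * R) (i : nat)
  : set (R * R) -> R :=
  fun A => mu (dsq i (dcell i x) `&` (TD i (dcell i x)) @^-1` A) / mu (dsq i (dcell i x)).

Definition log2 (R : realType) (q : R) : R := ln q / ln 2.

Definition ent (R : realType) (q : R) : R := if q <= 0 then 0 else - (q * log2 q).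

Definition entropy (R : realType) (mu : set (R * R) -> R) (m : nat) : R :=
  fine (\esum_(d in [set: int * int]) (ent (mu (dsq m d)))%:E)%E.

Definition Hm (R : realType) (m : nat) (mu : set (R * R) -> R) : R :=
  entropy mu m / m%:R.

Definition Pcomp (R : realType) (mu : set (R * R) -> R) (n : nat)
  (A : (set (R * R) -> R) -> Prop) : R :=
  (n.+1)%:R^-1 * \sum_(0 <= i < n.+1) mu [set x | A (component mu x i)].

(* n'(w): the least natural number N with 2 Rad prod_{j<N} r_{w j} <= 2^-n
   (then also 2 Rad prod_{j<N-1} r_{w j} > 2^-n when N >= 1). *)
Definition nprime (R : realType) (I : Type) (Rad : R) (r : I -> R) (n : nat)
  (w : nat -> I) : nat :=
  let P N := `[< 2 * Rad * \prod_(j < N) r (w j) <= 2 ^- n >] in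
  match pselect (exists N, P N) with
  | left h => ex_minn h
  | right _ => 0%N
  end.

(* Main.v *)
Require Import Defs.
From HB Require Import structures.
From mathcomp Require Import all_boot all_order all_algebra.
From mathcomp Require Import all_classical all_reals all_analysis.
From mathcomp Require Import measurable_realfun zify ring lra.
Set Implicit Arguments. Unset Strict Implicit. Unset Printing Implicit Defensive.
Import Order.TTheory GRing.Theory Num.Theory.
Import numFieldNormedType.Exports.
Local Open Scope classical_set_scope.
Local Open Scope ring_scope.

(** Lower bound: [eta^(w)] is an average of copies of [eta^(T^N w)] under similarities with a
    common linear part of size about [2^-i]. Exact dimensionality of [eta^(T^N w)] says that,
    off a set of small mass, balls of radius [2^-m] have mass at most [2^(-m (alpha - e))];
    hence a copy that leaves mass at least [c] in a dyadic square [D] of side [2^-i] has, once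
    restricted to [D], entropy at least about [m alpha] at scale [2^-(i+m)], and by concavity
    so does the component on [D]. The parts of mass less than [c] are negligible, because a
    copy meets boundedly many squares. This works at the scales [i] for which [T^N w] is good,
    which by a maximal inequality is most scales.

    Upper bound: the entropies of the components average to [H(eta^(w), D_n) / n] up to
    [O(m / n)], and this tends to [alpha]. Together with the lower bound this forces
    concentration at [alpha].

    The law of [T^(n'(w)) w] has density at most a constant with respect to [P], so it is
    enough to treat [eta^(w)] itself. *)

(** * The product measure on digit sequences *)

(** [etaw] is an outer measure, defined on all sets but additive only on Carathéodory measurable
    ones. The statement is therefore reduced to finite sums over dyadic squares: [PcompE] expresses
    the event through masses of squares, and its measurability in the environment follows from
    theirs. Entropies stay multiplied by the mass of their square ([cell_ent]); this avoids dividing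
    by the mass of a null square and turns concavity into a homogeneous log-sum inequality.

    Exact dimension gives no upper bound for the entropy of a single component, which is why only
    the average is bounded above. For the exceptional shifts an upper bound on the frequency of
    visits suffices, so a maximal inequality takes the place of the pointwise ergodic theorem. The
    order of choices matters: [e0] and [tau] come from [eps] and [alpha]; [c] and [lambda] from
    [tau] and the geometric constants [A], [L], [C]; then [m] is taken so large that the exceptional
    event has probability below [lambda]; [n] comes last and may depend on the environment. *)

Section outer_measure_of_cover.
Variables (R : realType) (T : Type) (W : Type) (D : W -> set T) (wt : W -> R).
Hypothesis wt_ge0 : forall s, 0 <= wt s.
Hypothesis null_words : exists s, wt s = 0.

(** With [dcyl] and [cyl_weight] this is literally the infimum inside [etaw], so [etaE] holds by
    conversion. Covers are infinite sequences; a word of weight zero pads finite ones and covers the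
    empty set. *)
Definition cover_outer (E : set T) : \bar R :=
  ereal_inf [set (\sum_(0 <= j <oo) (wt (C j))%:E)%E | C in
    [set C : nat -> W | E `<=` \bigcup_j D (C j)]].

Lemma cover_outer_ge0 E : (0 <= cover_outer E)%E.
Proof.
apply: le_ereal_inf_tmp => _ [C _ <-].
by apply: nneseries_ge0 => n _ _; rewrite lee_fin.
Qed.

Lemma cover_outer0 : cover_outer set0 = 0%E.
Proof.
apply/eqP; rewrite eq_le cover_outer_ge0 andbT.
have [s s0] := null_words.
apply: ereal_inf_lbound; exists (fun=> s) => //=.
by rewrite eseries0 // => i _ _; rewrite s0.
Qed.

Lemma le_cover_outer : {homo cover_outer : A B / A `<=` B >-> (A <= B)%E}.
Proof.
move=> A B AB; apply: le_ereal_inf_tmp => _ [C BC <-].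
apply: ereal_inf_lbound; exists C => //=; exact: subset_trans BC.
Qed.

Lemma cover_outer_sigma_subadditive : sigma_subadditive cover_outer.
Proof.
move=> A; have [[i ioo]|] := pselect (exists i, cover_outer (A i) = +oo%E).
  rewrite (eseries_pinfty _ _ ioo) ?leey// => n _.
  by rewrite -ltNye (lt_le_trans _ (cover_outer_ge0 _)).
rewrite -forallNE => Aoo.
apply/lee_addgt0Pr => e e0.
rewrite (le_trans _ (epsilon_trick _ _ _))//; last 2 first.
  by move=> n; exact: cover_outer_ge0.
  exact: ltW.
have /choice[G PG] : forall n, exists C : nat -> W,
    A n `<=` \bigcup_j D (C j) /\
    (\sum_(0 <= j <oo) (wt (C j))%:E <= cover_outer (A n) + (e / (2 ^ n.+1)%:R)%:E)%E.
  move=> n.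
  have fA : cover_outer (A n) \is a fin_num.
    by rewrite ge0_fin_numE ?cover_outer_ge0// ltey; apply/eqP; exact: Aoo.
  have en1 : 0 < e / (2 ^ n.+1)%:R by rewrite divr_gt0// ltr0n expn_gt0.
  have [x [C AC <-] /ltW xS] := lb_ereal_inf_adherent en1 fA.
  by exists C.
have /card_esym/ppcard_eqP[f] := card_nat2.
apply: (@le_trans _ _ (\sum_(0 <= i <oo) (wt (uncurry G (f i)))%:E)%E).
  apply: ereal_inf_lbound; exists (uncurry G \o f) => //= t [i _] /((PG i).1) [j _ Gt].
  by exists (f^-1%FUN (i, j)) => //=; rewrite invK ?inE.
apply: (@le_trans _ _ (\sum_(0 <= i <oo) \sum_(0 <= j <oo) (wt (G i j))%:E)%E); last first.
  by apply: lee_nneseries => [i _ _|n _]; [apply: nneseries_ge0 => *; rewrite lee_fin|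
    exact: (PG n).2].
rewrite nneseries_esumT; last by move=> *; rewrite lee_fin.
rewrite -(@reindex_esum _ _ _ setT setT f (fun x => (wt (uncurry G x))%:E)) //.
rewrite nneseries_esumT; last by move=> *; apply: nneseries_ge0 => *; rewrite lee_fin.
under [leRHS]eq_esum do (rewrite nneseries_esumT; last by move=> *; rewrite lee_fin).
rewrite esum_esum; last by move=> *; rewrite lee_fin.
rewrite le_eqVlt; apply/orP; left; apply/eqP.
rewrite (_ : [set: nat * nat] = setT `*`` (fun=> setT)); last by apply/seteqP; split=> -[].
by apply: eq_esum => -[].
Qed.

HB.instance Definition _ := isOuterMeasure.Build R T cover_outer
  cover_outer0 cover_outer_ge0 le_cover_outer cover_outer_sigma_subadditive.

(** The canonical structure depends on the hypotheses of the section. The existential packages it,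
    so that destructing it later gives access to the general theory of outer measures. *)
Lemma cover_outer_is_outer_measure :
  exists om : {outer_measure set T -> \bar R}, forall E, om E = cover_outer E.
Proof. by exists cover_outer. Qed.

End outer_measure_of_cover.

Section digits.
Variables (R : realType) (I : Type) (k : I -> nat) (p : I -> nat -> R).
Hypothesis p_gt0 : forall i j, (j < k i)%N -> 0 < p i j.
Hypothesis p_sum : forall i, \sum_(j < k i) p i j = 1.
Implicit Types (w : nat -> I) (u : nat -> nat) (E : set (nat -> nat)).

Local Notation weight := (cyl_weight k p).

Definition scons (j : nat) u : nat -> nat := fun n => if n is n'.+1 then u n' else j.

Definition digit_outer w : set (nat -> nat) -> \bar R :=
  cover_outer dcyl (weight w).

Lemma cyl_weight0 w : weight w [::] = 1.
Proof.
rewrite /cyl_weight big_ord0 ifT //; by apply/forallP => -[].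
Qed.

Lemma cyl_weight_cons w a s :
  weight w (a :: s) = (if (a < k (w 0%N))%N then p (w 0%N) a else 0) * weight (Tshift w) s.
Proof.
rewrite /cyl_weight; case: ifPn => [/forallP h|].
  rewrite big_ord_recl /= (h ord0) ifT; last first.
    by apply/forallP => j; exact: (h (lift ord0 j)).
  by congr (_ * _); apply: eq_bigr.
move=> /forallPn[j]; case: (unliftP ord0 j) => [j' ->|->] /= hj.
  rewrite [X in _ * X]ifF ?mulr0 //; apply/negbTE/forallPn; exists j'.
  exact: hj.
by rewrite (negbTE hj) mul0r.
Qed.

Lemma cyl_weight_ge0 w s : 0 <= weight w s.
Proof.
elim: s w => [|a s IH] w; first by rewrite cyl_weight0.
by rewrite cyl_weight_cons mulr_ge0 //; case: ifPn => // /p_gt0/ltW.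
Qed.

Lemma cyl_weight_null w : exists s, weight w s = 0.
Proof. by exists [:: k (w 0%N)]; rewrite cyl_weight_cons ltnn mul0r. Qed.

Lemma digit_outer_is_outer_measure w :
  exists om : {outer_measure set (nat -> nat) -> \bar R}, forall E, om E = digit_outer w E.
Proof.
exact: (cover_outer_is_outer_measure dcyl (@cyl_weight_ge0 w) (cyl_weight_null w)).
Qed.

(* The word [s] seen after reading the digit [j]; a word of weight zero stands for
   the empty cylinder. *)
Definition residual w (j : nat) (s : seq nat) : seq nat :=
  if s is a :: s' then if a == j then s' else [:: k (w 1%N)] else [::].

Lemma cyl_weight_residual w s :
  weight w s = \sum_(j < k (w 0%N)) p (w 0%N) j * weight (Tshift w) (residual w j s).
Proof.
case: s => [|a s] /=.
  by under eq_bigr do rewrite cyl_weight0 mulr1; rewrite cyl_weight0 p_sum.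
rewrite cyl_weight_cons; case: ifPn => ak; last first.
  rewrite mul0r big1 // => j _; case: eqP => [aj|_]; first by rewrite aj ltn_ord in ak.
  by rewrite cyl_weight_cons ltnn mul0r mulr0.
rewrite (bigD1 (Ordinal ak)) //= eqxx big1 ?addr0 // => j ja.
rewrite ifF; first by rewrite cyl_weight_cons ltnn mul0r mulr0.
by apply/negbTE; apply: contra ja => /eqP aj; apply/eqP/val_inj.
Qed.

Lemma dcyl_scons w j u s : dcyl s (scons j u) -> dcyl (residual w j s) u.
Proof.
case: s => [|a s] //= h; have /= <- := h 0%N isT; rewrite eqxx => n ns.
exact: (h n.+1).
Qed.

Lemma sum_residual w (C : nat -> seq nat) :
  (\sum_(0 <= i <oo) (weight w (C i))%:E =
   \sum_(j < k (w 0%N)) (p (w 0%N) j)%:E *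
     \sum_(0 <= i <oo) (weight (Tshift w) (residual w j (C i)))%:E)%E.
Proof.
under eq_eseriesr do rewrite cyl_weight_residual -sumEFin.
rewrite nneseries_sum; last first.
  by move=> i j _; rewrite lee_fin mulr_ge0 ?cyl_weight_ge0 //; exact/ltW/p_gt0.
apply: eq_bigr => j _; under eq_eseriesr do rewrite EFinM.
by rewrite nneseriesZl // => *; rewrite lee_fin cyl_weight_ge0.
Qed.

Lemma digit_outer_ge0 w E : (0 <= digit_outer w E)%E.
Proof. by apply: cover_outer_ge0; exact: cyl_weight_ge0. Qed.

Lemma le_digit_outer w : {homo digit_outer w : A B / A `<=` B >-> (A <= B)%E}.
Proof. exact: le_cover_outer. Qed.

Lemma digit_outer_le1 w E : (digit_outer w E <= 1)%E.
Proof.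
(* The empty word covers everything with weight 1; the out-of-range digit [k (w 0)] supplies words
   of weight zero for the rest of the sequence. *)
pose C n := if n is n'.+1 then [:: k (w 0%N)] else [::].
apply: ereal_inf_lbound; exists C => [u _|]; first by exists 0%N.
rewrite nneseries_recl //; last by move=> n; rewrite lee_fin cyl_weight_ge0.
rewrite /= cyl_weight0 eseries0 ?adde0 // => -[|n] //= _ _.
by rewrite cyl_weight_cons ltnn mul0r.
Qed.

Lemma digit_outer_fin_num w E : digit_outer w E \is a fin_num.
Proof.
rewrite ge0_fin_numE ?digit_outer_ge0 //.
by rewrite (le_lt_trans (digit_outer_le1 w E)) // ltry.
Qed.

(** Self-similarity of the product measure, for every [E], measurable or not. A cover of [E] splits
    into its residual covers, which gives one inequality. For the other, near-optimal covers of the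
    slices are prefixed by their digit and added by subadditivity; slices with an invalid first
    digit have weight zero. *)
Lemma digit_outer_rec w E :
  (digit_outer w E = \sum_(j < k (w 0%N)) (p (w 0%N) j)%:E *
     digit_outer (Tshift w) [set u | E (scons j u)])%E.
Proof.
apply/eqP; rewrite eq_le; apply/andP; split; last first.
  apply: le_ereal_inf_tmp => _ [C EC <-]; rewrite sum_residual.
  apply: lee_sum => j _; rewrite lee_pmul2l ?fin_numE //; last first.
    by rewrite lte_fin p_gt0.
  apply: ereal_inf_lbound; exists (fun i => residual w j (C i)) => //= u /EC[i _ Ci].
  by exists i => //; exact: dcyl_scons Ci.
have [om omE] := digit_outer_is_outer_measure w.
pose F (n : nat) := E `&` [set u | u 0%N = n].
have F0 n : (digit_outer w (F n) <=
    (if (n < k (w 0%N))%N then p (w 0%N) n else 0)%:E *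
     digit_outer (Tshift w) [set u | E (scons n u)])%E.
  have pn0 : 0 <= (if (n < k (w 0%N))%N then p (w 0%N) n else 0).
    by case: ifPn => // /p_gt0/ltW.
  apply/lee_addgt0Pr => e e0.
  have [_ [C EC <-] /ltW xS] := lb_ereal_inf_adherent e0
    (digit_outer_fin_num (Tshift w) [set u | E (scons n u)]).
  apply: (@le_trans _ _ (\sum_(0 <= i <oo) (weight w (n :: C i))%:E)%E).
    apply: ereal_inf_lbound; exists (fun i => n :: C i) => //= u [Eu un].
    have us : u = scons n (fun i => u i.+1) by apply/funext => -[].
    rewrite us in Eu; have [i _ Ci] := EC _ Eu.
    by exists i => // -[_|j]; [exact: un|exact: Ci].
  under eq_eseriesr do rewrite cyl_weight_cons EFinM.
  rewrite nneseriesZl; last by move=> *; rewrite lee_fin cyl_weight_ge0.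
  apply: (le_trans (lee_wpmul2l _ xS)); first by rewrite lee_fin.
  rewrite muleDr ?fin_num_adde_defl // leeD2l // -EFinM lee_fin ler_piMl //; first exact: ltW.
  case: ifPn => // nk; rewrite -(p_sum (w 0%N)) (bigD1 (Ordinal nk)) //= lerDl.
  by apply: sumr_ge0 => j _; exact/ltW/p_gt0.
have -> : E = \bigcup_n F n.
  by apply/seteqP; split=> [u Eu|u [n _ []]] //; exists (u 0%N).
rewrite -omE; apply: (le_trans (outer_measure_sigma_subadditive om F)).
apply: (@le_trans _ _ (\sum_(0 <= n <oo) (if (n < k (w 0%N))%N then p (w 0%N) n else 0)%:E *
     digit_outer (Tshift w) [set u | E (scons n u)])%E).
  apply: lee_nneseries => [n _ _|n _]; first exact: outer_measure_ge0.
  by rewrite omE.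
rewrite (nneseries_split _ (k (w 0%N))); last first.
  move=> n _; rewrite mule_ge0 ?digit_outer_ge0 // lee_fin.
  by case: ifPn => // /p_gt0/ltW.
rewrite [X in (_ + X)%E]eseries0 ?adde0; last first.
  by move=> n; rewrite add0n leqNgt => /negbTE -> _; rewrite mul0e.
rewrite add0n big_mkord; apply: lee_sum => j _; rewrite ltn_ord.
rewrite (_ : [set u | E (scons j u)] = [set u | (\bigcup_n F n) (scons j u)]) //.
by apply/seteqP; split=> [u Eu|u [n _ []]] //; exists j.
Qed.

(** Induction on the word through [digit_outer_rec]: once the first digit is fixed, the cylinder
    becomes either a shorter cylinder or the empty set. *)
Lemma dcyl_caratheodory w s : (digit_outer w).-caratheodory (dcyl s).
Proof.
elim: s w => [|a s IH] w X.
  rewrite (_ : dcyl [::] = setT); last by apply/seteqP; split.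
  rewrite setIT setCT setI0.
  have [om omE] := digit_outer_is_outer_measure w.
  by rewrite -!omE outer_measure0 adde0.
rewrite (digit_outer_rec w X) (digit_outer_rec w (X `&` _)) (digit_outer_rec w (X `&` ~` _)).
rewrite -big_split /=; apply: eq_bigr => j _.
rewrite -muleDr ?ge0_adde_def ?inE ?digit_outer_ge0 //; congr (_ * _)%E.
have [<-|ja] := eqVneq (j : nat) a.
  rewrite (IH (Tshift w)); congr (digit_outer _ _ + digit_outer _ _)%E.
    apply/seteqP; split=> u [Xu].
      by move=> h; split=> // -[|i] //=; exact: h.
    by move=> h; split=> // i si; exact: (h i.+1).
  apply/seteqP; split=> u [Xu] h; split=> // h'; apply: h.
    by move=> i si; exact: (h' i.+1).
  by move=> [|i] //= ?; exact: h'.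
rewrite (_ : [set u | (X `&` dcyl (a :: s)) (scons j u)] = set0); last first.
  apply/seteqP; split=> // u [_ h]; have /= := h 0%N isT => /eqP.
  by rewrite (negbTE ja).
rewrite (_ : [set u | (X `&` ~` dcyl (a :: s)) (scons j u)] = [set u | X (scons j u)]).
  have [om omE] := digit_outer_is_outer_measure (Tshift w).
  by rewrite -!omE outer_measure0 add0e.
apply/seteqP; split=> [u []|u Xu] //; split=> // h; have /= := h 0%N isT => /eqP.
by rewrite (negbTE ja).
Qed.

(* Along a cover of total weight less than 1 one can keep choosing a digit so that the
   residual covers have weight less than 1, which no covered sequence allows. *)
Lemma digit_outer_valid w : digit_outer w (valid_digits k w) = 1%E.
Proof.
apply/eqP; rewrite eq_le digit_outer_le1 /=.
apply: le_ereal_inf_tmp => _ [C VC <-]; rewrite leNgt; apply/negP => C1.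
(* The assumption on the total weight sits under the existential, so that [choice] yields a total
   function. The digit exists because the weight is an average of the residual weights. *)
have step (wC : (nat -> I) * (nat -> seq nat)) : exists j : nat,
    (\sum_(0 <= i <oo) (weight wC.1 (wC.2 i))%:E < 1)%E ->
    (j < k (wC.1 0))%N /\
    (\sum_(0 <= i <oo) (weight (Tshift wC.1) (residual wC.1 j (wC.2 i)))%:E < 1)%E.
  case: wC => v B /=; have [B1|] := pselect (\sum_(0 <= i <oo) (weight v (B i))%:E < 1)%E;
    last by exists 0%N.
  apply: contrapT => /forallNP h.
  have := B1; rewrite sum_residual ltNge => /negP; apply.
  have -> : (1 = \sum_(j < k (v 0%N)) (p (v 0%N) j)%:E * 1)%E.
    by under eq_bigr do rewrite mule1; rewrite sumEFin p_sum.
  apply: lee_sum => j _; apply: lee_wpmul2l; first by rewrite lee_fin ltW// p_gt0.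
  by rewrite leNgt; apply/negP => hj; apply: (h j) => _.
have [d dP] := choice step.
pose next (wC : (nat -> I) * (nat -> seq nat)) :=
  (Tshift wC.1, fun i => residual wC.1 (d wC) (wC.2 i)).
pose st n := iter n next (w, C).
have stP n : (\sum_(0 <= i <oo) (weight (st n).1 ((st n).2 i))%:E < 1)%E.
  by elim: n => [|n IH] //=; have [] := dP _ IH.
pose u n := d (st n).
have st1 n j : (st n).1 j = w (n + j)%N.
  by elim: n j => [|n IH] j //=; rewrite /Tshift IH addSnnS.
have uV : valid_digits k w u.
  by move=> n; have [] := dP _ (stP n); rewrite st1 addn0.
have [i _ Ci] := VC _ uV.
(* The word [C i] containing [u] loses one letter per step. After [size (C i)] steps it is the empty
   word, whose weight 1 contradicts [stP]. *)
have res n : dcyl ((st n).2 i) (fun j => u (n + j)%N) /\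
    size ((st n).2 i) = (size (C i) - n)%N.
  elim: n => [|n [IH1 IH2]]; first by rewrite subn0.
  rewrite /= -/(st n) subnS -IH2; move: IH1; case: ((st n).2 i) => [|a s] //= h.
  have /= <- := h 0%N isT; rewrite addn0 eqxx; split=> // j js.
  by rewrite addSnnS; exact: (h j.+1).
have := stP (size (C i)); rewrite ltNge => /negP; apply.
have [_] := res (size (C i)); rewrite subnn => /size0nil Ci0.
have := @nneseries_lim_ge R (fun i0 => (weight (st (size (C i))).1 ((st (size (C i))).2 i0))%:E) xpredT 0 i.+1.
rewrite big_nat_recr //= Ci0 cyl_weight0 => H.
apply: le_trans (H _); last by move=> *; rewrite lee_fin cyl_weight_ge0.
rewrite leeDr // sume_ge0 // => *; by rewrite lee_fin cyl_weight_ge0.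
Qed.

End digits.

Local Notation cadd := Defs.cadd.

(** * The coding map and self-similarity *)

Definition sqnorm (R : pzRingType) (z : R * R) : R := z.1 ^+ 2 + z.2 ^+ 2.

Definition csub (R : pzRingType) (a b : R * R) : R * R := (a.1 - b.1, a.2 - b.2).

Lemma sqnorm_cmul (R : comPzRingType) (a b : R * R) :
  sqnorm (cmul a b) = sqnorm a * sqnorm b.
Proof. by rewrite /sqnorm /=; ring. Qed.

Lemma sqnorm_coord (R : realDomainType) (z : R * R) (s : R) : 0 <= s ->
  sqnorm z <= s ^+ 2 -> `|z.1| <= s /\ `|z.2| <= s.
Proof.
move=> s0; rewrite /sqnorm => h.
by split; rewrite -(@ler_pXn2r _ 2) ?nnegrE // real_normK ?num_real //;
  apply: le_trans h; rewrite ?lerDl ?lerDr sqr_ge0.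
Qed.

Section coding.
Variables (R : realType) (I : Type) (k : I -> nat) (r : I -> R) (phi : I -> R * R).
Variables (t : I -> nat -> R * R) (Rad rM : R).
Hypothesis r_bounds : forall i, 0 < r i <= rM.
Hypothesis rM_lt1 : rM < 1.
Hypothesis phi_unit : forall i, (phi i).1 ^+ 2 + (phi i).2 ^+ 2 = 1.
Hypothesis Rad_gt0 : 0 < Rad.
Hypothesis Rad_closure : forall i j, (j < k i)%N ->
  closure (fij r phi t i j @` eball (0, 0) Rad) `<=` eball (0, 0) Rad.
Implicit Types (w : nat -> I) (u : nat -> nat).

Definition contr w n : R := \prod_(j < n) r (w j).

Local Notation lamprod := (lamprod r phi).
Local Notation fij := (fij r phi t).
Local Notation coding := (coding r phi t).

Lemma contrS w n : contr w n.+1 = r (w 0%N) * contr (Tshift w) n.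
Proof. by rewrite /contr big_ord_recl. Qed.

Lemma contrSr w n : contr w n.+1 = contr w n * r (w n).
Proof. by rewrite /contr big_ord_recr. Qed.

Lemma contr_gt0 w n : 0 < contr w n.
Proof. by apply: prodr_gt0 => j _; case/andP: (r_bounds (w j)). Qed.

Lemma rM_gt0 w : 0 < rM.
Proof. by case/andP: (r_bounds (w 0%N)) => /lt_le_trans; apply. Qed.

Lemma contr_le w n : contr w n <= rM ^+ n.
Proof.
elim: n => [|n IH]; first by rewrite /contr big_ord0.
rewrite contrSr exprSr ler_pM //; first exact/ltW/contr_gt0.
  by case/andP: (r_bounds (w n)) => /ltW.
by case/andP: (r_bounds (w n)).
Qed.

Lemma lamprodS w n : lamprod w n.+1 = cmul (lam r phi (w 0%N)) (lamprod (Tshift w) n).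
Proof.
elim: n => [|n IH] /=; first by rewrite /cmul /=; congr pair; ring.
by rewrite -[in LHS]/(lamprod w n.+1) IH /cmul /=; congr pair; ring.
Qed.

Lemma sqnorm_lam i : sqnorm (lam r phi i) = r i ^+ 2.
Proof. by rewrite /sqnorm /= !exprMn -mulrDr phi_unit mulr1. Qed.

Lemma sqnorm_lamprod w n : sqnorm (lamprod w n) = contr w n ^+ 2.
Proof.
elim: n => [|n IH] /=; first by rewrite /sqnorm /contr big_ord0 /= expr0n addr0.
by rewrite sqnorm_cmul IH sqnorm_lam contrSr exprMn.
Qed.

Lemma fij_eball i j z : (j < k i)%N -> sqnorm z < Rad ^+ 2 -> sqnorm (fij i j z) < Rad ^+ 2.
Proof.
move=> jk z0.
have /(Rad_closure jk) : closure (fij i j @` eball (0, 0) Rad) (fij i j z).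
  by apply: subset_closure; exists z => //; rewrite /eball /= !subr0.
by rewrite /eball /= !subr0.
Qed.

(** The translation part is the image of the centre of the invariant ball. *)
Lemma translation_bound i j : (j < k i)%N -> sqnorm (t i j) < Rad ^+ 2.
Proof.
move=> jk; have := @fij_eball i j (0, 0) jk.
rewrite (_ : fij i j (0, 0) = t i j).
  by apply; rewrite /sqnorm /= expr0n addr0 exprn_gt0.
by rewrite /Defs.fij /Defs.cadd /cmul /=; case: (t i j) => a b /=; congr pair; ring.
Qed.

Definition cterm w u n := cmul (lamprod w n) (t (w n) (u n)).
Definition cpartial w u n : R * R :=
  (\sum_(0 <= j < n) (cterm w u j).1, \sum_(0 <= j < n) (cterm w u j).2).

Definition dshift u : nat -> nat := fun n => u n.+1.

Lemma valid_dshift w u : valid_digits k w u -> valid_digits k (Tshift w) (dshift u).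
Proof. by move=> h n; exact: h. Qed.

Lemma ctermS w u n : cterm w u n.+1 = cmul (lam r phi (w 0%N)) (cterm (Tshift w) (dshift u) n).
Proof.
by rewrite /cterm lamprodS /cmul /= /dshift /Tshift; congr pair; ring.
Qed.

Lemma cpartialS w u n :
  cpartial w u n.+1 = fij (w 0%N) (u 0%N) (cpartial (Tshift w) (dshift u) n).
Proof.
have T0 : cterm w u 0%N = t (w 0%N) (u 0%N).
  by rewrite /cterm /= /cmul /= !mul1r !mul0r subr0 addr0; case: (t _ _).
rewrite /cpartial !big_nat_recl // T0.
under eq_bigr do rewrite ctermS.
under [X in (_, _ + X)]eq_bigr do rewrite ctermS.
rewrite /Defs.fij /Defs.cadd; move: (lam _ _ _) (cterm _ _) => c v; rewrite /cmul /=.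
by congr pair; rewrite addrC; congr (_ + _); rewrite !mulr_sumr -?sumrB -?big_split.
Qed.

Lemma cpartial_eball w u n : valid_digits k w u -> sqnorm (cpartial w u n) < Rad ^+ 2.
Proof.
elim: n w u => [|n IH] w u uv.
  by rewrite /cpartial !big_nil /sqnorm /= expr0n addr0 exprn_gt0.
rewrite cpartialS; apply: fij_eball; first exact: uv.
by apply: IH; exact: valid_dshift.
Qed.

Lemma cterm_bound w u n : valid_digits k w u ->
  `|(cterm w u n).1| <= Rad * rM ^+ n /\ `|(cterm w u n).2| <= Rad * rM ^+ n.
Proof.
move=> uv; apply: sqnorm_coord.
  by rewrite mulr_ge0 ?exprn_ge0 ?(ltW (rM_gt0 w)) // ltW.
rewrite sqnorm_cmul sqnorm_lamprod exprMn mulrC ler_pM ?sqr_ge0 //.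
- by rewrite addr_ge0 ?sqr_ge0.
- exact/ltW/translation_bound/uv.
- by rewrite ler_pXn2r ?nnegrE ?contr_le ?(ltW (contr_gt0 _ _)) //
    exprn_ge0 // (ltW (rM_gt0 w)).
Qed.

Lemma series_cvg_geometric_bound (v : nat -> R) (s : R) : 0 <= s ->
  (forall n, `|v n| <= Rad * s ^+ n) -> s < 1 ->
  cvgn (fun n => \sum_(0 <= j < n) v j).
Proof.
move=> s0 vb s1; apply: normed_cvg.
apply: (@series_le_cvg _ _ (geometric Rad s)).
- by move=> n /=.
- by move=> n /=; rewrite mulr_ge0 ?exprn_ge0 // ltW.
- exact: vb.
- by apply: is_cvg_geometric_series; rewrite ger0_norm.
Qed.

Lemma cpartial_cvg w u : valid_digits k w u ->
  (fun n => (cpartial w u n).1) @ \oo --> (coding w u).1 /\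
  (fun n => (cpartial w u n).2) @ \oo --> (coding w u).2.
Proof.
move=> uv; split.
  by apply: (@series_cvg_geometric_bound (fun n => (cterm w u n).1) rM);
    [exact/ltW/(rM_gt0 w)|move=> n; exact: (cterm_bound n uv).1|].
by apply: (@series_cvg_geometric_bound (fun n => (cterm w u n).2) rM);
  [exact/ltW/(rM_gt0 w)|move=> n; exact: (cterm_bound n uv).2|].
Qed.

(** Passage to the limit in [cpartialS]; validity of the digits gives the convergence of the two
    series in [coding]. *)
Lemma codingE w u : valid_digits k w u ->
  coding w u = fij (w 0%N) (u 0%N) (coding (Tshift w) (dshift u)).
Proof.
move=> uv; have [c1 c2] := cpartial_cvg uv.
have [d1 d2] := cpartial_cvg (valid_dshift uv).
have e1 : (fun n => (cpartial w u n.+1).1) @ \oo -->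
    (fij (w 0%N) (u 0%N) (coding (Tshift w) (dshift u))).1.
  under eq_cvg do rewrite cpartialS.
  by apply: cvgD; [apply: cvgB; apply: cvgM|]; try exact: cvg_cst.
have e2 : (fun n => (cpartial w u n.+1).2) @ \oo -->
    (fij (w 0%N) (u 0%N) (coding (Tshift w) (dshift u))).2.
  under eq_cvg do rewrite cpartialS.
  by apply: cvgD; [apply: cvgD; apply: cvgM|]; try exact: cvg_cst.
rewrite [LHS]surjective_pairing [RHS]surjective_pairing.
rewrite -cvg_shiftS /= in c1; rewrite -cvg_shiftS /= in c2.
congr pair; first by rewrite -(cvg_lim (@Rhausdorff R) e1) (cvg_lim (@Rhausdorff R) c1).
by rewrite -(cvg_lim (@Rhausdorff R) e2) (cvg_lim (@Rhausdorff R) c2).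
Qed.

Lemma coding_bound w u : valid_digits k w u -> sqnorm (coding w u) <= Rad ^+ 2.
Proof.
move=> uv; have [c1 c2] := cpartial_cvg uv.
have c : (fun n => sqnorm (cpartial w u n)) @ \oo --> sqnorm (coding w u).
  by rewrite /sqnorm; apply: cvgD; under eq_cvg do rewrite expr2; rewrite expr2; exact: cvgM.
rewrite -(cvg_lim _ c) //; apply: limr_le; first by apply/cvg_ex; exists (sqnorm (coding w u)).
by apply: nearW => n; exact/ltW/cpartial_eball.
Qed.

Lemma csub_fij i j z z' : csub (fij i j z) (fij i j z') = cmul (lam r phi i) (csub z z').
Proof. by rewrite /csub /Defs.fij /Defs.cadd /cmul /=; congr pair; ring. Qed.

Lemma coding_close w u u' n : valid_digits k w u -> valid_digits k w u' ->
  (forall j, (j < n)%N -> u j = u' j) ->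
  sqnorm (csub (coding w u) (coding w u')) <= (contr w n * (2 * Rad)) ^+ 2.
Proof.
elim: n w u u' => [|n IH] w u u' uv uv' uu'.
  have := coding_bound uv; have := coding_bound uv'; rewrite /contr big_ord0 mul1r.
  move: (coding w u) (coding w u') => [a b] [c d]; rewrite /sqnorm /csub /= => h h'.
  (* Parallelogram identity: two points of the ball of radius [Rad] are at distance at most
     [2 * Rad]. *)
  have -> : (a - c) ^+ 2 + (b - d) ^+ 2 =
      2 * (a ^+ 2 + b ^+ 2) + 2 * (c ^+ 2 + d ^+ 2) - (a + c) ^+ 2 - (b + d) ^+ 2 by ring.
  have := sqr_ge0 (a + c); have := sqr_ge0 (b + d); rewrite exprMn.
  by move: ((a + c) ^+ 2) ((b + d) ^+ 2) h h' => X Y; lra.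
rewrite (codingE uv) (codingE uv') -uu' // csub_fij sqnorm_cmul sqnorm_lam contrS -mulrA [leRHS]exprMn.
rewrite ler_pM2l; last by rewrite exprn_gt0 //; case/andP: (r_bounds (w 0%N)).
apply: IH; [exact: valid_dshift..|].
by move=> j jn; exact: uu'.
Qed.

End coding.

(** * The random measures *)

Section pullback_outer_measure.
Variables (R : realType) (T S : Type) (om : {outer_measure set T -> \bar R}).
Variables (V : set T) (f : T -> S).

(** Push-forward along [f] restricted to [V]; for [etaw], [V] is the set of valid digit sequences
    and [f] the coding map. *)
Definition pullback_outer (A : set S) : \bar R := om (V `&` f @^-1` A).

Lemma pullback_outer0 : pullback_outer set0 = 0%E.
Proof. by rewrite /pullback_outer preimage_set0 setI0 outer_measure0. Qed.

Lemma pullback_outer_ge0 A : (0 <= pullback_outer A)%E.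
Proof. exact: outer_measure_ge0. Qed.

Lemma le_pullback_outer : {homo pullback_outer : A B / A `<=` B >-> (A <= B)%E}.
Proof. by move=> A B AB; apply: le_outer_measure => u [Vu Au]; split=> //; exact: AB. Qed.

Lemma pullback_outer_sigma_subadditive : sigma_subadditive pullback_outer.
Proof.
move=> F; rewrite /pullback_outer preimage_bigcup setI_bigcupr.
exact: outer_measure_sigma_subadditive.
Qed.

HB.instance Definition _ := isOuterMeasure.Build R S pullback_outer
  pullback_outer0 pullback_outer_ge0 le_pullback_outer pullback_outer_sigma_subadditive.

End pullback_outer_measure.

Section plane.
Variables (R : realType) (I : Type) (k : I -> nat) (r : I -> R) (phi : I -> R * R).
Variables (t : I -> nat -> R * R) (p : I -> nat -> R) (Rad rM : R).
Hypothesis r_bounds : forall i, 0 < r i <= rM.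
Hypothesis rM_lt1 : rM < 1.
Hypothesis phi_unit : forall i, (phi i).1 ^+ 2 + (phi i).2 ^+ 2 = 1.
Hypothesis p_gt0 : forall i j, (j < k i)%N -> 0 < p i j.
Hypothesis p_sum : forall i, \sum_(j < k i) p i j = 1.
Hypothesis Rad_gt0 : 0 < Rad.
Hypothesis Rad_closure : forall i j, (j < k i)%N ->
  closure (fij r phi t i j @` eball (0, 0) Rad) `<=` eball (0, 0) Rad.
Implicit Types (w : nat -> I) (u : nat -> nat) (A B : set (R * R)).

Local Notation coding := (coding r phi t).
Local Notation eta := (etaw k r phi t p).

Definition plane_outer w A : \bar R :=
  digit_outer k p w [set u | valid_digits k w u /\ A (coding w u)].

(** The sets on which [etaw] behaves as a measure. No Borel structure on the plane is used:
    membership is proved for half-planes, and everything else is built from them. *)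
Definition eta_measurable w : set (set (R * R)) := (plane_outer w).-caratheodory.

Lemma etaE w A : eta w A = fine (plane_outer w A).
Proof. by []. Qed.

Lemma plane_outer_is_outer_measure w :
  exists om : {outer_measure set (R * R)%type -> \bar R}, plane_outer w = om.
Proof.
have [om omE] := digit_outer_is_outer_measure p_gt0 w.
exists (pullback_outer om (valid_digits k w) (coding w)); apply/funext => A.
by rewrite /plane_outer -omE.
Qed.

Lemma plane_outer_fin_num w A : plane_outer w A \is a fin_num.
Proof. exact: digit_outer_fin_num. Qed.

Lemma etaK w A : (eta w A)%:E = plane_outer w A.
Proof. by rewrite etaE fineK // plane_outer_fin_num. Qed.

Lemma eta_ge0 w A : 0 <= eta w A.
Proof. by rewrite -lee_fin etaK digit_outer_ge0. Qed.

Lemma eta_le1 w A : eta w A <= 1.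
Proof. by rewrite -lee_fin etaK digit_outer_le1. Qed.

(** The measure is carried by the closed ball of radius [Rad], where all coded points lie, so the
    inclusion is needed only there. *)
Lemma le_eta_supp w A B : (forall z : R * R, sqnorm z <= Rad ^+ 2 -> A z -> B z) ->
  eta w A <= eta w B.
Proof.
move=> AB; rewrite -lee_fin !etaK; apply: le_digit_outer => u [uv Au]; split=> //.
exact: AB (coding_bound r_bounds rM_lt1 phi_unit Rad_gt0 Rad_closure uv) Au.
Qed.

Lemma le_eta w A B : A `<=` B -> eta w A <= eta w B.
Proof. by move=> AB; apply: le_eta_supp => z _; exact: AB. Qed.

Lemma eta_setT w : eta w setT = 1.
Proof.
apply: EFin_inj; rewrite etaK /plane_outer -(digit_outer_valid p_gt0 p_sum w).
by congr (digit_outer _ _ _ _); apply/seteqP; split=> [u []|].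
Qed.

Lemma eta_set0 w : eta w set0 = 0.
Proof.
have [om omE] := plane_outer_is_outer_measure w.
by rewrite etaE omE outer_measure0.
Qed.

Lemma eta_measurableC w A : eta_measurable w A -> eta_measurable w (~` A).
Proof.
rewrite /eta_measurable; have [om ->] := plane_outer_is_outer_measure w.
exact: caratheodory_measurable_setC.
Qed.

Lemma eta_measurableI w A B :
  eta_measurable w A -> eta_measurable w B -> eta_measurable w (A `&` B).
Proof.
rewrite /eta_measurable; have [om ->] := plane_outer_is_outer_measure w.
exact: caratheodory_measurable_setI.
Qed.

Lemma eta_measurable_bigcup w (F : nat -> set (R * R)) :
  (forall n, eta_measurable w (F n)) -> eta_measurable w (\bigcup_n F n).
Proof.
rewrite /eta_measurable; have [om ->] := plane_outer_is_outer_measure w.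
exact: caratheodory_measurable_bigcup.
Qed.

Lemma eta_measurable_set0 w : eta_measurable w set0.
Proof.
rewrite /eta_measurable; have [om ->] := plane_outer_is_outer_measure w.
exact: caratheodory_measurable_set0.
Qed.

Lemma eta_measurable_countable_bigcup w (T : countType) (F : T -> set (R * R)) (D : set T) :
  (forall n, D n -> eta_measurable w (F n)) -> eta_measurable w (\bigcup_(n in D) F n).
Proof.
move=> mF; pose G n := if unpickle n is Some d then [set z | D d /\ F d z] else set0.
rewrite (_ : \bigcup_(n in D) F n = \bigcup_n G n).
  apply: eta_measurable_bigcup => n; rewrite /G; case: unpickle => [d|]; last first.
    exact: eta_measurable_set0.
  have [Dd|nDd] := pselect (D d).
    rewrite (_ : [set z | _ /\ _] = F d); first exact: mF.
    by apply/seteqP; split=> [z []|].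
  rewrite (_ : [set z | _ /\ _] = set0); first exact: eta_measurable_set0.
  by apply/seteqP; split=> [z []|].
apply/seteqP; split=> z.
  by move=> [d Dd Fz]; exists (pickle d) => //; rewrite /G pickleK.
by move=> [n _]; rewrite /G; case: unpickle => // d [Dd Fz]; exists d.
Qed.

Lemma eta_setU w A B : eta_measurable w A -> A `&` B = set0 ->
  eta w (A `|` B) = eta w A + eta w B.
Proof.
move=> mA AB; apply: EFin_inj; rewrite EFinD !etaK (mA (A `|` B)).
congr (plane_outer _ _ + plane_outer _ _)%E; first by rewrite setUK.
by rewrite setIUl setICr set0U; apply/setIidPl => z Bz Az; rewrite -[False]/(set0 z) -AB.
Qed.

(** The outer measure is a measure on its Carathéodory sets; recasting the sequence in
    [caratheodory_type] gives continuity from above. *)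
Lemma eta_cvg_nonincreasing w (F : nat -> set (R * R)) :
  (forall n, eta_measurable w (F n)) ->
  (forall n m, (n <= m)%N -> F m `<=` F n) ->
  eta w (\bigcap_n F n) = 0 -> eta w (F n) @[n --> \oo] --> (0 : R).
Proof.
have [om omE] := plane_outer_is_outer_measure w; rewrite /eta_measurable => mF dF F0.
rewrite omE in mF.
pose F' : (set (caratheodory_type om)) ^nat := F.
have h : (om : set (caratheodory_type om) -> \bar R) (F' n) @[n --> \oo] -->
    (om : set (caratheodory_type om) -> \bar R) (\bigcap_n F' n).
  apply: nonincreasing_cvg_mu.
  - by rewrite /= -omE -etaK ltry.
  - exact: mF.
  - by apply: bigcapT_measurable => n; exact: mF.
  - by move=> n m nm; apply/subsetPset; exact: dF.
move: h; rewrite /= -omE -etaK F0; exact: fine_cvg.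
Qed.

Lemma eta_cvg_nondecreasing w (F : nat -> set (R * R)) :
  (forall n, eta_measurable w (F n)) ->
  (forall n m, (n <= m)%N -> F n `<=` F m) ->
  eta w (F n) @[n --> \oo] --> eta w (\bigcup_n F n).
Proof.
have [om omE] := plane_outer_is_outer_measure w; rewrite /eta_measurable => mF dF.
rewrite omE in mF.
pose F' : (set (caratheodory_type om)) ^nat := F.
have h : (om : set (caratheodory_type om) -> \bar R) (F' n) @[n --> \oo] -->
    (om : set (caratheodory_type om) -> \bar R) (\bigcup_n F' n).
  apply: nondecreasing_cvg_mu.
  - exact: mF.
  - by apply: bigcupT_measurable => n; exact: mF.
  - by move=> n m nm; apply/subsetPset; exact: dF.
move: h; rewrite /= -omE -etaK; exact: fine_cvg.
Qed.

Lemma eta_bigcup_null w (F : nat -> set (R * R)) :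
  (forall n, eta w (F n) = 0) -> eta w (\bigcup_n F n) = 0.
Proof.
have [om omE] := plane_outer_is_outer_measure w => F0.
apply/eqP; rewrite eq_le eta_ge0 andbT -lee_fin etaK omE.
apply: (le_trans (outer_measure_sigma_subadditive om F)).
by rewrite eseries0 // => n _ _; rewrite -omE -etaK F0.
Qed.

(** The argument [w] witnesses that [I] is inhabited, whence [0 < rM]. *)
Lemma rM_expr_small (c e : R) w : 0 < e -> exists n, c * rM ^+ n < e.
Proof.
move=> e0.
have h : c * rM ^+ n @[n --> \oo] --> (c * 0 : R).
  apply: cvgM; first exact: cvg_cst.
  by apply: cvg_expr; rewrite ger0_norm // ltW // (rM_gt0 r_bounds w).
rewrite mulr0 in h.
move/cvgrPdist_lt : h => /(_ e e0)[]; move=> N _ /(_ N (leqnn N)) /=; rewrite sub0r normrN => ?; exists N.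
by apply: le_lt_trans (ler_norm _) _.
Qed.

(** The coding map is continuous on valid sequences, so the preimage of an open half-plane is there
    a countable union of cylinders, namely of the [good] ones. *)
Lemma eta_measurable_halfplane w (a b c : R) :
  eta_measurable w [set y : R * R | a * y.1 + b * y.2 < c].
Proof.
move=> X; set A := [set y : R * R | _].
have [om omE] := digit_outer_is_outer_measure p_gt0 w.
pose V := valid_digits k w.
pose good (s : seq nat) := V `&` dcyl s `<=` coding w @^-1` A.
pose G n := if unpickle n is Some s then [set u | good s /\ dcyl s u] else set0.
have mG : om.-caratheodory (\bigcup_n G n).
  apply: caratheodory_measurable_bigcup => n; rewrite /G; case: unpickle => [s|]; last first.
    exact: caratheodory_measurable_set0.
  have [gs|ngs] := pselect (good s).
    rewrite (_ : [set u | _ /\ _] = dcyl s); last by apply/seteqP; split=> [z []|].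
    by move=> Y; rewrite !omE; exact: dcyl_caratheodory.
  rewrite (_ : [set u | _ /\ _] = set0); first exact: caratheodory_measurable_set0.
  by apply/seteqP; split=> [z []|].
have GA u : V u -> ((\bigcup_n G n) u <-> A (coding w u)).
  move=> Vu; split.
    by move=> [n _]; rewrite /G; case: unpickle => // s [gs su]; exact: gs.
  move=> Au.
  have e0 : 0 < c - (a * (coding w u).1 + b * (coding w u).2) by rewrite subr_gt0.
  (* [n] makes the coded cylinder around [u] so small that the linear form varies by less than its
     distance to [c]. *)
  have [n hn] := rM_expr_small ((`|a| + `|b|) * (2 * Rad)) w e0.
  pose s := mkseq u n.
  have su : dcyl s u by move=> j; rewrite size_mkseq => jn; rewrite nth_mkseq.
  exists (pickle s) => //; rewrite /G pickleK; split=> // u' [Vu' su'].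
  have uu' j : (j < n)%N -> u j = u' j by move=> jn; rewrite su' ?size_mkseq // nth_mkseq.
  have /sqnorm_coord[|c1 c2] := coding_close r_bounds rM_lt1 phi_unit Rad_gt0 Rad_closure
    Vu Vu' uu'.
    by rewrite mulr_ge0 ?(ltW (contr_gt0 r_bounds _ _)) // mulr_ge0 // ltW.
  have le : contr r w n * (2 * Rad) <= rM ^+ n * (2 * Rad).
    by apply: ler_wpM2r (contr_le r_bounds w n); rewrite mulr_ge0 // ltW.
  have d1 := le_trans c1 le; have d2 := le_trans c2 le.
  change (a * (coding w u').1 + b * (coding w u').2 < c).
  have : `|a * ((coding w u).1 - (coding w u').1) + b * ((coding w u).2 - (coding w u').2)|
      < c - (a * (coding w u).1 + b * (coding w u).2).
    apply: le_lt_trans hn; apply: (le_trans (ler_normD _ _)).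
    rewrite !normrM -mulrA [2 * Rad * _]mulrC mulrDl.
    by apply: lerD; apply: ler_wpM2l.
  by rewrite ltr_norml => /andP[+ _]; move: (coding w u) (coding w u') => z z'; lra.
rewrite /plane_outer -!omE (mG [set u | V u /\ X (coding w u)]).
congr (om _ + om _)%E; apply/seteqP; split=> u.
- by move=> [[Vu Xu] Gu]; split=> //; split=> //; apply/(GA _ Vu).
- by move=> [Vu [Xu Au]]; split=> //; apply/(GA _ Vu).
- by move=> [[Vu Xu] Gu]; split=> //; split=> // /(GA _ Vu).
- by move=> [Vu [Xu Au]]; split=> // /(GA _ Vu).
Qed.

Lemma eta_rec w A : eta w A =
  \sum_(j < k (w 0%N)) p (w 0%N) j * eta (Tshift w) [set z | A (fij r phi t (w 0%N) j z)].
Proof.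
apply: EFin_inj; rewrite -sumEFin etaK /plane_outer digit_outer_rec //.
apply: eq_bigr => j _; rewrite EFinM etaK; congr (_ * digit_outer _ _ _ _)%E.
have sv u : valid_digits k w (scons j u) <-> valid_digits k (Tshift w) u.
  by split=> h n; [exact: (h n.+1)|case: n => [|n] //=; exact: h].
apply/seteqP; split=> u [uv].
  by rewrite (codingE r_bounds rM_lt1 phi_unit Rad_gt0 Rad_closure uv); split=> //; apply/sv.
move=> Au; have uv' : valid_digits k w (scons j u) by apply/sv.
by split=> //; rewrite (codingE r_bounds rM_lt1 phi_unit Rad_gt0 Rad_closure uv').
Qed.

(* Weights and translation parts of the level-[N] maps; they all share the linear part
   [lamprod r phi w N]. *)
Fixpoint pieces w (N : nat) : seq (R * (R * R)) :=
  if N is N'.+1 then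
    [seq (p (w 0%N) j * x.1, fij r phi t (w 0%N) j x.2) |
       j <- iota 0 (k (w 0%N)), x <- pieces (Tshift w) N']
  else [:: (1, (0, 0))].

Definition piece_map w N (tau z : R * R) : R * R := cadd (cmul (lamprod r phi w N) z) tau.

(** Iterates [eta_rec], and like it holds for arbitrary sets [A]. *)
Lemma eta_pieces w N A : eta w A =
  \sum_(x <- pieces w N) x.1 * eta (iter N (@Tshift I) w) [set z | A (piece_map w N x.2 z)].
Proof.
elim: N w A => [|N IH] w A.
  rewrite /= big_seq1 /= mul1r; congr (eta _ _); apply/seteqP.
  have E z : piece_map w 0 (0, 0) z = z.
    by rewrite /piece_map /Defs.cadd /cmul /=; case: z => a b /=; congr pair; ring.
  by split=> z /=; rewrite E.
rewrite eta_rec iterSr /= big_allpairs_dep.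
rewrite -(big_mkord xpredT (fun j => p (w 0%N) j * eta (Tshift w) [set z | A (fij r phi t (w 0%N) j z)])).
rewrite /index_iota subn0; apply: eq_bigr => j _.
rewrite IH mulr_sumr; apply: eq_bigr => x _ /=; rewrite mulrA; congr (_ * eta _ _).
have E z : piece_map w N.+1 (fij r phi t (w 0%N) j x.2) z =
    fij r phi t (w 0%N) j (piece_map (Tshift w) N x.2 z).
  by rewrite /piece_map lamprodS /fij /Defs.cadd /cmul /=; congr pair; ring.
by apply/seteqP; split=> z /=; rewrite E.
Qed.

Lemma pieces_ge0 w N x : x \in pieces w N -> 0 <= x.1.
Proof.
elim: N w x => [|N IH] w x /=; first by rewrite inE => /eqP ->.
move=> /allpairsPdep[j [y [+ yN ->]]]; rewrite mem_iota /= add0n => jk.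
by rewrite mulr_ge0 // ?(IH _ _ yN) // ltW // p_gt0.
Qed.

Lemma pieces_sum w N : \sum_(x <- pieces w N) x.1 = 1.
Proof.
by rewrite -(eta_setT w) (eta_pieces w N); apply: eq_bigr => x _; rewrite eta_setT mulr1.
Qed.

Lemma sqnorm_piece_map w N tau z z' :
  sqnorm (csub (piece_map w N tau z) (piece_map w N tau z')) =
  contr r w N ^+ 2 * sqnorm (csub z z').
Proof.
rewrite -(sqnorm_lamprod r phi_unit) -sqnorm_cmul; congr sqnorm.
by rewrite /csub /piece_map /Defs.cadd /cmul /=; congr pair; ring.
Qed.

End plane.

(** * Dyadic squares *)

Section dyadic.
Variable R : realType.
Implicit Types (x y z : R * R) (d e : int * int) (i m : nat).

Lemma dsqP i d x : dsq i d x <-> dcell i x = d.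
Proof.
have p2 : (0 : R) < 2 ^+ i by rewrite exprn_gt0.
rewrite /dsq /dcell /= !ler_pdivrMr // !ltr_pdivlMr // -!floor_eq.
split=> [[/eqP -> /eqP ->]|<-]; [by case: d|by rewrite !eqxx].
Qed.

Lemma dsq_dcell i x : dsq i (dcell i x) x.
Proof. exact/dsqP. Qed.

(** Indices of the squares [m] generations below [d]; the arithmetic is the same whatever the
    generation of [d]. *)
Definition subcells m d : seq (int * int) :=
  [seq (d.1 * (2 ^ m)%:Z + a%:Z, d.2 * (2 ^ m)%:Z + b%:Z) |
     a <- iota 0 (2 ^ m), b <- iota 0 (2 ^ m)].

Lemma mem_subcells m d e : e \in subcells m d =
  (d.1 * (2 ^ m)%:Z <= e.1 < (d.1 + 1) * (2 ^ m)%:Z) &&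
  (d.2 * (2 ^ m)%:Z <= e.2 < (d.2 + 1) * (2 ^ m)%:Z).
Proof.
rewrite /subcells; move: (2 ^ m)%N => M; apply/allpairsP/idP.
  move=> [[a b] /= [+ + ->]]; rewrite !mem_iota /= => aM bM; lia.
case: e d => [e1 e2] [d1 d2] /= h.
exists (absz (e1 - d1 * M%:Z)%R, absz (e2 - d2 * M%:Z)%R); rewrite !mem_iota /=.
by split; [lia|lia|congr pair; lia].
Qed.

Lemma subcells_uniq m d : uniq (subcells m d).
Proof.
apply: allpairs_uniq; rewrite ?iota_uniq // => -[a b] [a' b'] _ _ /= [].
by move=> /addrI[->] /addrI[->].
Qed.

Lemma floor_refine i m (s : R) (n : int) :
  (Num.floor (s * 2 ^+ i) == n) =
  (n * (2 ^ m)%:Z <= Num.floor (s * 2 ^+ (i + m)) < (n + 1) * (2 ^ m)%:Z).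
Proof.
have p2 : (0 : R) < 2 ^+ m by rewrite exprn_gt0.
have E (q : int) : (q * (2 ^ m)%:Z <= Num.floor (s * 2 ^+ (i + m))) =
    (q%:~R <= s * 2 ^+ i).
  rewrite floor_ge_int intrM exprD mulrA -[(2 ^ m)%:Z%:~R]/((2 ^ m)%:R : R) natrX.
  by rewrite ler_pM2r.
by rewrite floor_eq [in RHS]ltNge !E -ltNge.
Qed.

Lemma dcell_subcells i m d x : (dcell (i + m) x \in subcells m d) = (dcell i x == d).
Proof.
by rewrite mem_subcells /= -!floor_refine; case: d => d1 d2; rewrite xpair_eqE.
Qed.

Lemma TD_dsq i m d e x :
  dsq m e (TD i d x) <-> dsq (i + m) (d.1 * (2 ^ m)%:Z + e.1, d.2 * (2 ^ m)%:Z + e.2) x.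
Proof.
have p2 n : (0 : R) < 2 ^+ n by rewrite exprn_gt0.
have M : (2 ^ m)%:Z%:~R = 2 ^+ m :> R by rewrite -natrX.
have E (s : R) (q n : int) :
    (n%:~R * 2 ^- m <= (s - q%:~R * 2 ^- i) * 2 ^+ i < (n + 1)%:~R * 2 ^- m) =
    ((q * (2 ^ m)%:Z + n)%:~R * 2 ^- (i + m) <= s <
      (q * (2 ^ m)%:Z + n + 1)%:~R * 2 ^- (i + m)).
  rewrite mulrBl divfK ?gt_eqF // !ler_pdivrMr // !ltr_pdivlMr // mulrBl exprD.
  rewrite !intrD !intrM M mulrA lerBrDl ltrBlDl addrA.
  by rewrite [X in _ && X](_ : _ = (s * 2 ^+ i * 2 ^+ m < q%:~R * 2 ^+ m + n%:~R + 1)).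
by rewrite /dsq /TD /= !E.
Qed.

Variable K0 : nat.

(** The squares of generation [i] tiling the square from [-K0] to [K0]. With [Rad < K0] they cover
    the ball carrying the measures, so sums over all squares become finite. *)
Definition cells i : seq (int * int) :=
  [seq (a%:Z - (K0 * 2 ^ i)%:Z, b%:Z - (K0 * 2 ^ i)%:Z) |
     a <- iota 0 (K0 * 2 ^ i + K0 * 2 ^ i), b <- iota 0 (K0 * 2 ^ i + K0 * 2 ^ i)].

Lemma mem_cells i d : d \in cells i =
  (- (K0 * 2 ^ i)%:Z <= d.1 < (K0 * 2 ^ i)%:Z) &&
  (- (K0 * 2 ^ i)%:Z <= d.2 < (K0 * 2 ^ i)%:Z).
Proof.
rewrite /cells; move: (K0 * 2 ^ i)%N => M; apply/allpairsP/idP.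
  move=> [[a b] /= [+ + ->]]; rewrite !mem_iota /= => aM bM; lia.
case: d => [e1 e2] /= h.
exists (absz (e1 + M%:Z)%R, absz (e2 + M%:Z)%R); rewrite !mem_iota /=.
by split; [lia|lia|congr pair; lia].
Qed.

Lemma cells_uniq i : uniq (cells i).
Proof.
apply: allpairs_uniq; rewrite ?iota_uniq // => -[a b] [a' b'] _ _ /= [].
by move=> /addIr[->] /addIr[->].
Qed.

Lemma size_cells i : size (cells i) = (K0 * 2 * (K0 * 2) * 4 ^ i)%N.
Proof.
rewrite size_allpairs !size_iota (_ : 4 = 2 * 2)%N // expnMn; nia.
Qed.

Lemma dcell_cells i x (s : R) : 0 <= s -> s < K0%:R -> sqnorm x <= s ^+ 2 ->
  dcell i x \in cells i.
Proof.
move=> s0 sK /(sqnorm_coord s0)[x1 x2].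
have p2 : (0 : R) < 2 ^+ i by rewrite exprn_gt0.
have h (v : R) : `|v| <= s ->
    (- (K0 * 2 ^ i)%:Z <= Num.floor (v * 2 ^+ i) < (K0 * 2 ^ i)%:Z).
  rewrite ler_norml => /andP[v1 v2].
  have M : (K0 * 2 ^ i)%:Z%:~R = K0%:R * 2 ^+ i :> R by rewrite -natrX -natrM.
  rewrite ltNge !floor_ge_int intrN M -ltNge -mulNr ler_pM2r // ltr_pM2r //.
  by apply/andP; split; lra.
by rewrite mem_cells /= !h.
Qed.

Lemma divz_itv (e n : int) (M : nat) : (0 < M)%N ->
  (n * M%:Z <= e < (n + 1) * M%:Z) = (n == (e %/ M%:Z)%Z).
Proof.
move=> M0; have M0' : (M%:Z != 0) by lia.
have := divz_eq e M%:Z; have := modz_ge0 e M0'; have := ltz_pmod e (_ : 0 < M%:Z).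
move=> /(_ ltac:(lia)); move: (e %/ M%:Z)%Z (e %% M%:Z)%Z => q s s1 s0 ->.
apply/idP/eqP => [/andP[h1 h2]|->]; last by apply/andP; split; nia.
have : (n < q + 1) by rewrite -(@ltr_pM2r _ M%:Z) //; nia.
have : (q < n + 1) by rewrite -(@ltr_pM2r _ M%:Z) //; nia.
lia.
Qed.

Lemma mem_subcells_div m d e :
  (e \in subcells m d) = (d == ((e.1 %/ (2 ^ m)%:Z)%Z, (e.2 %/ (2 ^ m)%:Z)%Z)).
Proof.
by rewrite mem_subcells !divz_itv ?expn_gt0 //; case: d => d1 d2; rewrite xpair_eqE.
Qed.

Lemma mem_cells_div i m e :
  (e \in cells (i + m)) = (((e.1 %/ (2 ^ m)%:Z)%Z, (e.2 %/ (2 ^ m)%:Z)%Z) \in cells i).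
Proof.
have h (a : int) : (- (K0 * 2 ^ (i + m))%:Z <= a < (K0 * 2 ^ (i + m))%:Z) =
    (- (K0 * 2 ^ i)%:Z <= (a %/ (2 ^ m)%:Z)%Z < (K0 * 2 ^ i)%:Z).
  rewrite expnD mulnA; move: (K0 * 2 ^ i)%N => L.
  have : (0 < 2 ^ m)%N by rewrite expn_gt0.
  move: (2 ^ m)%N => M M0; have /esym := @divz_itv a (a %/ M%:Z)%Z M M0.
  rewrite eqxx => /esym/andP[]; move: (a %/ M%:Z)%Z => q h1 h2; apply/idP/idP.
    move=> /andP[h3 h4]; apply/andP; split.
      have : (- L%:Z < q + 1) by rewrite -(@ltr_pM2r _ M%:Z) //; nia.
      lia.
    by rewrite -(@ltr_pM2r _ M%:Z) //; nia.
  by move=> /andP[h3 h4]; apply/andP; split; nia.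
by rewrite !mem_cells /= !h.
Qed.

Lemma big_subcells (F : int * int -> R) i m :
  \sum_(e <- cells (i + m)) F e = \sum_(d <- cells i) \sum_(e <- subcells m d) F e.
Proof.
have -> : \sum_(d <- cells i) \sum_(e <- subcells m d) F e =
    \sum_(d <- cells i) \sum_(e <- cells (i + m)) if e \in subcells m d then F e else 0.
  rewrite big_seq [RHS]big_seq; apply: eq_bigr => d dD.
  rewrite -big_mkcond -[RHS]big_filter; apply: perm_big.
  apply: uniq_perm; [exact: subcells_uniq|by rewrite filter_uniq // cells_uniq|].
  move=> e; rewrite mem_filter mem_cells_div mem_subcells_div.
  by case: eqVneq => // <-; rewrite dD.
rewrite exchange_big /= big_seq [RHS]big_seq; apply: eq_bigr => e; rewrite mem_cells_div => eD.
rewrite (bigD1_seq _ eD (cells_uniq i)) /= mem_subcells_div eqxx big1 ?addr0 // => d.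
by rewrite mem_subcells_div => /negbTE ->.
Qed.

End dyadic.

(** * Entropy *)

Section ent.
Variable R : realType.
Implicit Types (q x y : R).

Lemma ln2_gt0 : 0 < ln 2 :> R.
Proof. by rewrite ln_gt0 // ltr1n. Qed.

Lemma entE q : 0 <= q -> ent q = - (q * ln q) / ln 2.
Proof.
rewrite /ent /log2 => q0; case: ifPn => [q0'|_].
  have -> : q = 0 by apply/eqP; rewrite eq_le q0' q0.
  by rewrite mul0r oppr0 mul0r.
by rewrite mulrA mulNr.
Qed.

Lemma ent0 : ent (0 : R) = 0.
Proof. by rewrite /ent lexx. Qed.

Lemma ent_ge0 q : 0 <= q -> q <= 1 -> 0 <= ent q.
Proof.
move=> q0 q1; rewrite entE //; apply: divr_ge0; last exact/ltW/ln2_gt0.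
by rewrite oppr_ge0 mulr_ge0_le0 // ln_le0.
Qed.

(** Removes the normalisation of a conditional mass; the right-hand side contains no quotient by
    [q]. *)
Lemma ent_scale q x : 0 < q -> 0 <= x -> q * ent (x / q) = ent x + x * ln q / ln 2.
Proof.
move=> q0; rewrite le_eqVlt => /predU1P[<-|x0].
  by rewrite mul0r ent0 mulr0 !mul0r addr0.
rewrite !entE ?divr_ge0 ?ltW // ln_div ?posrE //.
have l2 : ln 2 != 0 :> R by rewrite gt_eqF // ln2_gt0.
by field; rewrite l2 gt_eqF.
Qed.

(** The graph of the concave function [ent] lies below its tangent at [y]; this is [ln s <= s - 1]
    at [s = y / x]. All entropy upper bounds below come from a choice of [y]. *)
Lemma ent_tangent x y : 0 <= x -> 0 < y -> ent x <= - (x * ln y) / ln 2 + (y - x) / ln 2.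
Proof.
move=> x0 y0; rewrite entE // -mulrDl ler_pM2r ?invr_gt0 ?ln2_gt0 //.
move: x0; rewrite le_eqVlt => /predU1P[<-|x0]; first by rewrite !mul0r oppr0 add0r addr0 ltW.
have : ln (y / x) <= y / x - 1.
  have yx : 0 < y / x by rewrite divr_gt0.
  have := @le_ln1Dx R (y / x - 1); rewrite addrCA subrr addr0; apply.
  by move: (y / x) yx => v; lra.
rewrite ln_div ?posrE // => h.
have := ler_wpM2l (ltW x0) h; have -> : x * (y / x - 1) = y - x by field; rewrite gt_eqF.
by rewrite mulrBr => h'; lra.
Qed.

(** Jensen's inequality for the jointly concave function [x * log2 (y / x)]. It is homogeneous of
    degree one, so the weights need not sum to 1. This is how the entropy of a mixture dominates the
    average entropy of its parts. *)
Lemma log_sum (T : eqType) (s : seq T) (a x y : T -> R) :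
  (forall u, u \in s -> 0 <= a u) -> (forall u, u \in s -> 0 <= x u <= y u) ->
  forall X Y, X = \sum_(u <- s) a u * x u -> Y = \sum_(u <- s) a u * y u ->
  \sum_(u <- s) a u * (ent (x u) + x u * ln (y u) / ln 2) <= ent X + X * ln Y / ln 2.
Proof.
move=> a0 xy X Y XE YE.
have X0 : 0 <= X.
  rewrite XE big_seq; apply: sumr_ge0 => u us.
  by rewrite mulr_ge0 ?a0 //; case/andP: (xy _ us).
have Y0 : 0 <= Y.
  rewrite YE big_seq; apply: sumr_ge0 => u us.
  by rewrite mulr_ge0 ?a0 //; case/andP: (xy _ us) => /le_trans; apply.
have XY : X <= Y.
  rewrite XE YE big_seq [leRHS]big_seq; apply: ler_sum => u us.
  by rewrite ler_wpM2l ?a0 //; case/andP: (xy _ us).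
move: X0; rewrite le_eqVlt => /predU1P[X0|X0].
  rewrite -X0 ent0 mul0r mul0r addr0 big_seq.
  rewrite big1 // => u us.
  have /eqP : a u * x u = 0.
    apply/eqP; rewrite eq_le; apply/andP; split; last first.
      by rewrite mulr_ge0 ?a0 //; case/andP: (xy _ us).
    rewrite X0 XE (big_rem u us) /= lerDl big_seq; apply: sumr_ge0 => v /mem_rem vs.
    by rewrite mulr_ge0 ?a0 //; case/andP: (xy _ vs).
  by rewrite mulf_eq0 => /orP[/eqP ->|/eqP ->]; [rewrite mul0r|rewrite ent0 !mul0r addr0 mulr0].
have Y1 : 0 < Y by exact: lt_le_trans XY.
have l2 := ln2_gt0.
(* The tangent plane at [(X, Y)] is evaluated at each [(x u, y u)]: its weighted sum is the value at
   [(X, Y)]. Each term is then compared by [ent_tangent] at [X / Y * y u]. *)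
have -> : ent X + X * ln Y / ln 2 =
   \sum_(u <- s) a u * ((x u * (ln Y - ln X)) / ln 2 + (X / Y * y u - x u) / ln 2).
  rewrite (eq_bigr (fun u => (a u * x u) * ((ln Y - ln X) / ln 2 - 1 / ln 2) +
       (a u * y u) * (X / Y / ln 2))); last first.
    by move=> u _; field; rewrite !gt_eqF.
  rewrite big_split /= -!mulr_suml -XE -YE entE ?ltW //.
  by field; rewrite !gt_eqF.
rewrite big_seq [leRHS]big_seq; apply: ler_sum => u us; apply: ler_wpM2l; first exact: a0.
have /andP[x0 xyu] := xy _ us.
move: (x0); rewrite le_eqVlt => /predU1P[x0'|x1].
  rewrite -x0' ent0 !mul0r !add0r subr0; apply: divr_ge0; last exact: ltW.
  by apply: mulr_ge0; [exact/ltW/divr_gt0|exact: le_trans xyu].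
have y1 : 0 < y u by exact: lt_le_trans xyu.
have z0 : 0 < X / Y * y u by rewrite mulr_gt0 // divr_gt0.
have := ent_tangent x0 z0.
rewrite lnM ?posrE ?divr_gt0 // ln_div ?posrE //; move=> h.
rewrite -(lerD2r (- (x u * ln (y u) / ln 2))) addrK.
apply: (le_trans h); rewrite le_eqVlt; apply/orP; left; apply/eqP.
by field; rewrite !gt_eqF.
Qed.

End ent.

(** * Masses of dyadic squares *)

Section cell_masses.
Variables (R : realType) (I : Type) (k : I -> nat) (r : I -> R) (phi : I -> R * R).
Variables (t : I -> nat -> R * R) (p : I -> nat -> R) (Rad rM : R).
Hypothesis r_bounds : forall i, 0 < r i <= rM.
Hypothesis rM_lt1 : rM < 1.
Hypothesis phi_unit : forall i, (phi i).1 ^+ 2 + (phi i).2 ^+ 2 = 1.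
Hypothesis p_gt0 : forall i j, (j < k i)%N -> 0 < p i j.
Hypothesis p_sum : forall i, \sum_(j < k i) p i j = 1.
Hypothesis Rad_gt0 : 0 < Rad.
Hypothesis Rad_closure : forall i j, (j < k i)%N ->
  closure (fij r phi t i j @` eball (0, 0) Rad) `<=` eball (0, 0) Rad.
Variable K0 : nat.
Hypothesis Rad_lt : Rad < K0%:R.
Implicit Types (w : nat -> I) (g : R * R -> R * R).

Local Notation eta := (etaw k r phi t p).
Local Notation eta_measurable := (eta_measurable k r phi t p).
Local Notation cells := (cells K0).

Definition mass w i (d : int * int) : R := eta w (dsq i d).

(** All that measurability needs: preimages of squares under [g] are then cut out by half-planes. *)
Definition affine g := exists a1 b1 c1 a2 b2 c2, forall z,
  g z = (a1 * z.1 + b1 * z.2 + c1, a2 * z.1 + b2 * z.2 + c2).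

Lemma affine_id : affine id.
Proof. by exists 1, 0, 0, 0, 1, 0 => -[a b] /=; congr pair; ring. Qed.

Lemma affine_piece_map w N tau : affine (piece_map r phi w N tau).
Proof.
rewrite /piece_map; case: (lamprod r phi w N) => a b.
exists a, (- b), tau.1, b, a, tau.2 => z; rewrite /Defs.cadd /cmul /=.
by congr pair; ring.
Qed.

Lemma eta_measurable_dsq w g i d : affine g -> eta_measurable w [set z | dsq i d (g z)].
Proof.
move=> [a1 [b1 [c1 [a2 [b2 [c2 gE]]]]]].
have H (a b c lo hi : R) : eta_measurable w [set z : R * R | lo <= a * z.1 + b * z.2 + c < hi].
  rewrite (_ : [set z | _] = ~` [set z : R * R | a * z.1 + b * z.2 < lo - c] `&`
      [set z : R * R | a * z.1 + b * z.2 < hi - c]).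
    by apply: (eta_measurableI p_gt0); [apply: (eta_measurableC p_gt0)|];
      apply: (eta_measurable_halfplane r_bounds rM_lt1 phi_unit p_gt0 p_sum Rad_gt0 Rad_closure).
  apply/seteqP; split=> z /=.
    by move=> /andP[h1 h2]; split; [apply/negP; rewrite -leNgt; lra|lra].
  by move=> [/negP]; rewrite -leNgt => h1 h2; apply/andP; split; lra.
rewrite (_ : [set z | _] =
  [set z : R * R | d.1%:~R * 2 ^- i <= a1 * z.1 + b1 * z.2 + c1 < (d.1 + 1)%:~R * 2 ^- i] `&`
  [set z : R * R | d.2%:~R * 2 ^- i <= a2 * z.1 + b2 * z.2 + c2 < (d.2 + 1)%:~R * 2 ^- i]).
  exact: (eta_measurableI p_gt0).
by apply/seteqP; split=> z /=; rewrite /dsq /= gE.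
Qed.

Lemma eta_dcell_seq w g i (s : seq (int * int)) : affine g -> uniq s ->
  eta w [set z | dcell i (g z) \in s] = \sum_(d <- s) eta w [set z | dsq i d (g z)].
Proof.
move=> ag; elim: s => [|d s IH] /=.
  move=> _; rewrite big_nil -(eta_set0 r phi t p_gt0 w); congr (eta _ _).
  by apply/seteqP; split.
move=> /andP[ds us]; rewrite big_cons -(IH us) -(eta_setU p_gt0).
- congr (eta _ _); apply/seteqP; split=> z /=; rewrite inE.
    by move=> /predU1P[|]; [left; apply/dsqP|right].
  by move=> [/dsqP ->|->]; rewrite ?eqxx ?orbT.
- exact: eta_measurable_dsq.
- by apply/seteqP; split=> // z [/= /dsqP ->]; rewrite (negbTE ds).
Qed.

(** The set is a union of squares, and only those in [cells i] meet the support; finite additivity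
    does the rest. *)
Lemma eta_dcell w i (S : set (int * int)) :
  eta w [set x | S (dcell i x)] = \sum_(d <- cells i | `[< S d >]) mass w i d.
Proof.
have := eta_dcell_seq w i affine_id (filter_uniq (fun d => `[< S d >]) (cells_uniq K0 i)).
rewrite big_filter => <-; apply/eqP; rewrite eq_le; apply/andP; split;
  apply: (le_eta_supp r_bounds rM_lt1 phi_unit p_gt0 Rad_gt0 Rad_closure) => z zR /=;
  rewrite mem_filter.
- by move=> /asboolP ->; apply: dcell_cells zR => //; exact: ltW.
- by move=> /andP[/asboolP].
Qed.

Lemma eta_measurable_dcell w i (S : set (int * int)) :
  eta_measurable w [set x | S (dcell i x)].
Proof.
rewrite (_ : [set x | _] = \bigcup_(d in S) [set x | dsq i d x]).
  apply: (eta_measurable_countable_bigcup p_gt0) => d _.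
  by have := @eta_measurable_dsq w id i d affine_id.
apply/seteqP; split=> x /=.
  by move=> Sx; exists (dcell i x) => //=; exact: dsq_dcell.
by move=> [d Sd /= /dsqP ->].
Qed.

Lemma mass_ge0 w i d : 0 <= mass w i d.
Proof. exact: eta_ge0. Qed.

Lemma mass_le1 w i d : mass w i d <= 1.
Proof. exact: eta_le1. Qed.

Lemma mass_sum w i : \sum_(d <- cells i) mass w i d = 1.
Proof.
have := eta_dcell w i setT; rewrite (eq_bigl xpredT); last by move=> d; exact/asboolP.
by move=> <-; rewrite -(eta_setT r phi t p_gt0 p_sum w); congr (eta _ _); apply/seteqP; split.
Qed.

Lemma eta_dsq_subcells w g i m d : affine g ->
  eta w [set z | dsq i d (g z)] =
  \sum_(e <- subcells m d) eta w [set z | dsq (i + m) e (g z)].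
Proof.
move=> ag; rewrite -eta_dcell_seq ?subcells_uniq //; congr (eta _ _).
by apply/seteqP; split=> z /=; rewrite dcell_subcells; [move=> /dsqP ->|move=> /eqP/dsqP].
Qed.

Lemma mass_subcells w i m d : mass w i d = \sum_(e <- subcells m d) mass w (i + m) e.
Proof. exact: (eta_dsq_subcells w i m d affine_id). Qed.

(* [mass w i d] times the entropy of the rescaled component on the square [d]. *)
Definition cell_ent w m i d : R :=
  \sum_(e <- subcells m d) ent (mass w (i + m) e) - ent (mass w i d).

Lemma cell_entE w m i d : cell_ent w m i d = \sum_(e <- subcells m d)
  (ent (mass w (i + m) e) + mass w (i + m) e * ln (mass w i d) / ln 2).
Proof.
rewrite big_split /= -!mulr_suml -mass_subcells /cell_ent [in LHS](entE (mass_ge0 w i d)).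
by rewrite mulNr opprK.
Qed.

Lemma sub_mass_le w i m d e : e \in subcells m d -> mass w (i + m) e <= mass w i d.
Proof.
move=> es; rewrite (mass_subcells w i m d) (big_rem e) //= lerDl.
by apply: sumr_ge0 => *; exact: mass_ge0.
Qed.

Lemma component_dsq w i m x e :
  component (eta w) x i (dsq m e) =
  if e \in subcells m (0, 0) then
    mass w (i + m) ((dcell i x).1 * (2 ^ m)%:Z + e.1, (dcell i x).2 * (2 ^ m)%:Z + e.2)
      / mass w i (dcell i x) else 0.
Proof.
rewrite /component /mass; set d := dcell i x.
pose e' := (d.1 * (2 ^ m)%:Z + e.1, d.2 * (2 ^ m)%:Z + e.2); rewrite -/e'.
have E : (e \in subcells m (0, 0)) = (e' \in subcells m d).
  by rewrite !mem_subcells /= !mul0r !add0r !mul1r !lerDl !mulrDl !mul1r !ltrD2l.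
rewrite E; case: ifPn => e's.
  congr (eta _ _ / _); apply/seteqP; split=> y /=.
    by move=> [_ /TD_dsq].
  move=> ye; split; last exact/TD_dsq.
  by apply/dsqP/eqP; rewrite -(dcell_subcells i m); move/dsqP: ye => ->.
rewrite (_ : _ `&` _ = set0) ?(eta_set0 r phi t p_gt0 w) ?mul0r //.
apply/seteqP; split=> // y [/dsqP yd /= /TD_dsq/dsqP ye].
by move: e's; rewrite /e' -ye dcell_subcells yd eqxx.
Qed.

Lemma component_entropy w m x i :
  mass w i (dcell i x) * entropy (component (eta w) x i) m = cell_ent w m i (dcell i x).
Proof.
set d := dcell i x; set q := mass w i d.
pose sh (e : int * int) := (d.1 * (2 ^ m)%:Z + e.1, d.2 * (2 ^ m)%:Z + e.2).
have shs : subcells m d = [seq sh e | e <- subcells m (0, 0)].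
  rewrite /subcells map_allpairs /sh /=.
  by apply: eq_allpairs => a b /=; rewrite !mul0r !add0r.
have qe e : e \in subcells m (0, 0) -> 0 <= mass w (i + m) (sh e) <= q.
  move=> es; rewrite mass_ge0 /= sub_mass_le // shs; exact: map_f.
have h01 (e : int * int) : e \in subcells m (0, 0) ->
    0 <= mass w (i + m) (sh e) / q <= 1.
  move=> /qe /andP[h1 h2]; have q0 : 0 <= q by exact: mass_ge0.
  rewrite divr_ge0 //=; move: q0; rewrite le_eqVlt => /predU1P[<-|q0].
    by rewrite invr0 mulr0.
  by rewrite ler_pdivrMr // mul1r.
have -> : entropy (component (eta w) x i) m =
    \sum_(e <- subcells m (0, 0)) ent (mass w (i + m) (sh e) / q).
  rewrite /entropy.
  (* The component gives no mass outside the unit square, so the sum over all index pairs is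
     finite. *)
  rewrite (eq_esum (b := fun e => if e \in [set` subcells m (0, 0)] then
      (ent (mass w (i + m) (sh e) / q))%:E else 0%E)); last first.
    move=> e _; rewrite component_dsq mem_setE; case: ifP => //=.
    by rewrite ent0.
  rewrite -esum_mkcond esum_fset; first by rewrite -fsbig_seq ?subcells_uniq // sumEFin.
    exact: finite_seq.
  by move=> e; rewrite mem_setE => /h01 /andP[h1 h2]; rewrite lee_fin ent_ge0.
have : 0 <= q by exact: mass_ge0.
rewrite /cell_ent -/q shs big_map le_eqVlt => /predU1P[q0|q0].
  (* On a null square all subsquares are null, so both sides vanish whatever the division by zero
     returns. *)
  rewrite -q0 mul0r ent0 subr0 big_seq big1 // => e /qe; rewrite -q0 -eq_le => /eqP <-.
  exact: ent0.
rewrite -[X in X - _](big_map sh xpredT (fun e => ent (mass w (i + m) e))) -shs.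
rewrite -/(cell_ent w m i d) cell_entE shs big_map mulr_sumr big_seq [RHS]big_seq.
by apply: eq_bigr => e /qe /andP[h _]; rewrite ent_scale.
Qed.

Lemma cell_ent_ge0 w m i d : 0 <= cell_ent w m i d.
Proof.
have : 0 <= mass w i d by exact: mass_ge0.
rewrite /cell_ent le_eqVlt => /predU1P[q0|q0].
  rewrite -q0 ent0 subr0 big_seq; apply: sumr_ge0 => e es.
  by rewrite ent_ge0 ?mass_ge0 ?mass_le1.
rewrite -/(cell_ent w m i d) cell_entE big_seq; apply: sumr_ge0 => e es.
rewrite -ent_scale ?mass_ge0 //; apply: mulr_ge0; first exact: ltW.
apply: ent_ge0; first by apply: divr_ge0; exact: mass_ge0.
by rewrite ler_pdivrMr // mul1r sub_mass_le.
Qed.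

Lemma PcompE w n m (alpha eps : R) : (0 < m)%N ->
  Pcomp (eta w) n (fun nu => `|Hm m nu - alpha| < eps) =
  n.+1%:R^-1 * \sum_(0 <= i < n.+1) \sum_(d <- cells i |
    `|cell_ent w m i d - alpha * m%:R * mass w i d| < eps * m%:R * mass w i d) mass w i d.
Proof.
move=> m0; rewrite /Pcomp; congr (_ * _); apply: eq_bigr => i _.
have m0' : 0 < m%:R :> R by rewrite ltr0n.
(* The component depends on [x] only through its square, so the event is a condition on indices. *)
pose S (d : int * int) := exists x, dcell i x = d /\
   `|Hm m (component (eta w) x i) - alpha| < eps.
have compE x y : dcell i x = dcell i y -> component (eta w) x i = component (eta w) y i.
  by rewrite /component => ->.
have -> : [set x | `|Hm m (component (eta w) x i) - alpha| < eps] =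
    [set x | S (dcell i x)].
  apply/seteqP; split=> x /=; first by exists x.
  by move=> [y [/compE ->]].
rewrite eta_dcell big_mkcond [RHS]big_mkcond big_seq [RHS]big_seq; apply: eq_bigr => d _.
have : 0 <= mass w i d by exact: mass_ge0.
rewrite le_eqVlt => /predU1P[<-|q0]; first by rewrite !if_same.
congr (if _ then _ else _).
have key x : dcell i x = d -> (`|Hm m (component (eta w) x i) - alpha| < eps) =
   (`|cell_ent w m i d - alpha * m%:R * mass w i d| < eps * m%:R * mass w i d).
  move=> xd; rewrite -xd -component_entropy xd /Hm.
  move: (entropy _ _) => h.
  have -> : mass w i d * h - alpha * m%:R * mass w i d = (h / m%:R - alpha) * (m%:R * mass w i d).
    by field; rewrite gt_eqF.
  have mq : 0 < m%:R * mass w i d by rewrite mulr_gt0.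
  by rewrite normrM (gtr0_norm mq) -mulrA ltr_pM2r.
apply/asboolP/idP => [[x [/key <-]]//|h].
(* The lower left corner, which belongs to the half-open square. *)
pose x : R * R := (d.1%:~R * 2 ^- i, d.2%:~R * 2 ^- i).
have xd : dcell i x = d.
  have p2 : (2 : R) ^+ i != 0 by rewrite gt_eqF // exprn_gt0.
  by rewrite /dcell /x /= !divfK // !intrKfloor; case: (d).
by exists x; rewrite key.
Qed.

End cell_masses.

(** * Measurability in the environment *)

Section environment.
Variable I : pointedType.
Hypothesis I_fin : finite_set [set: I].

(** Downward induction on the length [m] of a fixed prefix: revealing one more letter splits the set
    into finitely many pieces, because [I] is finite. *)
Lemma measurable_finite_window n (Q : set (Omega I)) :
  (forall w w' : nat -> I, (forall j, (j < n)%N -> w j = w' j) -> Q w -> Q w') ->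
  measurable Q.
Proof.
move=> Qn.
have H (m : nat) (a : nat -> I) : (m <= n)%N -> measurable (Q `&` cylinder m a).
  move=> mn; move E : (n - m)%N => l; elim: l m a mn E => [|l IH] m a mn E.
    have {mn E}-> : m = n by lia.
    have [Qa|nQa] := pselect (Q a).
      rewrite (_ : _ `&` _ = cylinder n a).
        by apply: sub_sigma_algebra; exists n, a.
      by apply/seteqP; split=> [w []|w wa] //; split=> //; apply: (Qn a) => // j /wa.
    rewrite (_ : _ `&` _ = set0); first exact: measurable0.
    by apply/seteqP; split=> [w [Qw wa]|] //; apply: nQa; apply: (Qn w).
  pose upd i : nat -> I := fun j => if j == m then i else a j.
  rewrite (_ : _ `&` _ = \bigcup_(i in [set: I]) (Q `&` cylinder m.+1 (upd i))).
    by apply: fin_bigcup_measurable => // i _; apply: IH; lia.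
  apply/seteqP; split=> w.
    move=> [Qw wa]; exists (w m) => //; split=> // j jm; rewrite /upd.
    by case: eqP => [->//|jm']; apply: wa; lia.
  move=> [i _ [Qw wi]]; split=> // j jm; rewrite wi; last lia.
  by rewrite /upd; case: eqP => // jm'; lia.
have := H 0%N point (leq0n _); rewrite (_ : _ `&` _ = Q) //.
by apply/seteqP; split=> [w []|w] //.
Qed.

Lemma measurable_fun_finite_window d (T : measurableType d) n (f : Omega I -> T) :
  (forall w w' : nat -> I, (forall j, (j < n)%N -> w j = w' j) -> f w = f w') ->
  measurable_fun setT f.
Proof.
move=> fn _ Y mY; rewrite setTI; apply: (@measurable_finite_window n) => w w' ww' /=.
by rewrite (fn w w').
Qed.

Lemma measurable_Tshift : measurable_fun [set: Omega I] (@Tshift I : Omega I -> Omega I).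
Proof.
apply: (measurability (@cylinders I : set (set (Omega I)))) => //.
move=> _ [_ [N [a ->]] <-]; rewrite setTI.
apply: (@measurable_finite_window N.+1) => w w' ww' /= h j jN.
by rewrite /Tshift -ww' //; exact: h.
Qed.

Lemma measurable_iter_Tshift n :
  measurable_fun [set: Omega I] (iter n (@Tshift I) : Omega I -> Omega I).
Proof.
elim: n => [|n IH]; first exact: measurable_id.
exact: (measurableT_comp measurable_Tshift IH).
Qed.

End environment.

Lemma iter_Tshift (I : Type) n (w : nat -> I) j : iter n (@Tshift I) w j = w (n + j)%N.
Proof. by elim: n j => [|n IH] j //=; rewrite /Tshift IH addSnnS. Qed.

Lemma measurable_sum_lt d (X : measurableType d) (R : realType) (T : Type) (s : seq T)
    (f g h : T -> X -> R) :
  (forall x, measurable_fun setT (f x)) -> (forall x, measurable_fun setT (g x)) ->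
  (forall x, measurable_fun setT (h x)) ->
  measurable_fun setT (fun w => \sum_(x <- s | f x w < g x w) h x w).
Proof.
move=> mf mg mh; under eq_fun do rewrite big_mkcond.
apply: measurable_sum => x; apply: measurable_fun_ifT => //.
exact: measurable_fun_ltr.
Qed.

(** * Measurable dependence of the masses of squares on the environment *)

Section mass_measurable.
Variables (R : realType) (I : pointedType) (k : I -> nat) (r : I -> R) (phi : I -> R * R).
Variables (t : I -> nat -> R * R) (p : I -> nat -> R) (Rad rM : R).
Hypothesis r_bounds : forall i, 0 < r i <= rM.
Hypothesis rM_lt1 : rM < 1.
Hypothesis phi_unit : forall i, (phi i).1 ^+ 2 + (phi i).2 ^+ 2 = 1.
Hypothesis p_gt0 : forall i j, (j < k i)%N -> 0 < p i j.
Hypothesis p_sum : forall i, \sum_(j < k i) p i j = 1.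
Hypothesis Rad_gt0 : 0 < Rad.
Hypothesis Rad_closure : forall i j, (j < k i)%N ->
  closure (fij r phi t i j @` eball (0, 0) Rad) `<=` eball (0, 0) Rad.
Hypothesis I_fin : finite_set [set: I].
Variable K0 : nat.
Hypothesis Rad_lt : Rad < K0%:R.
Implicit Types (w : nat -> I).

Local Notation eta := (etaw k r phi t p).
Local Notation mass := (mass k r phi t p).
Local Notation cell_ent := (cell_ent k r phi t p).
Local Notation pieces := (pieces k r phi t p).

(** Open quadrants are exhausted from inside by moving their corner, and half-open squares are
    obtained from them by inclusion and exclusion. *)
Definition quadrant (a b : R) : set (R * R) := [set y | y.1 < a /\ y.2 < b].

Lemma eta_measurable_quadrant w a b : eta_measurable k r phi t p w (quadrant a b).
Proof.
have := @eta_measurable_halfplane _ _ _ _ _ _ _ _ _ r_bounds rM_lt1 phi_unit p_gt0 p_sum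
  Rad_gt0 Rad_closure w => H.
rewrite (_ : quadrant a b = [set y : R * R | 1 * y.1 + 0 * y.2 < a] `&`
  [set y : R * R | 0 * y.1 + 1 * y.2 < b]).
  by apply: (eta_measurableI p_gt0).
by apply/seteqP; split=> y /=; rewrite !mul1r !mul0r addr0 add0r.
Qed.

(** Total weight of the level-[n] pieces whose whole ball lies in [A]; it depends on the first [n]
    letters of [w] only. *)
Definition inner_approx w n (A : set (R * R)) : R :=
  \sum_(x <- pieces w n)
    x.1 * (`[< forall z : R * R, sqnorm z <= Rad ^+ 2 -> A (piece_map r phi w n x.2 z) >])%:R.

Lemma inner_approx_le w n A : inner_approx w n A <= eta w A.
Proof.
rewrite (eta_pieces r_bounds rM_lt1 phi_unit p_gt0 p_sum Rad_gt0 Rad_closure w n A).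
rewrite /inner_approx big_seq [leRHS]big_seq; apply: ler_sum => x xs.
apply: ler_wpM2l; first exact: pieces_ge0 xs.
case: asboolP => [h|_]; last exact: eta_ge0.
rewrite -(eta_setT r phi t p_gt0 p_sum (iter n (@Tshift I) w)).
by apply: (le_eta_supp r_bounds rM_lt1 phi_unit p_gt0 Rad_gt0 Rad_closure) => z zR _; exact: h.
Qed.

(** A level-[n] piece has diameter at most [2 * Rad * rM ^+ n], so a piece that meets the shrunken
    quadrant is contained in the original one. *)
Lemma inner_approx_ge w n a b :
  eta w (quadrant (a - 2 * Rad * rM ^+ n) (b - 2 * Rad * rM ^+ n)) <=
  inner_approx w n (quadrant a b).
Proof.
rewrite (eta_pieces r_bounds rM_lt1 phi_unit p_gt0 p_sum Rad_gt0 Rad_closure w n).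
rewrite /inner_approx big_seq [leRHS]big_seq; apply: ler_sum => x xs.
apply: ler_wpM2l; first exact: pieces_ge0 xs.
case: asboolP => [h|nh]; first exact: eta_le1.
rewrite mulr0n -(eta_set0 r phi t p_gt0 (iter n (@Tshift I) w)).
apply: (le_eta_supp r_bounds rM_lt1 phi_unit p_gt0 Rad_gt0 Rad_closure) => z zR [z1 z2].
apply: nh => z' zR'.
have s0 : 0 <= 2 * Rad * rM ^+ n.
  by rewrite mulr_ge0 ?exprn_ge0 ?(ltW (rM_gt0 r_bounds w)) // mulr_ge0 // ltW.
have : sqnorm (csub (piece_map r phi w n x.2 z') (piece_map r phi w n x.2 z)) <=
    (2 * Rad * rM ^+ n) ^+ 2.
  rewrite (sqnorm_piece_map r phi_unit) mulrC exprMn.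
  apply: ler_pM; rewrite ?sqr_ge0 ?addr_ge0 ?sqr_ge0 //.
    move: zR zR'; rewrite /sqnorm /csub /= => zR zR'.
    have -> : (z'.1 - z.1) ^+ 2 + (z'.2 - z.2) ^+ 2 =
        2 * (z.1 ^+ 2 + z.2 ^+ 2) + 2 * (z'.1 ^+ 2 + z'.2 ^+ 2) -
        (z.1 + z'.1) ^+ 2 - (z.2 + z'.2) ^+ 2 by ring.
    have := sqr_ge0 (z.1 + z'.1); have := sqr_ge0 (z.2 + z'.2); rewrite exprMn.
    by move: ((z.1 + z'.1) ^+ 2) ((z.2 + z'.2) ^+ 2) zR zR' => X Y; lra.
  by rewrite ler_pXn2r ?nnegrE ?(contr_le r_bounds) ?(ltW (contr_gt0 r_bounds _ _)) //
    exprn_ge0 // (ltW (rM_gt0 r_bounds w)).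
move=> /(sqnorm_coord s0).
move: (piece_map r phi w n x.2 z') (piece_map r phi w n x.2 z) z1 z2 => y y' z1 z2 /=[].
by rewrite !ler_norml => /andP[_ h1] /andP[_ h2]; split; lra.
Qed.

Lemma pieces_window n w w' : (forall j, (j < n)%N -> w j = w' j) ->
  pieces w n = pieces w' n.
Proof.
elim: n w w' => [|n IH] w w' ww' //=.
rewrite -ww' // (IH (Tshift w) (Tshift w')) // => j jn; exact: ww'.
Qed.

Lemma lamprod_window n w w' : (forall j, (j < n)%N -> w j = w' j) ->
  lamprod r phi w n = lamprod r phi w' n.
Proof.
by elim: n => [|n IH] ww' //=; rewrite IH ?ww' // => j jn; apply: ww'; exact: ltnW.
Qed.

(** Pointwise limit of the finite-window functions [inner_approx], squeezed between the masses of
    shrunken quadrants and that of the quadrant. *)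
Lemma measurable_eta_quadrant a b :
  measurable_fun [set: Omega I] (fun w : Omega I => eta w (quadrant a b)).
Proof.
apply: (@measurable_fun_cvg _ _ _ _ (fun n (w : Omega I) => inner_approx w n (quadrant a b))).
  move=> n; apply: (@measurable_fun_finite_window _ I_fin _ _ n) => w w' ww'.
  by rewrite /inner_approx (pieces_window ww') /piece_map (lamprod_window ww').
move=> w _.
pose s n : R := 2 * Rad * rM ^+ n.
have rM0 := rM_gt0 r_bounds w.
apply: (@squeeze_cvgr _ _ _ _ (fun n => eta w (quadrant (a - s n) (b - s n)))
    (fun=> eta w (quadrant a b))).
- by apply: nearW => n; rewrite inner_approx_ge inner_approx_le.
- have s_mono n n' : (n <= n')%N -> s n' <= s n.
    move=> nn'; apply: ler_wpM2l; first by rewrite mulr_ge0 // ltW.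
    by apply: ler_wiXn2l => //; exact: ltW.
  rewrite (_ : quadrant a b = \bigcup_n quadrant (a - s n) (b - s n)).
    apply: (eta_cvg_nondecreasing p_gt0) => [n|n n' /s_mono h z []].
      exact: eta_measurable_quadrant.
    by move=> z1 z2; split; lra.
  apply/seteqP; split=> z.
    move=> [z1 z2].
    have e0 : 0 < Num.min (a - z.1) (b - z.2) by rewrite lt_min !subr_gt0 z1 z2.
    have [n hn] := rM_expr_small r_bounds rM_lt1 (2 * Rad) w e0.
    exists n => //; move: hn; rewrite -/(s n) lt_min => /andP[h1 h2].
    by split; lra.
  move=> [n _ [z1 z2]].
  have : 0 <= s n by rewrite mulr_ge0 ?exprn_ge0 ?mulr_ge0 // ltW.
  by split; lra.
- exact: cvg_cst.
Qed.

Lemma measurable_mass i d :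
  measurable_fun [set: Omega I] (fun w : Omega I => mass w i d).
Proof.
pose x1 : R := d.1%:~R * 2 ^- i; pose y1 : R := (d.1 + 1)%:~R * 2 ^- i.
pose x2 : R := d.2%:~R * 2 ^- i; pose y2 : R := (d.2 + 1)%:~R * 2 ^- i.
have p2 : (0 : R) < 2 ^- i by rewrite invr_gt0 exprn_gt0.
have xy1 : x1 <= y1 by rewrite ler_pM2r // ler_int lerDl.
have xy2 : x2 <= y2 by rewrite ler_pM2r // ler_int lerDl.
rewrite (_ : (fun w : Omega I => mass w i d) = (fun w : Omega I =>
  (eta w (quadrant y1 y2) - eta w (quadrant x1 y2)) -
  (eta w (quadrant y1 x2) - eta w (quadrant x1 x2)))).
  by apply: measurable_funB; apply: measurable_funB; exact: measurable_eta_quadrant.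
apply/funext => w.
have mQ a b : eta_measurable k r phi t p w (quadrant a b) by exact: eta_measurable_quadrant.
have strip b : eta w (quadrant y1 b) =
    eta w (quadrant x1 b) + eta w [set z | x1 <= z.1 < y1 /\ z.2 < b].
  rewrite -(eta_setU p_gt0) //.
    congr (eta _ _); apply/seteqP; split=> z.
      move=> [z1 z2]; have [zx|zx] := ltP z.1 x1; first by left.
      by right; split=> //; rewrite zx.
    by move=> [[z1 z2]|[/andP[z1 z1'] z2]]; split=> //; exact: lt_le_trans xy1.
  by apply/seteqP; split=> // z [[z1 _] [/andP[/(lt_le_trans z1)]]]; rewrite ltxx.
have : eta w [set z | x1 <= z.1 < y1 /\ z.2 < y2] =
    eta w [set z | x1 <= z.1 < y1 /\ z.2 < x2] + mass w i d.
  rewrite -(eta_setU p_gt0) //.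
  - congr (eta _ _); apply/seteqP; split=> z.
      move=> [z1 z2]; have [zx|zx] := ltP z.2 x2; first by left.
      by right; split=> //; rewrite zx.
    by move=> [[z1 z2]|[z1 /andP[z2 z2']]]; split=> //; exact: lt_le_trans xy2.
  - rewrite (_ : [set z | _] = quadrant y1 x2 `&` ~` quadrant x1 x2).
      by apply: (eta_measurableI p_gt0) => //; exact: (eta_measurableC p_gt0).
    apply/seteqP; split=> z.
      move=> [/andP[z1 z1'] z2]; split=> // -[/lt_geF]; by rewrite z1.
    move=> [[z1 z2] h]; split=> //; rewrite z1 andbT leNgt; apply/negP => h'.
    exact: h.
  - by apply/seteqP; split=> // z [[_ z1] [_ /andP[/(lt_le_trans z1)]]]; rewrite ltxx.
by rewrite !strip; lra.
Qed.

Lemma measurable_ent_mass i d :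
  measurable_fun [set: Omega I] (fun w : Omega I => ent (mass w i d)).
Proof.
rewrite (_ : (fun w => _) = (fun w : Omega I => - (mass w i d * ln (mass w i d)) * (ln 2)^-1)).
  apply: measurable_funM; last exact: measurable_cst.
  apply: measurableT_comp => //; apply: measurable_funM; first exact: measurable_mass.
  apply: (measurableT_comp (@measurable_ln R)); exact: measurable_mass.
by apply/funext => w; rewrite entE // mass_ge0.
Qed.

Lemma measurable_cell_ent m i d :
  measurable_fun [set: Omega I] (fun w : Omega I => cell_ent w m i d).
Proof.
apply: measurable_funB; last exact: measurable_ent_mass.
by apply: measurable_sum => e; exact: measurable_ent_mass.
Qed.

Lemma measurable_Pcomp n m (alpha eps : R) : (0 < m)%N ->
  measurable_fun [set: Omega I] (fun w : Omega I =>
    Pcomp (eta w) n (fun nu => `|Hm m nu - alpha| < eps)).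
Proof.
move=> m0.
rewrite (_ : (fun w => _) = (fun w : Omega I => n.+1%:R^-1 *
  \sum_(0 <= i < n.+1) \sum_(d <- cells K0 i |
    `|cell_ent w m i d - alpha * m%:R * mass w i d| < eps * m%:R * mass w i d) mass w i d));
  last by apply/funext => w; rewrite (PcompE r_bounds rM_lt1 phi_unit p_gt0 p_sum Rad_gt0
    Rad_closure Rad_lt).
apply: measurable_funM; first exact: measurable_cst.
apply: measurable_sum => i; apply: measurable_sum_lt => d.
- apply: measurableT_comp => //; apply: measurable_funB; first exact: measurable_cell_ent.
  by apply: measurable_funM; [exact: measurable_cst|exact: measurable_mass].
- by apply: measurable_funM; [exact: measurable_cst|exact: measurable_mass].
- exact: measurable_mass.
Qed.

End mass_measurable.

(** * Ergodic averages and stopping times *)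

(** All elements of [S] lie in the window of length [K] that starts at the least one. *)
Lemma count_window (S : pred nat) (K M : nat) :
  (forall a b, S a -> S b -> (a <= b)%N -> (b < a + K)%N) -> (count S (iota 0 M) <= K)%N.
Proof.
move=> SK; rewrite -size_filter.
have [[a Sa]|nS] := pselect (exists a, S a); last first.
  rewrite (@eq_in_filter _ _ pred0) ?filter_pred0 // => a _.
  by apply/negbTE/negP => Sa; apply: nS; exists a.
have [c Sc cmin] := ex_minnP (ex_intro _ a Sa).
rewrite -(size_iota c K); apply: uniq_leq_size; first by rewrite filter_uniq ?iota_uniq.
by move=> b; rewrite mem_filter => /andP[Sb _]; rewrite mem_iota cmin //= SK // cmin.
Qed.

Section sum_indic.
Context d (T : measurableType d) (R : realType) (P : probability T R).

Lemma sum_indic_le (n m : nat) (A B : nat -> set T) (c : R) : 0 <= c ->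
  (forall j, measurable (A j)) -> (forall j, measurable (B j)) ->
  (forall w, c * \sum_(0 <= j < n) \1_(A j) w <= \sum_(0 <= j < m) \1_(B j) w) ->
  (c%:E * \sum_(0 <= j < n) P (A j) <= \sum_(0 <= j < m) P (B j))%E.
Proof.
move=> c0 mA mB AB.
have E (s : nat) (F : nat -> set T) : (forall j, measurable (F j)) ->
    (\sum_(0 <= j < s) P (F j) = \int[P]_w (\sum_(0 <= j < s) \1_(F j) w)%:E)%E.
  move=> mF; under [RHS]eq_integral do rewrite -sumEFin.
  rewrite ge0_integral_sum //; last first.
    by move=> j; apply/measurable_EFinP; exact: measurable_indic.
  by apply: eq_bigr => j _; rewrite integral_indic // setIT.
have mS (s : nat) (F : nat -> set T) : (forall j, measurable (F j)) ->
    measurable_fun setT (fun w => (\sum_(0 <= j < s) \1_(F j) w : R)%:E).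
  move=> mF; apply/measurable_EFinP; apply: measurable_sum => j; exact: measurable_indic.
have S0 (s : nat) (F : nat -> set T) w : 0 <= \sum_(0 <= j < s) \1_(F j) w :> R.
  by apply: sumr_ge0.
rewrite !E // -ge0_integralZl //; last 2 first.
- exact: mS.
- by move=> w _; rewrite lee_fin.
apply: ge0_le_integral => //.
- by move=> w _; rewrite mule_ge0 ?lee_fin.
- by apply: measurable_funeM; exact: mS.
- exact: mS.
- by move=> w _; rewrite -EFinM lee_fin.
Qed.

End sum_indic.

Section maximal.
Variables (R : realType) (b : nat -> R) (lambda : R) (M : nat).
Hypothesis b_ge0 : forall j, 0 <= b j.
Hypothesis lambda_ge0 : 0 <= lambda.

Definition exceeds (j : nat) : Prop :=
  exists n, (0 < n <= M)%N /\ lambda * n%:R < \sum_(j <= i < j + n) b i.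

(** Greedy covering: from an exceeding index jump over its block, whose sum pays for every index
    inside; from any other index advance by one. The extra [M] terms on the right allow the last
    block to overrun. *)
Lemma exceeds_count L a :
  lambda * \sum_(a <= j < a + L) (`[< exceeds j >])%:R <= \sum_(a <= j < a + L + M) b j.
Proof.
have b0 x y : 0 <= \sum_(x <= j < y) b j by exact: sumr_ge0.
have cat x y z : (x <= y)%N -> (y <= z)%N ->
    \sum_(x <= j < z) b j = \sum_(x <= j < y) b j + \sum_(y <= j < z) b j.
  by move=> xy yz; rewrite (big_cat_nat xy yz).
elim/ltn_ind: L a => -[|L] IH a.
  by rewrite addn0 big_geq // mulr0.
have [[n [/andP[n0 nM] hn]]|na] := pselect (exceeds a).
  have cnt x y : (x <= y)%N -> \sum_(x <= j < y) (`[< exceeds j >])%:R <= (y - x)%:R :> R.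
    move=> xy; rewrite -[leRHS]mulr1 mulr_natl -sumr_const_nat; apply: ler_sum => j _.
    by case: asboolP.
  have [Ln|nL] := leqP L.+1 n.
    apply: (@le_trans _ _ (lambda * n%:R)).
      rewrite ler_wpM2l //; apply: (le_trans (cnt _ _ _)); first lia.
      by rewrite ler_nat; lia.
    apply: (le_trans (ltW hn)); rewrite [leRHS](cat _ (a + n)%N) ?lerDl //; lia.
  have := IH (L.+1 - n)%N ltac:(lia) (a + n)%N.
  have -> : (a + n + (L.+1 - n) = a + L.+1)%N by lia.
  move=> h.
  rewrite (@big_cat_nat _ _ _ (a + n)%N) /=; [|lia|lia].
  rewrite mulrDr (cat a (a + n)%N (a + L.+1 + M)%N); [|lia|lia].
  apply: lerD => //; apply: le_trans (ltW hn); rewrite ler_wpM2l //.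
  by apply: (le_trans (cnt _ _ _)); [lia|rewrite ler_nat; lia].
rewrite big_ltn; last lia.
rewrite asboolF // add0r.
have := IH L ltac:(lia) a.+1; have -> : (a.+1 + L = a + L.+1)%N by lia.
move=> /le_trans; apply.
by rewrite [leRHS]big_ltn ?lerDr //; lia.
Qed.

End maximal.

Section ergodic.
Variables (R : realType) (I : pointedType) (P : probability (Omega I) R).
Hypothesis I_fin : finite_set [set: I].
Hypothesis P_inv : forall A : set (Omega I), measurable A -> P (@Tshift I @^-1` A) = P A.
Hypothesis P_erg : forall A : set (Omega I), measurable A -> @Tshift I @^-1` A = A ->
  P A = 0%E \/ P A = 1%E.

Local Notation T := (@Tshift I).

Lemma measurable_iter_preimage n (A : set (Omega I)) : measurable A ->
  measurable (iter n T @^-1` A : set (Omega I)).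
Proof.
by move=> mA; have := measurable_iter_Tshift I_fin n measurableT mA; rewrite setTI.
Qed.

Lemma P_iter n (A : set (Omega I)) : measurable A -> P (iter n T @^-1` A) = P A.
Proof.
move=> mA; elim: n => [|n IH] //.
rewrite -IH -[RHS]P_inv; last exact: measurable_iter_preimage.
by congr (P _); apply/seteqP; split=> w /=; rewrite -iterSr.
Qed.

Definition visits (B : set (Omega I)) (n : nat) (w : Omega I) : R :=
  \sum_(0 <= i < n) \1_B (iter i T w).

Lemma measurable_visits (B : set (Omega I)) n : measurable B ->
  measurable_fun [set: Omega I] (visits B n).
Proof.
move=> mB; apply: measurable_sum => i.
apply: (measurableT_comp (measurable_indic mB)); exact: measurable_iter_Tshift.
Qed.

Lemma measurable_visits_gt (B : set (Omega I)) n (c : R) : measurable B ->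
  measurable [set w : Omega I | c < visits B n w].
Proof.
move=> mB; have := measurable_visits n mB measurableT (measurable_itv `]c, +oo[).
rewrite setTI (_ : visits B n @^-1` _ = [set w : Omega I | c < visits B n w]) //.
by apply/seteqP; split=> w /=; rewrite in_itv /= andbT.
Qed.

(** Transference: [exceeds_count] along an orbit of length [L], integrated with the invariance of
    [P], gives the inequality up to the factor [(L + M) / L]; then [L] grows with [M] fixed. *)
Lemma maximal_ergodic (B : set (Omega I)) (lambda : R) (M : nat) :
  measurable B -> 0 <= lambda ->
  (lambda%:E * P [set w : Omega I | exists n, (0 < n <= M)%N /\
    (lambda * n%:R < visits B n w)%R] <= P B)%E.
Proof.
move=> mB l0; set F := [set w : Omega I | _].
have mF : measurable F.
  rewrite (_ : F = \bigcup_(n in [set n | (0 < n <= M)%N])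
      [set w : Omega I | lambda * n%:R < visits B n w]).
    by apply: bigcup_measurable => n _; exact: measurable_visits_gt.
  by apply/seteqP; split=> w; [move=> [n [h1 h2]]; exists n|move=> [n h1 h2]; exists n].
have H L : (lambda%:E * (L%:R%:E * P F) <= (L + M)%:R%:E * P B)%E.
  have := @sum_indic_le _ _ _ P L (L + M) (fun j => iter j T @^-1` F)
    (fun j => iter j T @^-1` B) lambda l0.
  have E s (A : set (Omega I)) : measurable A ->
      (\sum_(0 <= j < s) P (iter j T @^-1` A) = s%:R%:E * P A)%E.
    move=> mA; elim: s => [|s IH]; first by rewrite big_geq // mul0e.
    by rewrite big_nat_recr //= IH P_iter // -natr1 EFinD ge0_muleDl ?mul1e ?lee_fin.
  rewrite !E //; apply.
  - by move=> j; exact: measurable_iter_preimage.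
  - by move=> j; exact: measurable_iter_preimage.
  move=> w.
  have := @exceeds_count R (fun j => \1_B (iter j T w)) lambda M _ l0 L 0.
  rewrite !add0n => h; apply: le_trans (h _); last by move=> j.
  apply: ler_wpM2l => //; apply: ler_sum => j _.
  case: asboolP => [_|nex]; first by rewrite /indic lern1 leq_b1.
  rewrite /indic (_ : (w \in _) = false) //; apply/negbTE/negP; rewrite in_setE.
  move=> -[n [hn1 hn2]]; apply: nex; exists n; split=> //; move: hn2; rewrite /visits.
  rewrite -{2}[j]add0n big_addn addKn.
  by under [X in _ -> _ < X]eq_bigr do rewrite iterD.
move: H; rewrite -(fineK (fin_num_measure P F mF)) -(fineK (fin_num_measure P B mB)).
move: (fine (P F)) (fine (P B)) => f b H.
rewrite -EFinM lee_fin leNgt; apply/negP => bf.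
have df : 0 < lambda * f - b by rewrite subr_gt0.
have [L hL] : exists L : nat, M%:R * b / (lambda * f - b) < L%:R.
  by exists (Num.truncn (M%:R * b / (lambda * f - b))).+1; exact: truncnS_gt.
have := H L; rewrite -!EFinM lee_fin natrD => h.
move: hL; rewrite ltr_pdivrMr // => hL.
by rewrite mulrBr mulrCA in hL; lra.
Qed.

(* The event that [visits B n - lambda n] is unbounded is exactly invariant, and the
   maximal inequality bounds its probability by [P B / lambda < 1]. *)
Lemma visits_bound (B : set (Omega I)) (lambda : R) : measurable B -> (P B < lambda%:E)%E ->
  {ae P, forall w : Omega I, exists K : nat, forall n, visits B n w <= lambda * n%:R + K%:R}.
Proof.
move=> mB Bl.
have l0 : 0 < lambda by rewrite -lte_fin (le_lt_trans _ Bl).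
pose E : set (Omega I) := [set w | forall K : nat, exists n, lambda * n%:R + K%:R < visits B n w].
have mE : measurable E.
  rewrite (_ : E = \bigcap_K \bigcup_n [set w : Omega I | lambda * n%:R + K%:R < visits B n w]).
    apply: bigcapT_measurable => K; apply: bigcupT_measurable => n.
    exact: measurable_visits_gt.
  apply/seteqP; split=> w.
    by move=> Ew K _; have [n hn] := Ew K; exists n.
  by move=> Ew K; have [n _ hn] := Ew K Logic.I; exists n.
have indic01 (w : Omega I) : (0 <= \1_B w :> R) && (\1_B w <= 1 :> R).
  by rewrite /indic ler0n lern1 leq_b1.
have visitsS n (w : Omega I) : visits B n.+1 w = \1_B w + visits B n (T w).
  rewrite /visits big_nat_recl //; congr (_ + _); apply: eq_bigr => i _.
  by rewrite -iterSr.
have invE : T @^-1` E = E.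
  apply/seteqP; split=> w /= Ew K.
    (* One more step raises the threshold by [lambda], which the surplus [(truncn lambda).+1] pays
       for. *)
    have [n hn] := Ew (K + (Num.truncn lambda).+1)%N; exists n.+1; rewrite visitsS.
    have /andP[i0 i1] := indic01 w; have := truncnS_gt lambda.
    by move: hn; rewrite natrD -[n.+1%:R]natr1 mulrDr mulr1 => *; lra.
  (* Dropping the first point loses at most one visit, hence [K.+1]. *)
  have [n hn] := Ew K.+1; case: n hn => [|n] hn.
    by exfalso; move: hn; rewrite /visits big_geq // mulr0 add0r ltrn0.
  exists n; move: hn; rewrite visitsS -!natr1.
  by have /andP[i0 i1] := indic01 w; rewrite mulrDr mulr1 => *; lra.
pose F M : set (Omega I) := [set w | exists n, (0 < n <= M)%N /\ lambda * n%:R < visits B n w].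
have mF M : measurable (F M).
  rewrite (_ : F M = \bigcup_(n in [set n | (0 < n <= M)%N])
      [set w : Omega I | lambda * n%:R < visits B n w]).
    by apply: bigcup_measurable => n _; exact: measurable_visits_gt.
  by apply/seteqP; split=> w; [move=> [n [h1 h2]]; exists n|move=> [n h1 h2]; exists n].
have PF : (P (\bigcup_M F M) <= (lambda^-1)%:E * P B)%E.
  have cv : P (F M) @[M --> \oo] --> P (\bigcup_M F M).
    apply: nondecreasing_cvg_mu => //; first exact: bigcupT_measurable.
    move=> M M' MM'; apply/subsetPset => w [n [h1 h2]]; exists n; split=> //; lia.
  rewrite -(cvg_lim _ cv) //; apply: lime_le; first by apply/cvg_ex; eexists; exact: cv.
  apply: nearW => M; rewrite muleC lee_pdivlMr // muleC.
  exact: (maximal_ergodic M mB (ltW l0)).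
have EF : E `<=` \bigcup_M F M.
  move=> w Ew; have [n hn] := Ew 0%N; exists n => //; exists n; rewrite addr0 in hn; split=> //.
  rewrite leqnn andbT lt0n; apply/eqP => n0; move: hn.
  by rewrite n0 /visits big_geq // mulr0 ltxx.
have E0 : P E = 0%E.
  have [//|E1] := P_erg mE invE; exfalso.
  have : (P E <= (lambda^-1)%:E * P B)%E.
    by apply: le_trans PF; apply: le_measure; rewrite ?inE //; exact: bigcupT_measurable.
  rewrite E1 muleC lee_pdivlMr // mul1e leNgt => /negP; exact.
exists E; split=> // w /= /forallNP h K.
by have /existsNP[n /negP] := h K; rewrite -ltNge; exists n.
Qed.

(** * The stopping time [nprime] and the law of the environment seen from it *)

Section stopping.
Variables (r : I -> R) (rm rM Rad : R).
Hypothesis rm_gt0 : 0 < rm.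
Hypothesis r_ge : forall i, rm <= r i.
Hypothesis r_bounds : forall i, 0 < r i <= rM.
Hypothesis rM_lt1 : rM < 1.
Hypothesis Rad_gt0 : 0 < Rad.

Local Notation np := (nprime Rad r).

Lemma expr_rM_small (c e : R) : 0 < e -> exists n, c * rM ^+ n < e.
Proof. exact: (rM_expr_small r_bounds rM_lt1 c (fun=> point)). Qed.

Definition small_at n (w : nat -> I) N := 2 * Rad * contr r w N <= 2 ^- n.

Lemma small_at_exists n : exists M, forall w : nat -> I, small_at n w M.
Proof.
have e0 : (0 : R) < 2 ^- n by rewrite invr_gt0 exprn_gt0.
have [M hM] := expr_rM_small (2 * Rad) e0.
exists M => w; apply: le_trans (ltW hM); apply: ler_wpM2l; first by rewrite mulr_ge0 // ltW.
exact: (contr_le r_bounds).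
Qed.

(** The products of contractions tend to 0, so the search in [nprime] succeeds and its default value
    is never taken. *)
Lemma nprimeP n (w : nat -> I) :
  small_at n w (np n w) /\ forall N, small_at n w N -> (np n w <= N)%N.
Proof.
rewrite /nprime; case: pselect => [h|[]]; last first.
  by have [M hM] := small_at_exists n; exists M; apply/asboolP; exact: hM.
by case: ex_minnP => N /asboolP hN min; split=> // N' hN'; apply: min; apply/asboolP.
Qed.

Lemma contr_window n (w w' : nat -> I) : (forall j, (j < n)%N -> w j = w' j) ->
  contr r w n = contr r w' n.
Proof. by move=> ww'; apply: eq_bigr => j _; rewrite ww'. Qed.

(** The stopping time property: whether [nprime] equals [N] is decided by the first [N] letters. *)
Lemma nprime_window n (w w' : nat -> I) : (forall j, (j < np n w)%N -> w j = w' j) ->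
  np n w = np n w'.
Proof.
move=> ww'; have [h1 h2] := nprimeP n w; have [h1' h2'] := nprimeP n w'.
have le : (np n w' <= np n w)%N by apply: h2'; rewrite /small_at -(contr_window ww').
apply/eqP; rewrite eqn_leq le andbT; apply: h2; rewrite /small_at.
rewrite (@contr_window _ w w') // => j jn; apply: ww'; exact: leq_trans le.
Qed.

(* Read backwards from a fixed time [M], the products of the [r]'s form a sequence that
   decreases geometrically, hence takes values in a fixed multiplicative window boundedly
   often. *)
Lemma nprime_multiplicity : exists K : nat, forall n M (w : nat -> I),
  (count (fun N => np n (iter (M - N) T w) == N) (iota 0 M.+1) <= K)%N.
Proof.
(* [K'] contractions shrink by more than the factor [rm], the width of the window that minimality
   allows for the product. *)
have [K' hK'] := expr_rM_small 1 rm_gt0; rewrite mul1r in hK'.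
exists K'.+1 => n M w.
have c0 : 0 < 2 * Rad by rewrite mulr_gt0.
pose S N := np n (iter (M - N) T w) == N.
(* [N = 0] is counted apart: minimality bounds the product from below only through the preceding
   index. This is the extra 1 in [K'.+1]. *)
have -> : iota 0 M.+1 = 0%N :: iota 1 M by [].
rewrite /= -(add1n K'); apply: leq_add; first exact: leq_b1.
have -> : count S (iota 1 M) = count (fun N => (0 < N <= M)%N && S N) (iota 0 M.+1).
  rewrite /= add0n; apply: eq_in_count => N; rewrite mem_iota => h.
  by rewrite (_ : (0 < N <= M)%N) //; lia.
apply: count_window => a b /andP[aM Sa] /andP[bM Sb]; rewrite leq_eqVlt => /predU1P[<-|ab].
  rewrite -[ltnLHS]addn0 ltn_add2l lt0n; apply/eqP => K0; move: hK'.
  rewrite K0 expr0 => /(lt_le_trans)/(_ (r_ge point)).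
  by case/andP: (r_bounds point) => _ /lt_le_trans h /h /lt_trans /(_ rM_lt1); rewrite ltxx.
rewrite ltnNge; apply/negP => hab.
have [ha _] := nprimeP n (iter (M - a) T w); rewrite (eqP Sa) in ha.
have [_ hb] := nprimeP n (iter (M - b) T w); rewrite (eqP Sb) in hb.
have : ~ small_at n (iter (M - b) T w) b.-1 by move=> /hb; lia.
rewrite /small_at => /negP; rewrite -ltNge => hb'.
(* Both blocks end at time [M], so the one of length [b] is a block of length [b - a] followed by
   the one of length [a]. *)
have cb : contr r (iter (M - b) T w) b =
    contr r (iter (M - b) T w) (b - a) * contr r (iter (M - a) T w) a.
  have cE v m : contr r v m = \prod_(0 <= j < m) r (v j) by rewrite big_mkord.
  rewrite !cE (@big_cat_nat _ _ _ (b - a)%N) //=; last lia.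
  congr (_ * _); rewrite -{1}[(b - a)%N]add0n big_addn (_ : (b - (b - a))%N = a); last lia.
  apply: eq_bigr => i _; rewrite !iter_Tshift; congr (r (w _)); lia.
have cb' : contr r (iter (M - b) T w) b =
    contr r (iter (M - b) T w) b.-1 * r (iter (M - b) T w b.-1).
  by rewrite -contrSr prednK //; lia.
have h1 : 2 * Rad * contr r (iter (M - b) T w) b <= rM ^+ K' * 2 ^- n.
  rewrite cb mulrCA; apply: ler_pM => //.
  - exact/ltW/(contr_gt0 r_bounds).
  - by rewrite mulr_ge0 ?(ltW c0) // (ltW (contr_gt0 r_bounds _ _)).
  - apply: (le_trans (contr_le r_bounds _ _)); apply: ler_wiXn2l; rewrite ?ltW //.
      exact: (rM_gt0 r_bounds w).
    lia.
have h2 : 2 ^- n * rm < 2 * Rad * contr r (iter (M - b) T w) b.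
  rewrite cb' mulrA; apply: (@lt_le_trans _ _ (2 * Rad * contr r (iter (M - b) T w) b.-1 * rm)).
    by rewrite ltr_pM2r.
  by rewrite ler_pM2l // mulr_gt0 // (contr_gt0 r_bounds).
have p2 : (0 : R) < 2 ^- n by rewrite invr_gt0 exprn_gt0.
have := lt_le_trans h2 h1; rewrite mulrC ltr_pM2r // => /lt_trans/(_ hK').
by rewrite ltxx.
Qed.

(** The event splits according to the value [N] of the stopping time. By invariance each part may be
    pulled back by [M - N] steps; all parts then lie in the preimage of [E] at the common time [M],
    and [nprime_multiplicity] bounds their overlap by [K]. *)
Lemma nprime_dominated : exists K : nat, forall n (E : set (Omega I)), measurable E ->
  measurable [set w : Omega I | E (iter (np n w) T w)] /\
  (P [set w : Omega I | E (iter (np n w) T w)] <= K%:R%:E * P E)%E.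
Proof.
have [K hK] := nprime_multiplicity; exists K => n E mE.
have [M hM] := small_at_exists n.
have npM w : (np n w <= M)%N by apply: (nprimeP n w).2; exact: hM.
pose A N : set (Omega I) := [set w | np n w = N] `&` iter N T @^-1` E.
have mA N : measurable (A N).
  apply: measurableI; last exact: measurable_iter_preimage.
  apply: (@measurable_finite_window _ I_fin N) => w w' ww' /= wN.
  by rewrite -(@nprime_window n w w') // wN.
have EA : [set w : Omega I | E (iter (np n w) T w)] = \big[setU/set0]_(N < M.+1) A N.
  rewrite -bigcup_mkord; apply/seteqP; split=> w.
    by move=> Ew; exists (np n w) => //=; rewrite ltnS.
  by move=> [N _ [/= <-]].
rewrite EA; split; first by apply: bigsetU_measurable.
apply: (le_trans (Boole_inequality P (fun N (_ : (N < M.+1)%N) => mA N))).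
have -> : (\sum_(i < M.+1) P (A i) = \sum_(0 <= N < M.+1) P (iter (M - N) T @^-1` A N))%E.
  by rewrite big_mkord; apply: eq_bigr => N _; rewrite P_iter.
have := @sum_indic_le _ _ _ P M.+1 K (fun N => iter (M - N) T @^-1` A N)
  (fun=> iter M T @^-1` E) 1 ler01.
have -> : (K%:R%:E * P E = \sum_(0 <= j < K) P (iter M T @^-1` E))%E.
  elim: (K) => [|K1 IH]; first by rewrite big_geq // mul0e.
  by rewrite big_nat_recr //= -IH P_iter // -natr1 EFinD ge0_muleDl ?mul1e ?lee_fin.
rewrite mul1e; apply=> [N|_|w]; [exact: measurable_iter_preimage..|].
rewrite mul1r; case: (boolP (w \in iter M T @^-1` E)) => wE; last first.
  rewrite [leLHS]big1_seq ?sumr_ge0 // => N; rewrite mem_index_iota => /andP[_ NM].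
  rewrite /indic (_ : (w \in _) = false) //; apply/negbTE; apply: contra wE.
  rewrite !in_setE => -[_ /=]; rewrite -iterD subnKC //; lia.
rewrite [leRHS](_ : _ = K%:R); last first.
  rewrite /indic wE; elim: (K) => [|K1 IH]; first by rewrite big_geq.
  by rewrite big_nat_recr //= IH natr1.
apply: (@le_trans _ _ (count (fun N => np n (iter (M - N) T w) == N) (iota 0 M.+1))%:R); last first.
  by rewrite ler_nat.
rewrite -sum1_count natr_sum [leRHS]big_mkcond /index_iota subn0; apply: ler_sum => N _.
rewrite /indic; case: (boolP (w \in _)) => [|_]; last by case: ifP.
by rewrite in_setE => -[/= -> _]; rewrite eqxx.
Qed.

End stopping.

End ergodic.

(** * Entropy of components from below *)

Definition box (A : nat) (d : int * int) : seq (int * int) :=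
  [seq (d.1 + a%:Z - A%:Z, d.2 + b%:Z - A%:Z) | a <- iota 0 (A + A).+1, b <- iota 0 (A + A).+1].

Lemma mem_box A d e : e \in box A d =
  (d.1 - A%:Z <= e.1 <= d.1 + A%:Z) && (d.2 - A%:Z <= e.2 <= d.2 + A%:Z).
Proof.
rewrite /box; move E : (A + A).+1 => M; apply/allpairsP/idP.
  move=> [[a b] /= [+ + ->]]; rewrite !mem_iota /= => aM bM; lia.
case: e d => [e1 e2] [d1 d2] /= h.
exists (absz (e1 - d1 + A%:Z)%R, absz (e2 - d2 + A%:Z)%R); rewrite !mem_iota /=.
by split; [lia|lia|congr pair; lia].
Qed.

Lemma box_uniq A d : uniq (box A d).
Proof.
apply: allpairs_uniq; rewrite ?iota_uniq // => -[a b] [a' b'] _ _ /= [].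
by move=> /addIr/addrI[->] /addIr/addrI[->].
Qed.

Lemma size_box A d : size (box A d) = ((A + A).+1 ^ 2)%N.
Proof. by rewrite size_allpairs !size_iota. Qed.

Lemma dcell_box (R : realType) A i (x y : R * R) :
  `|x.1 - y.1| * 2 ^+ i <= A%:R -> `|x.2 - y.2| * 2 ^+ i <= A%:R ->
  dcell i x \in box A (dcell i y).
Proof.
have h (a b : R) : `|a - b| * 2 ^+ i <= A%:R ->
    Num.floor (b * 2 ^+ i) - A%:Z <= Num.floor (a * 2 ^+ i) <= Num.floor (b * 2 ^+ i) + A%:Z.
  have -> : `|a - b| * 2 ^+ i = `|a * 2 ^+ i - b * 2 ^+ i|.
    by rewrite -mulrBl normrM (gtr0_norm (exprn_gt0 _ _)).
  move: (a * 2 ^+ i) (b * 2 ^+ i) => {}a {}b; rewrite ler_norml => /andP[h1 h2].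
  have /andP[a1 a2] := floor_itv a; have /andP[b1 b2] := floor_itv b.
  rewrite !intrD in a2 b2.
  apply/andP; split.
    have : (Num.floor b - A%:Z)%:~R < (Num.floor a + 1)%:~R :> R.
      by rewrite intrB intrD -[A%:Z%:~R]/(A%:R : R); lra.
    by rewrite ltr_int; lia.
  have : (Num.floor a)%:~R < (Num.floor b + A%:Z + 1)%:~R :> R.
    by rewrite !intrD -[A%:Z%:~R]/(A%:R : R); lra.
  by rewrite ltr_int; lia.
by move=> h1 h2; rewrite mem_box /= !h.
Qed.

Section lower_bound.
Variables (R : realType) (I : Type) (k : I -> nat) (r : I -> R) (phi : I -> R * R).
Variables (t : I -> nat -> R * R) (p : I -> nat -> R) (Rad rM : R).
Hypothesis r_bounds : forall i, 0 < r i <= rM.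
Hypothesis rM_lt1 : rM < 1.
Hypothesis phi_unit : forall i, (phi i).1 ^+ 2 + (phi i).2 ^+ 2 = 1.
Hypothesis p_gt0 : forall i j, (j < k i)%N -> 0 < p i j.
Hypothesis p_sum : forall i, \sum_(j < k i) p i j = 1.
Hypothesis Rad_gt0 : 0 < Rad.
Hypothesis Rad_closure : forall i j, (j < k i)%N ->
  closure (fij r phi t i j @` eball (0, 0) Rad) `<=` eball (0, 0) Rad.
Variable K0 : nat.
Hypothesis Rad_lt : Rad < K0%:R.
Implicit Types (w : nat -> I).

Local Notation eta := (etaw k r phi t p).
Local Notation mass := (mass k r phi t p).
Local Notation cell_ent := (cell_ent k r phi t p).
Local Notation pieces := (pieces k r phi t p).
Local Notation cells := (cells K0).

Lemma massE w i d : mass w i d = eta w (dsq i d).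
Proof. by []. Qed.

(** Dyadic substitute for the mass of a ball: the five by five block contains the ball of radius
    [2 ^- i] about any point of its central square, and fits in a ball eight times larger. *)
Definition block_mass w i d : R := \sum_(e <- box 2 d) mass w i e.

Definition heavy w m (theta : R) : set (R * R) :=
  [set y | theta < block_mass w m (dcell m y)].

Lemma eta_pre_seq w g i (s : seq (int * int)) : affine g -> uniq s ->
  eta w [set z | dcell i (g z) \in s] = \sum_(d <- s) eta w [set z | dsq i d (g z)].
Proof.
exact: (eta_dcell_seq r_bounds rM_lt1 phi_unit p_gt0 p_sum Rad_gt0 Rad_closure).
Qed.

Lemma block_massE w i d : block_mass w i d = eta w [set y | dcell i y \in box 2 d].
Proof. by rewrite (eta_pre_seq w i (@affine_id R) (box_uniq 2 d)). Qed.

Section piece.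
Variables (w : nat -> I) (N i m : nat) (tau : R * R) (theta c : R) (A : nat).
Hypothesis scale_ge : 2 ^- i <= contr r w N.
Hypothesis scale_le : Rad * contr r w N * 2 ^+ i <= A%:R.
Hypothesis theta_gt0 : 0 < theta.
Hypothesis c_gt0 : 0 < c.
Hypothesis theta_le : theta <= c.
Let v := iter N (@Tshift I) w.
Hypothesis heavy_small : eta v (heavy v m theta) <= c ^+ 2.
Let g := piece_map r phi w N tau.
Let pre j d := eta v [set z | dsq j d (g z)].
(** Entropy per unit of mass when a total mass of at least [c] is split into cells of mass at most
    [theta]. *)
Let Lam : R := (ln c - ln theta) / ln 2.

Let ag : affine g. Proof. exact: affine_piece_map. Qed.

Let pre_ge0 j d : 0 <= pre j d. Proof. exact: eta_ge0. Qed.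

Let Lam_ge0 : 0 <= Lam.
Proof. by rewrite /Lam divr_ge0 ?(ltW (ln2_gt0 R)) // subr_ge0 ler_ln ?posrE. Qed.

(** The similarity [g] has ratio at least [2 ^- i], so the preimage of a square of side
    [2 ^- (i + m)] has diameter at most [2 * 2 ^- m], which is two cells. *)
Lemma preimage_in_block e z0 : dsq (i + m) e (g z0) ->
  pre (i + m) e <= block_mass v m (dcell m z0).
Proof.
move=> z0e; rewrite block_massE; apply: (le_eta r_bounds rM_lt1 phi_unit p_gt0 Rad_gt0 Rad_closure).
move=> z /= ze.
have := sqnorm_piece_map r phi_unit w N tau z z0; rewrite -/g => E.
have [[/andP[a1 a2] /andP[a3 a4]] [/andP[b1 b2] /andP[b3 b4]]] := (ze, z0e).
have p2 n : (0 : R) < 2 ^- n by rewrite invr_gt0 exprn_gt0.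
rewrite !intrD !mulrDl !mul1r in a2 a4 b2 b4.
have h1 : `|(g z).1 - (g z0).1| <= 2 ^- (i + m) by rewrite ler_norml; apply/andP; split; lra.
have h2 : `|(g z).2 - (g z0).2| <= 2 ^- (i + m) by rewrite ler_norml; apply/andP; split; lra.
have h : sqnorm (csub (g z) (g z0)) <= 2 * (2 ^- (i + m)) ^+ 2.
  rewrite /sqnorm /csub /= mulr2n mulrDl mul1r -[X in X + _ <= _]real_normK ?num_real //.
  rewrite -[X in _ + X <= _]real_normK ?num_real //.
  by apply: lerD; rewrite ler_pXn2r ?nnegrE // ltW.
have {E h}: 2 ^- i ^+ 2 * sqnorm (csub z z0) <= 2 ^- i ^+ 2 * (2 * 2 ^- m) ^+ 2.
  apply: (@le_trans _ _ (contr r w N ^+ 2 * sqnorm (csub z z0))).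
    apply: ler_wpM2r; first by rewrite addr_ge0 ?sqr_ge0.
    by rewrite ler_pXn2r ?nnegrE ?(ltW (p2 _)) // (ltW (contr_gt0 r_bounds _ _)).
  rewrite -E; apply: (le_trans h); rewrite exprD invfM !exprMn mulrCA.
  rewrite ler_wpM2l ?sqr_ge0 // ler_wpM2r ?sqr_ge0 //.
  by rewrite expr2; lra.
rewrite ler_pM2l ?exprn_gt0 // => /sqnorm_coord[|/= k1 k2]; first by rewrite mulr_ge0 // ltW.
apply: dcell_box; rewrite -ler_pdivlMr ?exprn_gt0 //.
Qed.

(** One point outside [heavy] bounds the mass of the whole cell; a cell without such a point has its
    preimage inside [heavy]. *)
Let lightcell e := `[< exists z0, dsq (i + m) e (g z0) /\ ~ heavy v m theta z0 >].

Lemma light_pre_le e : lightcell e -> pre (i + m) e <= theta.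
Proof.
move=> /asboolP[z0 [/preimage_in_block h /negP]]; rewrite -leNgt.
exact: le_trans.
Qed.

(** The bound is quadratic so that, on a square of mass at least [c], the lost part is at most the
    fraction [c]: the second branch of [deficit]. *)
Lemma dark_pre_sum d : \sum_(e <- subcells m d | ~~ lightcell e) pre (i + m) e <= c ^+ 2.
Proof.
rewrite -big_filter -eta_pre_seq ?filter_uniq ?subcells_uniq //.
apply: le_trans heavy_small; apply: (le_eta r_bounds rM_lt1 phi_unit p_gt0 Rad_gt0 Rad_closure).
move=> z /=; rewrite mem_filter => /andP[/asboolP nl _]; apply: contrapT => nh.
by apply: nl; exists z; split=> //; exact: dsq_dcell.
Qed.

Lemma pre_subcells d : pre i d = \sum_(e <- subcells m d) pre (i + m) e.
Proof.
exact: (eta_dsq_subcells r_bounds rM_lt1 phi_unit p_gt0 p_sum Rad_gt0 Rad_closure v i m d ag).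
Qed.

Lemma pre_sub_le d e : e \in subcells m d -> pre (i + m) e <= pre i d.
Proof.
move=> es; rewrite (pre_subcells d) (big_rem e) //= lerDl.
by apply: sumr_ge0 => *; exact: pre_ge0.
Qed.

(* The pieces meeting [d] in mass at least [c] have almost full entropy; the part of [d]
   not accounted for in this way is bounded by [deficit]. *)
Definition deficit d : R := if pre i d < c then pre i d else c * pre i d.

(** Below mass [c] the left side is zero. Otherwise each light cell contributes at least [Lam] times
    its mass, and the other cells contribute nonnegatively. *)
Lemma piece_entropy_ge d : Lam * (pre i d - deficit d) <=
  \sum_(e <- subcells m d) (ent (pre (i + m) e) + pre (i + m) e * ln (pre i d) / ln 2).
Proof.
have term0 e : 0 < pre i d -> e \in subcells m d ->
    0 <= ent (pre (i + m) e) + pre (i + m) e * ln (pre i d) / ln 2.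
  move=> Y0 es; rewrite -ent_scale //; apply: mulr_ge0; first exact: ltW.
  apply: ent_ge0; first by apply: divr_ge0 => //; exact: ltW.
  by rewrite ler_pdivrMr // mul1r pre_sub_le.
rewrite /deficit; case: ltP => [Yc|cY].
  rewrite subrr mulr0; move: (pre_ge0 i d); rewrite le_eqVlt => /predU1P[Y0|Y0].
    rewrite big_seq; apply: sumr_ge0 => e es.
    have -> : pre (i + m) e = 0.
      by apply/eqP; rewrite eq_le pre_ge0 andbT Y0 pre_sub_le.
    by rewrite ent0 !mul0r addr0.
  by rewrite big_seq; apply: sumr_ge0 => e es; exact: term0.
have Y0 : 0 < pre i d by exact: lt_le_trans cY.
rewrite (bigID lightcell) /=.
apply: (@le_trans _ _ (\sum_(e <- subcells m d | lightcell e) Lam * pre (i + m) e)).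
  rewrite -mulr_sumr; apply: ler_wpM2l => //.
  have := pre_subcells d; rewrite (bigID lightcell) /=; have := dark_pre_sum d.
  have : c ^+ 2 <= c * pre i d by rewrite expr2 ler_pM2l.
  by move: (\sum_(_ <- _ | _) _) (\sum_(_ <- _ | _) _) => s1 s2; lra.
rewrite -[leLHS]addr0; apply: lerD; last first.
  by rewrite big_seq_cond; apply: sumr_ge0 => e /andP[es _]; exact: term0.
apply: ler_sum => e le.
move: (pre_ge0 (i + m) e); rewrite le_eqVlt => /predU1P[<-|x0].
  by rewrite ent0 !mul0r addr0 mulr0.
rewrite (entE (ltW x0)) mulrC.
have -> : - (pre (i + m) e * ln (pre (i + m) e)) / ln 2 + pre (i + m) e * ln (pre i d) / ln 2 =
    pre (i + m) e * ((ln (pre i d) - ln (pre (i + m) e)) / ln 2) by ring.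
apply: ler_wpM2l; first exact: ltW.
rewrite ler_pM2r ?invr_gt0 ?ln2_gt0 //.
by apply: lerB; rewrite ler_ln ?posrE // light_pre_le.
Qed.

Lemma deficit_ge0 d : 0 <= deficit d.
Proof. by rewrite /deficit; case: ifP => // _; rewrite mulr_ge0 // ltW. Qed.

(** The piece stays within [A] cells of [g (0, 0)], so at most [(2A + 1) ^ 2] squares fall in the
    first branch with positive mass, each costing less than [c]; the second branch costs [c] times a
    total mass of at most 1. *)
Lemma deficit_sum : \sum_(d <- cells i) deficit d <= (((A + A).+1 ^ 2)%:R + 1) * c.
Proof.
pose d0 := dcell i (g (0, 0)).
apply: (@le_trans _ _ (\sum_(d <- cells i) ((if d \in box A d0 then c else 0) + c * pre i d))).
  apply: ler_sum => d _; rewrite /deficit; case: ltP => [Yc|cY].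
    case: ifPn => dd0; first by apply: ler_wpDr; [rewrite mulr_ge0 // ltW|exact: ltW].
    suff -> : pre i d = 0 by rewrite mulr0 addr0.
    apply/eqP; rewrite eq_le pre_ge0 andbT -(eta_set0 r phi t p_gt0 v).
    apply: (le_eta_supp r_bounds rM_lt1 phi_unit p_gt0 Rad_gt0 Rad_closure) => z zR /= /dsqP zd.
    move: dd0; rewrite -zd => /negP; apply; rewrite /d0.
    have : sqnorm (csub (g z) (g (0, 0))) <= (Rad * contr r w N) ^+ 2.
      rewrite (sqnorm_piece_map r phi_unit) exprMn mulrC ler_wpM2r ?sqr_ge0 //.
      by move: zR; rewrite /sqnorm /csub /= !subr0.
    have rc0 : 0 <= Rad * contr r w N.
      by rewrite mulr_ge0 ?(ltW Rad_gt0) // (ltW (contr_gt0 r_bounds _ _)).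
    move=> /(sqnorm_coord rc0)[h1 h2].
    by apply: dcell_box; apply: le_trans scale_le; rewrite ler_wpM2r // exprn_ge0.
  by rewrite lerDr; case: ifP => // _; exact: ltW.
rewrite big_split /= mulrDl mul1r; apply: lerD.
  rewrite -big_mkcond -big_filter big_const_seq count_predT iter_addr_0 -[leLHS]mulr_natl.
  rewrite ler_pM2r // ler_nat -(size_box A d0); apply: uniq_leq_size.
    by rewrite filter_uniq ?cells_uniq.
  by move=> d; rewrite mem_filter => /andP[].
rewrite -mulr_sumr -[leRHS]mulr1 ler_pM2l // -eta_pre_seq ?cells_uniq //.
exact: eta_le1.
Qed.

End piece.

(** Averages the bounds for single pieces with the weights of [pieces]; [log_sum] makes [cell_ent]
    dominate the average, and the deficits average to [def]. *)
Lemma cell_ent_lower w N i m (theta c : R) (A : nat) :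
  2 ^- i <= contr r w N -> Rad * contr r w N * 2 ^+ i <= A%:R ->
  0 < theta -> 0 < c -> theta <= c ->
  let v := iter N (@Tshift I) w in
  eta v (heavy v m theta) <= c ^+ 2 ->
  exists def : int * int -> R,
    [/\ forall d, 0 <= def d,
        forall d, (ln c - ln theta) / ln 2 * (mass w i d - def d) <= cell_ent w m i d &
        \sum_(d <- cells i) def d <= (((A + A).+1 ^ 2)%:R + 1) * c].
Proof.
move=> s1 s2 t0 c0 tc v hv.
exists (fun d => \sum_(x <- pieces w N) x.1 * deficit w N i x.2 c d).
have piecesE B := eta_pieces r_bounds rM_lt1 phi_unit p_gt0 p_sum Rad_gt0 Rad_closure w N B.
have x0 x : x \in pieces w N -> 0 <= x.1 by exact: pieces_ge0.
split.
- move=> d; rewrite big_seq; apply: sumr_ge0 => x xs.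
  by rewrite mulr_ge0 ?x0 // deficit_ge0.
- move=> d; rewrite (cell_entE r_bounds rM_lt1 phi_unit p_gt0 p_sum Rad_gt0 Rad_closure).
  pose X (x : R * (R * R)) e := eta v [set z | dsq (i + m) e (piece_map r phi w N x.2 z)].
  pose Y (x : R * (R * R)) := eta v [set z | dsq i d (piece_map r phi w N x.2 z)].
  apply: (@le_trans _ _ (\sum_(e <- subcells m d) \sum_(x <- pieces w N)
      x.1 * (ent (X x e) + X x e * ln (Y x) / ln 2))); last first.
    rewrite big_seq [leRHS]big_seq; apply: ler_sum => e es.
    apply: log_sum => //; last 2 first.
    - by rewrite massE piecesE.
    - by rewrite massE piecesE.
    by move=> x xs; rewrite eta_ge0 //=; exact: pre_sub_le.
  rewrite exchange_big /= massE piecesE -sumrB mulr_sumr big_seq [leRHS]big_seq.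
  apply: ler_sum => x xs; rewrite -mulrBr mulrCA -mulr_sumr; apply: ler_wpM2l; first exact: x0.
  exact: (@piece_entropy_ge w N i m x.2 theta c s1 t0 c0 tc hv d).
- rewrite exchange_big /=; set Q := (X in _ <= X); rewrite -[Q]mul1r.
  rewrite -(pieces_sum r_bounds rM_lt1 phi_unit p_gt0 p_sum Rad_gt0 Rad_closure w N) mulr_suml.
  rewrite big_seq [leRHS]big_seq; apply: ler_sum => x xs; rewrite -mulr_sumr.
  apply: ler_wpM2l; first exact: x0.
  exact: deficit_sum.
Qed.

End lower_bound.

(** * Consequences of exact dimensionality *)

Lemma pow2_small (R : realType) (d : R) : 0 < d ->
  exists n0, forall n, (n0 <= n)%N -> 2 ^- n < d.
Proof.
move=> d0; exists (Num.truncn d^-1).+1 => n hn.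
rewrite -[ltRHS]invrK ltf_pV2 ?posrE ?invr_gt0 ?exprn_gt0 //.
apply: (lt_trans (truncnS_gt _)); apply: (@le_lt_trans _ _ n%:R); first by rewrite ler_nat.
by rewrite -natrX ltr_nat ltn_expl.
Qed.

Section exact_dimension.
Variables (R : realType) (I : Type) (k : I -> nat) (r : I -> R) (phi : I -> R * R).
Variables (t : I -> nat -> R * R) (p : I -> nat -> R) (Rad rM : R).
Hypothesis r_bounds : forall i, 0 < r i <= rM.
Hypothesis rM_lt1 : rM < 1.
Hypothesis phi_unit : forall i, (phi i).1 ^+ 2 + (phi i).2 ^+ 2 = 1.
Hypothesis p_gt0 : forall i j, (j < k i)%N -> 0 < p i j.
Hypothesis p_sum : forall i, \sum_(j < k i) p i j = 1.
Hypothesis Rad_gt0 : 0 < Rad.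
Hypothesis Rad_closure : forall i j, (j < k i)%N ->
  closure (fij r phi t i j @` eball (0, 0) Rad) `<=` eball (0, 0) Rad.
Variable K0 : nat.
Hypothesis Rad_lt : Rad < K0%:R.
Variables (w : nat -> I) (alpha : R).
Hypothesis dim_w : exact_dim (etaw k r phi t p w) alpha.

Local Notation eta := (etaw k r phi t p).
Local Notation mass := (mass k r phi t p).
Local Notation block_mass := (block_mass k r phi t p).
Local Notation heavy := (heavy k r phi t p).
Local Notation cells := (cells K0).
Local Notation leta := (le_eta r_bounds rM_lt1 phi_unit p_gt0 Rad_gt0 Rad_closure).
Local Notation etaM := (eta_measurable_dcell r_bounds rM_lt1 phi_unit p_gt0 p_sum Rad_gt0
  Rad_closure).

(** Continuity from above along the tail unions [F n], whose intersection is contained in [N]. *)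
Lemma eta_limsup_null (V : nat -> set (R * R)) (N : set (R * R)) :
  (forall n, eta_measurable k r phi t p w (V n)) -> eta w N = 0 ->
  (forall x, ~ N x -> exists n0, forall n, (n0 <= n)%N -> ~ V n x) ->
  eta w (V n) @[n --> \oo] --> (0 : R).
Proof.
move=> mV N0 VN; pose F n := \bigcup_(j in [set j | (n <= j)%N]) V j.
have FV n : V n `<=` F n by move=> x Vx; exists n => /=.
have cF : eta w (F n) @[n --> \oo] --> (0 : R).
  apply: (eta_cvg_nonincreasing p_gt0).
  - by move=> n; apply: (eta_measurable_countable_bigcup p_gt0).
  - by move=> n m nm x [j /= mj Vj]; exists j => //=; exact: leq_trans mj.
  - apply/eqP; rewrite eq_le eta_ge0 // andbT -N0; apply: leta => x Fx.
    apply: contrapT => /VN[n0 hn0]; have [j /= nj] := Fx n0 Logic.I.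
    exact: hn0.
apply: (@squeeze_cvgr _ _ _ _ (fun=> 0) (fun n => eta w (F n))) => //; last exact: cvg_cst.
by apply: nearW => n; rewrite eta_ge0 //=; exact: leta.
Qed.

Lemma local_dimension : exists N : set (R * R), eta w N = 0 /\ forall x, ~ N x ->
  forall e, 0 < e -> exists n0, forall n, (n0 <= n)%N ->
    n%:R * ln 2 * (alpha - e) <= - ln (eta w (eball x (2 ^- n))) <= n%:R * ln 2 * (alpha + e).
Proof.
have [N [N0 hN]] := dim_w; exists N; split=> // x /hN /cvgrPdist_lt h e e0.
have [d /= d0 hd] := h e e0.
have [n0 hn0] := pow2_small d0; exists n0.+1 => n hn.
have p2 : (0 : R) < 2 ^- n by rewrite invr_gt0 exprn_gt0.
have := hd (2 ^- n); rewrite /= sub0r normrN gtr0_norm // => /(_ (hn0 _ (ltnW hn)) p2).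
rewrite lnV ?posrE ?exprn_gt0 // lnXn // -[ln 2 *+ n]mulr_natl.
have nl : 0 < n%:R * ln 2 :> R by rewrite mulr_gt0 ?ln2_gt0 // ltr0n; lia.
move: (ln (eta w _)) => l; rewrite invrN mulrN opprK => hl.
have E : - l = n%:R * ln 2 * (- (l / (n%:R * ln 2))).
  by rewrite mulrN mulrCA divff ?gt_eqF // mulr1.
rewrite E !ler_pM2l //.
by move: hl; rewrite ltr_norml => /andP[h1 h2]; apply/andP; split; lra.
Qed.

Lemma alpha_ge0 : 0 <= alpha.
Proof.
have [N [N0 hN]] := local_dimension.
have [x Nx] : exists x, ~ N x.
  apply: contrapT => /forallNP h; move: N0.
  rewrite (_ : N = setT) ?(eta_setT r phi t p_gt0 p_sum w); first by move/eqP; rewrite oner_eq0.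
  by apply/seteqP; split=> // y _; apply: contrapT; exact: h.
apply/ler_addgt0Pr => e e0; have [n0 /(_ n0.+1 (leqnSn _)) /andP[_ h]] := hN x Nx e e0.
have nl : 0 < n0.+1%:R * ln 2 :> R by rewrite mulr_gt0 ?ln2_gt0.
have : 0 <= - ln (eta w (eball x (2 ^- n0.+1))) by rewrite oppr_ge0 ln_le0 // eta_le1.
by move=> /le_trans /(_ h); rewrite pmulr_rge0.
Qed.

Lemma eball_sub_block n x : eball x (2 ^- n) `<=` [set y : R * R | dcell n y \in box 2 (dcell n x)].
Proof.
move=> y /= xy; have p2 : (0 : R) < 2 ^+ n by rewrite exprn_gt0.
have /sqnorm_coord[|h1 h2] : sqnorm (csub y x) <= (2 ^- n) ^+ 2 by exact: ltW.
  by rewrite invr_ge0 ltW.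
have h (a : R) : `|a| <= 2 ^- n -> `|a| * 2 ^+ n <= 2%:R.
  by rewrite -ler_pdivlMr // => /le_trans; apply; rewrite ler_pdivlMr // mulVf ?gt_eqF // ler1n.
by apply: dcell_box; exact: h.
Qed.

(** Points of the block differ by at most three cells in each coordinate, that is [3 / 8 * 2 ^- n],
    and [2 * (3 / 8) ^ 2 < 1]. Two generations would not do, since [2 * (3 / 4) ^ 2 > 1]. *)
Lemma block_sub_eball n x : [set y : R * R | dcell (n + 3) y \in box 2 (dcell (n + 3) x)] `<=`
  eball x (2 ^- n).
Proof.
move=> y /=; rewrite mem_box /= => /andP[b1 b2].
have h (a b : R) : Num.floor (b * 2 ^+ (n + 3)) - 2 <= Num.floor (a * 2 ^+ (n + 3)) <=
    Num.floor (b * 2 ^+ (n + 3)) + 2 -> (a - b) ^+ 2 <= (3 / 8 * 2 ^- n) ^+ 2.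
  have p2 : (0 : R) < 2 ^+ n by rewrite exprn_gt0.
  rewrite exprD (_ : 2 ^+ 3 = 8); last by rewrite -natrX.
  move: (floor_itv (a * (2 ^+ n * 8))) (floor_itv (b * (2 ^+ n * 8))).
  rewrite !intrD => /andP[a1 a2] /andP[c1 c2] /andP[h1 h2].
  have {}h1 : (Num.floor (b * (2 ^+ n * 8)))%:~R - 2 <= (Num.floor (a * (2 ^+ n * 8)))%:~R :> R.
    by move: h1; rewrite -(ler_int R) intrB.
  have {}h2 : (Num.floor (a * (2 ^+ n * 8)))%:~R <= (Num.floor (b * (2 ^+ n * 8)))%:~R + 2 :> R.
    by move: h2; rewrite -(ler_int R) intrD.
  have : `|a - b| <= 3 / 8 * 2 ^- n.
    rewrite ler_pdivlMr // -[X in _ * X]gtr0_norm // -normrM mulrBl ler_norml.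
    move: a1 a2 c1 c2 h1 h2; rewrite !mulrA.
    move: (Num.floor (a * 2 ^+ n * 8))%:~R (Num.floor (b * 2 ^+ n * 8))%:~R => f1 f2.
    move: (a * 2 ^+ n) (b * 2 ^+ n) => a' b'; rewrite -[1%:~R]/(1 : R) => *.
    by apply/andP; split; lra.
  by move=> hab; rewrite -[leLHS]real_normK ?num_real // ler_pXn2r ?nnegrE.
rewrite /eball /=; have := h _ _ b1; have := h _ _ b2; rewrite exprMn.
have : (0 : R) < (2 ^- n) ^+ 2 by rewrite exprn_gt0 // invr_gt0 exprn_gt0.
move: ((2 ^- n) ^+ 2) => q q0.
rewrite (_ : (3 / 8) ^+ 2 = 9 / 64 :> R); last by field.
by move=> h1 h2; lra.
Qed.

Lemma heavy_cvg0 (e : R) : 0 < e ->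
  eta w (heavy w m (expR (- (m%:R * ln 2 * (alpha - e))))) @[m --> \oo] --> (0 : R).
Proof.
move=> e0; have [N [N0 hN]] := local_dimension.
apply: (@eta_limsup_null _ N) => //.
  by move=> m; exact: (etaM w m
    (fun d => expR (- (m%:R * ln 2 * (alpha - e))) < block_mass w m d)).
move=> x Nx; have e2 : 0 < e / 2 by rewrite divr_gt0.
have [n0 h] := hN x Nx _ e2.
(* Passing from blocks to balls loses three generations, hence [3 * alpha] in the exponent; the
   spare [n * e / 2] absorbs it once [n >= 6 * alpha / e]. *)
exists (n0 + 3 + (Num.truncn (6 * alpha / e)).+1)%N => m hm.
change (~ (expR (- (m%:R * ln 2 * (alpha - e))) < block_mass w m (dcell m x))).
apply/negP; rewrite -leNgt.
have [n mE] : exists n, m = (n + 3)%N by exists (m - 3)%N; lia.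
rewrite mE (block_massE r_bounds rM_lt1 phi_unit p_gt0 p_sum Rad_gt0 Rad_closure).
apply: (le_trans (leta w (@block_sub_eball n x))).
have : 0 <= eta w (eball x (2 ^- n)) by rewrite eta_ge0.
rewrite le_eqVlt => /predU1P[<-|mu0]; first exact: expR_ge0.
rewrite -[leLHS](lnK mu0) ler_expR lerNr.
have /andP[+ _] := h n ltac:(lia); apply: le_trans.
have nN : 6 * alpha / e <= n%:R.
  have := truncnS_gt (6 * alpha / e); move: (Num.truncn (6 * alpha / e)).+1 hm => T hm hT.
  by apply: (le_trans (ltW hT)); rewrite ler_nat; lia.
rewrite ler_pdivrMr // in nN.
have l2 := ln2_gt0 R; rewrite natrD -!mulrA mulrCA [leRHS]mulrCA ler_pM2l //.
rewrite mulrDl; have -> : 3%:R * (alpha - e) = 3 * alpha - 3 * e :> R by ring.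
by nra.
Qed.

Definition thin m (theta : R) : set (R * R) := [set y | block_mass w m (dcell m y) < theta].

Lemma thin_cvg0 (e : R) : 0 < e ->
  eta w (thin m (expR (- (m%:R * ln 2 * (alpha + e))))) @[m --> \oo] --> (0 : R).
Proof.
move=> e0; have [N [N0 hN]] := local_dimension.
(* Because [ln 0 = 0], the local dimension does not exclude balls of mass zero. The null squares of
   all generations are added to the exceptional set, so that the ball masses below are positive. *)
pose F n : set (R * R) := if n is n'.+1 then [set x | mass w n' (dcell n' x) = 0] else N.
apply: (@eta_limsup_null _ (\bigcup_n F n)) => //.
  - by move=> m; exact: (etaM w m
      (fun d => block_mass w m d < expR (- (m%:R * ln 2 * (alpha + e))))).
  - apply: (eta_bigcup_null p_gt0) => -[|n] //=.
  rewrite (eta_dcell r_bounds rM_lt1 phi_unit p_gt0 p_sum Rad_gt0 Rad_closure Rad_lt w n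
    [set d | mass w n d = 0]).
  by rewrite big1 // => d /asboolP.
move=> x nF; have Nx : ~ N x by move=> Nx; apply: nF; exists 0%N.
have [n0 h] := hN x Nx _ e0; exists n0 => m hm /=.
apply/negP; rewrite -leNgt.
rewrite (block_massE r_bounds rM_lt1 phi_unit p_gt0 p_sum Rad_gt0 Rad_closure).
apply: le_trans (leta w (@eball_sub_block m x)).
have mu0 : 0 < eta w (eball x (2 ^- m)).
  have : 0 < mass w (m + 3) (dcell (m + 3) x).
    rewrite lt_neqAle eta_ge0 // andbT; apply/eqP => /esym E.
    by apply: nF; exists (m + 3).+1.
  move=> /lt_le_trans; apply; apply: leta => y /dsqP yx; apply: block_sub_eball => /=.
  by rewrite yx; case: (dcell _ _) => a b; rewrite mem_box /=; lia.
rewrite -[leRHS](lnK mu0) ler_expR lerNl.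
by have /andP[_] := h m hm.
Qed.

(** For each of the 25 offsets the shifted squares are distinct, hence have total mass at most 1. *)
Lemma block_mass_sum m : \sum_(d <- cells m) block_mass w m d <= 25.
Proof.
have E d : block_mass w m d = \sum_(a <- iota 0 5) \sum_(b <- iota 0 5)
    mass w m (d.1 + a%:Z - 2, d.2 + b%:Z - 2).
  by rewrite -[block_mass w m d]/(\sum_(e <- box 2 d) mass w m e) /box big_allpairs_dep.
under eq_bigr do rewrite E.
rewrite exchange_big /= -[leRHS]/((5 * 5)%:R) natrM.
have H a : a \in iota 0 5 -> \sum_(d <- cells m) \sum_(b <- iota 0 5)
    mass w m (d.1 + a%:Z - 2, d.2 + b%:Z - 2) <= 5%:R.
  move=> _; rewrite exchange_big /= -[leRHS]mulr1 mulr_natl.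
  have -> : 1 *+ 5 = \sum_(b <- iota 0 5) (1 : R) by rewrite big_const_seq iter_addr_0.
  apply: ler_sum => b _.
  pose s := [seq (d.1 + a%:Z - 2, d.2 + b%:Z - 2) | d <- cells m].
  have us : uniq s.
    rewrite map_inj_uniq ?cells_uniq // => -[x1 x2] [y1 y2] /= [].
    by move=> /addIr/addIr -> /addIr/addIr ->.
  have := eta_pre_seq r_bounds rM_lt1 phi_unit p_gt0 p_sum Rad_gt0 Rad_closure w m
    (@affine_id R) us.
  by rewrite big_map => <-; exact: eta_le1.
rewrite mulr_natl.
have -> : 5%:R *+ 5 = \sum_(b <- iota 0 5) (5%:R : R) by rewrite big_const_seq iter_addr_0.
by rewrite big_seq [leRHS]big_seq; apply: ler_sum => a; exact: H.
Qed.

(* Most of the mass lies on cells whose blocks have mass at least [2 ^ (- i (alpha + e))];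
   there are at most [25 * 2 ^ (i (alpha + e))] of them. *)
Lemma entropy_upper (e : R) : 0 < e ->
  \forall i \near \oo, \sum_(d <- cells i) ent (mass w i d) <= i%:R * (alpha + e).
Proof.
move=> e0; have e2 : 0 < e / 2 by rewrite divr_gt0.
have l2 := ln2_gt0 R; have a0 := alpha_ge0.
have e8 : 0 < e / 8 by rewrite divr_gt0.
move/cvgrPdist_lt : (thin_cvg0 e2) => /(_ _ e8)[n1 _ hthin].
pose Cst : R := (25 + (K0 * 2 * (K0 * 2))%:R) / ln 2.
exists (n1 + (Num.truncn (4 * Cst / e)).+1)%N => // i /= hi.
pose th := expR (- (i%:R * ln 2 * (alpha + e / 2))).
have q0 d : 0 <= mass w i d by exact: eta_ge0.
have thin_i : eta w (thin i th) < e / 8.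
  have := hthin i ltac:(rewrite /=; lia); rewrite sub0r normrN.
  by apply: le_lt_trans; exact: ler_norm.
have th0 : 0 < th by exact: expR_gt0.
have p4 : 0 < 2 ^- (i + i) :> R by rewrite invr_gt0 exprn_gt0.
rewrite (bigID (fun d => block_mass w i d < th)) /=.
(* Tangent at [4 ^- i]: thin cells cost [2 * i] per unit of mass, of which there is less than
   [e / 8], plus a constant because there are only [(2 * K0) ^ 2 * 4 ^ i] cells. *)
have B1 : \sum_(d <- cells i | block_mass w i d < th) ent (mass w i d) <=
    2 * i%:R * (e / 8) + (K0 * 2 * (K0 * 2))%:R / ln 2.
  apply: (@le_trans _ _ (\sum_(d <- cells i | block_mass w i d < th)
      (2 * i%:R * mass w i d + 2 ^- (i + i) / ln 2))).
    apply: ler_sum => d _; apply: (le_trans (ent_tangent (q0 d) p4)); apply: lerD.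
      rewrite lnV ?posrE ?exprn_gt0 // lnXn // -[ln 2 *+ _]mulr_natl natrD mulrN opprK.
      by rewrite le_eqVlt; apply/orP; left; apply/eqP; field; rewrite gt_eqF.
    by rewrite ler_pM2r ?invr_gt0 // gerBl.
  rewrite big_split /= -mulr_sumr; apply: lerD.
    apply: ler_wpM2l; first by rewrite mulr_ge0.
    apply: ltW; apply: le_lt_trans thin_i.
    rewrite (eta_dcell r_bounds rM_lt1 phi_unit p_gt0 p_sum Rad_gt0 Rad_closure Rad_lt w i
      [set d | block_mass w i d < th]).
    by under [leRHS]eq_bigl do rewrite asboolb.
  rewrite -mulr_suml ler_pM2r ?invr_gt0 //.
  apply: (@le_trans _ _ (\sum_(d <- cells i) 2 ^- (i + i))).
    by rewrite [leLHS]big_mkcond /=; apply: ler_sum => d _; case: ifP => // _; exact: ltW.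
  rewrite big_const_seq count_predT iter_addr_0 size_cells -[leLHS]mulr_natr natrM mulrCA.
  rewrite -[leRHS]mulr1 ler_wpM2l // natrX exprD.
  have -> : 4%:R = 2 * 2 :> R by ring.
  by rewrite exprMn mulVf // gt_eqF // mulr_gt0 // exprn_gt0.
(* Tangent at [th]: the slope gives [i * (alpha + e / 2)], and the remainder [th] per cell is at
   most the block mass, with total at most 25. *)
have B2 : \sum_(d <- cells i | ~~ (block_mass w i d < th)) ent (mass w i d) <=
    i%:R * (alpha + e / 2) + 25 / ln 2.
  apply: (@le_trans _ _ (\sum_(d <- cells i | ~~ (block_mass w i d < th))
      (i%:R * (alpha + e / 2) * mass w i d + block_mass w i d / ln 2))).
    apply: ler_sum => d; rewrite -leNgt => hd.
    apply: (le_trans (ent_tangent (q0 d) th0)); apply: lerD.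
      rewrite /th expRK.
      by rewrite le_eqVlt; apply/orP; left; apply/eqP; field; rewrite gt_eqF.
    by rewrite ler_pM2r ?invr_gt0 //; apply: le_trans hd; rewrite gerBl.
  apply: (@le_trans _ _ (\sum_(d <- cells i)
      (i%:R * (alpha + e / 2) * mass w i d + block_mass w i d / ln 2))).
    rewrite [leLHS]big_mkcond /=; apply: ler_sum => d _; case: ifP => // _.
    apply: addr_ge0; first by apply: mulr_ge0 => //; rewrite mulr_ge0 // addr_ge0 // ltW.
    by apply: divr_ge0; [apply: sumr_ge0 => *; exact: eta_ge0|exact: ltW].
  rewrite big_split /= -mulr_sumr -mulr_suml.
  rewrite (mass_sum r_bounds rM_lt1 phi_unit p_gt0 p_sum Rad_gt0 Rad_closure Rad_lt) mulr1.
  by rewrite lerD2l ler_pM2r ?invr_gt0 // block_mass_sum.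
apply: (le_trans (lerD B1 B2)).
have iN : 4 * Cst / e <= i%:R.
  have := truncnS_gt (4 * Cst / e); move: (Num.truncn (4 * Cst / e)).+1 hi => T hi hT.
  by apply: (le_trans (ltW hT)); rewrite ler_nat; exact: leq_trans (leq_addl _ _) hi.
rewrite ler_pdivrMr // in iN.
have : (K0 * 2 * (K0 * 2))%:R / ln 2 + 25 / ln 2 = Cst by rewrite /Cst -mulrDl addrC.
clear hi; move: ((K0 * 2 * (K0 * 2))%:R / ln 2) (25 / ln 2) Cst iN => x y z h1 h2.
by rewrite !mulrDr; lra.
Qed.

End exact_dimension.

(** * Concentration of component entropies *)

(** Markov's inequality for the nonnegative quantity [Z], whose sum is controlled by the average
    upper bound on [H] and the total deficit [tau]. *)
Lemma concentration (R : realType) (T : eqType) (n : nat) (s : nat -> seq T)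
    (q H f : nat -> T -> R) (alpha beta e1 e2 tau eps : R) :
  0 < eps -> 0 <= beta -> beta <= alpha -> alpha - e2 <= beta -> e2 <= eps / 2 ->
  (forall i d, 0 <= q i d) -> (forall i d, 0 <= f i d) ->
  (forall i d, beta * (q i d - f i d) <= H i d) ->
  (forall i, \sum_(d <- s i) q i d = 1) ->
  \sum_(0 <= i < n.+1) \sum_(d <- s i) H i d <= n.+1%:R * (alpha + e1) ->
  \sum_(0 <= i < n.+1) \sum_(d <- s i) f i d <= n.+1%:R * tau ->
  e1 + e2 + 3 * alpha * tau < eps ^+ 2 ->
  1 - eps < n.+1%:R^-1 * \sum_(0 <= i < n.+1)
    \sum_(d <- s i | `|H i d - alpha * q i d| < eps * q i d) q i d.
Proof.
move=> eps0 b0 ba ab e2e q0 f0 Hb q1 sumH sumf small.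
have n0 : 0 < n.+1%:R :> R by [].
rewrite -(ltr_pM2l n0) mulrA divff ?gt_eqF // mul1r.
set S := \sum_(_ <= _ < _) _.
(* One [beta * f] makes [Z] nonnegative. If [H] is too small, [beta * f] is at least
   [(eps - e2) * q], hence at least [eps / 2 * q], and the two further copies reach [eps * q]. *)
pose Z i d := H i d - beta * q i d + 3 * beta * f i d.
have key i d : ~~ (`|H i d - alpha * q i d| < eps * q i d) -> eps * q i d <= Z i d.
  rewrite -leNgt /Z => h.
  have := Hb i d; rewrite mulrBr => hb.
  have a1 : 0 <= (alpha - beta) * q i d by rewrite mulr_ge0 // subr_ge0.
  have a2 : 0 <= (beta - alpha + e2) * q i d by rewrite mulr_ge0 //; lra.
  have a3 : 0 <= (eps / 2 - e2) * q i d by rewrite mulr_ge0 //; lra.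
  have a4 : 0 <= beta * f i d by rewrite mulr_ge0.
  rewrite !mulrDl !mulNr in a1 a2 a3.
  have [h0|h0] := leP 0 (H i d - alpha * q i d).
    by rewrite ger0_norm // in h; lra.
  by rewrite ltr0_norm // in h; lra.
have Z0 i d : 0 <= Z i d.
  rewrite /Z; have := Hb i d; rewrite mulrBr => hb.
  have a4 : 0 <= beta * f i d by rewrite mulr_ge0.
  lra.
have tot : n.+1%:R = S + \sum_(0 <= i < n.+1)
    \sum_(d <- s i | ~~ (`|H i d - alpha * q i d| < eps * q i d)) q i d.
  rewrite -big_split /= -[LHS]mulr1 mulr_natl -[n.+1 in LHS]subn0 -sumr_const_nat.
  by apply: eq_bigr => i _; rewrite -(q1 i) (bigID (fun d => `|H i d - alpha * q i d| < eps * q i d)).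
set S' := \sum_(_ <= _ < _) _ in tot.
have bad : eps * S' <= \sum_(0 <= i < n.+1) \sum_(d <- s i) Z i d.
  rewrite /S' mulr_sumr; apply: ler_sum => i _; rewrite mulr_sumr [leLHS]big_mkcond /=.
  by apply: ler_sum => d _; case: ifP => // /key.
have sumZ : \sum_(0 <= i < n.+1) \sum_(d <- s i) Z i d =
    \sum_(0 <= i < n.+1) \sum_(d <- s i) H i d - beta * n.+1%:R +
    3 * beta * \sum_(0 <= i < n.+1) \sum_(d <- s i) f i d.
  rewrite /Z; under eq_bigr do rewrite big_split sumrB /= -!mulr_sumr q1.
  by rewrite big_split sumrB /= -!mulr_sumr sumr_const_nat subn0 -mulr_natr mul1r.
rewrite sumZ in bad.
have c1 : 3 * beta * \sum_(0 <= i < n.+1) \sum_(d <- s i) f i d <= 3 * beta * (n.+1%:R * tau).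
  by apply: ler_wpM2l => //; rewrite mulr_ge0.
have tau0 : 0 <= tau.
  rewrite -(pmulr_rge0 _ n0); apply: le_trans sumf; apply: sumr_ge0 => i _.
  by apply: sumr_ge0.
have c2 : 3 * beta * (n.+1%:R * tau) <= 3 * alpha * (n.+1%:R * tau).
  by apply: ler_wpM2r; [rewrite mulr_ge0 // ltW|lra].
have c3 : n.+1%:R * (alpha - e2) <= beta * n.+1%:R by rewrite mulrC ler_pM2r.
have c4 : n.+1%:R * (e1 + e2 + 3 * alpha * tau) < n.+1%:R * eps ^+ 2 by rewrite ltr_pM2l.
have : eps * S' < eps * (n.+1%:R * eps).
  apply: le_lt_trans bad _.
  move: (\sum_(0 <= i < n.+1) \sum_(d <- s i) H i d)
    (\sum_(0 <= i < n.+1) \sum_(d <- s i) f i d) sumH c1 => A B; move: c2 c3 c4.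
  by rewrite expr2; lra.
rewrite ltr_pM2l // => hS'; rewrite mulrBr mulr1; lra.
Qed.

(** The tail argument of [eta_limsup_null], now for events in the environment. *)
Lemma ae_eventually_cvg0 d (T : measurableType d) (R : realType) (P : probability T R)
    (A : nat -> set T) : (forall n, measurable (A n)) ->
  {ae P, forall w, exists n0, forall n, (n0 <= n)%N -> ~ A n w} ->
  P (A n) @[n --> \oo] --> 0%E.
Proof.
move=> mA [N [mN N0 hN]]; pose F n := \bigcup_(j in [set j | (n <= j)%N]) A j.
have mF n : measurable (F n) by apply: bigcup_measurable.
have cF : P (F n) @[n --> \oo] --> P (\bigcap_n F n).
  apply: nonincreasing_cvg_mu => //.
  - by rewrite (le_lt_trans (probability_le1 P (mF 0%N))) // ltry.
  - exact: bigcapT_measurable.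
  - by move=> n m nm; apply/subsetPset => x [j /= mj Vj]; exists j => //=; exact: leq_trans mj.
have F0 : P (\bigcap_n F n) = 0%E.
  apply/eqP; rewrite eq_le measure_ge0 andbT -N0; apply: le_measure; rewrite ?inE //.
    exact: bigcapT_measurable.
  move=> x Fx; apply: hN => /= -[n0 hn0]; have [j /= nj] := Fx n0 Logic.I.
  exact: hn0.
rewrite F0 in cF; apply: (squeeze_cvge _ (cvg_cst 0%E) cF).
apply: nearW => n; rewrite measure_ge0 /=; apply: le_measure; rewrite ?inE //.
by move=> x Ax; exists n => /=.
Qed.

(** * Matching dyadic scales with products of contraction ratios *)

Section scales.
Variables (R : realType) (I : Type) (r : I -> R) (rm rM : R).
Hypothesis rm_gt0 : 0 < rm.
Hypothesis r_ge : forall i, rm <= r i.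
Hypothesis r_bounds : forall i, 0 < r i <= rM.
Hypothesis rM_lt1 : rM < 1.

(** [N] precedes the first time at which the product drops below [2 ^- i]; that time is not 0, since
    the empty product is 1. *)
Lemma scale_exists (w : nat -> I) i :
  exists N, 2 ^- i <= contr r w N /\ contr r w N.+1 < 2 ^- i.
Proof.
have p2 : (0 : R) < 2 ^- i by rewrite invr_gt0 exprn_gt0.
have [n hn] := rM_expr_small r_bounds rM_lt1 1 w p2; rewrite mul1r in hn.
have ex : exists n, contr r w n < 2 ^- i.
  by exists n; apply: le_lt_trans hn; exact: (contr_le r_bounds).
have [[|N] hN min] := ex_minnP ex.
  exfalso; move: hN; rewrite /contr big_ord0 ltNge invf_le1 ?exprn_gt0 //.
  by rewrite exprn_ege1 // ler1n.
by exists N; split=> //; rewrite leNgt; apply/negP => /min; rewrite ltnn.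
Qed.

(** One letter contracts by at least [rm], more than [2 ^- L], so a single time serves fewer than
    [L + 1] consecutive scales. *)
Lemma scale_window : exists L : nat, forall (w : nat -> I) (Nf : nat -> nat),
  (forall i, 2 ^- i <= contr r w (Nf i) /\ contr r w (Nf i).+1 < 2 ^- i) ->
  forall j M, (count (fun i => Nf i == j) (iota 0 M) <= L)%N.
Proof.
have [L hL] := pow2_small rm_gt0; exists L => w Nf h j M.
apply: count_window => a b /eqP aj /eqP bj ab; rewrite ltnNge; apply/negP => hab.
have [ha _] := h a; have [_ hb] := h b; rewrite aj in ha; rewrite bj in hb.
have : 2 ^- a * rm < 2 ^- b.
  apply: le_lt_trans hb; rewrite contrSr; by apply: ler_pM => //; exact: ltW.
rewrite -(subnKC ab) exprD invfM ltr_pM2l ?invr_gt0 ?exprn_gt0 //.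
have Lab : (L <= b - a)%N by lia.
by move=> /lt_trans /(_ (hL _ Lab)); rewrite ltxx.
Qed.

(** [C] letters contract by more than a factor 2. *)
Lemma scale_linear (w0 : nat -> I) : exists C : nat, forall (w : nat -> I) i N,
  2 ^- i <= contr r w N -> (N <= C * i)%N.
Proof.
have h2 : (0 : R) < 2^-1 by rewrite invr_gt0.
have [C hC] := rM_expr_small r_bounds rM_lt1 1 w0 h2; rewrite mul1r in hC.
have rM0 := rM_gt0 r_bounds w0.
exists C => w i N h; rewrite leqNgt; apply/negP => hN.
have : 2 ^- i <= rM ^+ (C * i).+1.
  apply: (le_trans h); apply: (le_trans (contr_le r_bounds _ _)).
  by apply: ler_wiXn2l => //; exact: ltW.
rewrite exprS exprM -exprVn leNgt => /negP; apply.
apply: (@lt_le_trans _ _ ((rM ^+ C) ^+ i)); first by rewrite gtr_pMl // !exprn_gt0.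
by apply: lerXn2r; rewrite ?nnegrE ?exprn_ge0 ?ltW.
Qed.

End scales.

Section main.
Variables (R : realType) (I : pointedType) (k : I -> nat) (r : I -> R) (phi : I -> R * R).
Variables (t : I -> nat -> R * R) (p : I -> nat -> R) (Rad rM : R).
Hypothesis r_bounds : forall i, 0 < r i <= rM.
Hypothesis rM_lt1 : rM < 1.
Hypothesis phi_unit : forall i, (phi i).1 ^+ 2 + (phi i).2 ^+ 2 = 1.
Hypothesis p_gt0 : forall i j, (j < k i)%N -> 0 < p i j.
Hypothesis p_sum : forall i, \sum_(j < k i) p i j = 1.
Hypothesis Rad_gt0 : 0 < Rad.
Hypothesis Rad_closure : forall i j, (j < k i)%N ->
  closure (fij r phi t i j @` eball (0, 0) Rad) `<=` eball (0, 0) Rad.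
Variables (rm : R) (K0 : nat).
Hypothesis I_fin : finite_set [set: I].
Hypothesis rm_gt0 : 0 < rm.
Hypothesis r_ge : forall i, rm <= r i.
Hypothesis Rad_lt : Rad < K0%:R.
Implicit Types (w : nat -> I).

Local Notation eta := (etaw k r phi t p).
Local Notation mass := (mass k r phi t p).
Local Notation cell_ent := (cell_ent k r phi t p).
Local Notation block_mass := (block_mass k r phi t p).
Local Notation heavy := (heavy k r phi t p).
Local Notation cells := (cells K0).
Local Notation T := (@Tshift I).

(** Telescoping with step [m]: entropies at scale [i + m] minus those at scale [i] leave the last
    [m] scales, after dropping the first [m], which are nonnegative. *)
Lemma cell_ent_total w n m : \sum_(0 <= i < n.+1) \sum_(d <- cells i) cell_ent w m i d <=
  \sum_(n.+1 <= i < n.+1 + m) \sum_(d <- cells i) ent (mass w i d).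
Proof.
pose Hs i := \sum_(d <- cells i) ent (mass w i d).
have Hs0 i : 0 <= Hs i.
  by apply: sumr_ge0 => d _; rewrite ent_ge0 ?mass_le1 ?mass_ge0.
have E i : \sum_(d <- cells i) cell_ent w m i d = Hs (i + m)%N - Hs i.
  by rewrite /Hs big_subcells -sumrB.
under eq_bigr do rewrite E.
have sh : \sum_(0 <= i < n.+1) Hs (i + m)%N = \sum_(m <= i < n.+1 + m) Hs i.
  by rewrite -{2}[m]add0n big_addn addnK.
rewrite sumrB sh lerBlDr addrC -(@big_cat_nat _ _ _ n.+1) //= ?leq_addr //.
rewrite (@big_cat_nat _ _ _ m 0) //= ?leq_addl // lerDr.
by apply: sumr_ge0.
Qed.

(** Each time [j] is used by at most [L] scales, and scales up to [n] use times up to [C * n]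
    only. *)
Lemma bad_scales_le (B : set (Omega I)) w (Nf : nat -> nat) (L C n : nat) :
  (forall j M, (count (fun i => Nf i == j) (iota 0 M) <= L)%N) ->
  (forall i, (Nf i <= C * i)%N) ->
  \sum_(0 <= i < n.+1) \1_B (iter (Nf i) T w : Omega I) <= L%:R * visits R B (C * n).+1 w.
Proof.
move=> hL hC.
have E i : (i < n.+1)%N -> \1_B (iter (Nf i) T w : Omega I) =
    \sum_(0 <= j < (C * n).+1) \1_B (iter j T w : Omega I) * (Nf i == j)%:R :> R.
  move=> ni; have Ni : Nf i \in index_iota 0 (C * n).+1.
    rewrite mem_index_iota ltnS /=; apply: (leq_trans (hC i)).
    by rewrite leq_mul2l -ltnS ni orbT.
  rewrite (bigD1_seq (Nf i) Ni (iota_uniq _ _)) /=.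
  rewrite eqxx mulr1 big1 ?addr0 // => j; rewrite eq_sym => /negbTE ->.
  by rewrite mulr0.
rewrite big_nat; under eq_bigr => i ni do rewrite E //.
rewrite -big_nat exchange_big /= /visits mulr_sumr; apply: ler_sum => j _.
rewrite -mulr_sumr mulrC; apply: ler_wpM2r => //.
have -> : \sum_(0 <= i < n.+1) (Nf i == j)%:R = (count (fun i => Nf i == j) (iota 0 n.+1))%:R :> R.
  rewrite -sum1_count natr_sum [RHS]big_mkcond /index_iota subn0; apply: eq_bigr => i _.
  by case: eqP.
by rewrite ler_nat.
Qed.

(** The deterministic part, for one fixed environment: the probability enters only through the last
    hypothesis, the bound on the visits to [B]. *)
Lemma component_concentration w (alpha eps e0 tau c theta lambda : R) (m A L C : nat)
    (B : set (Omega I)) :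
  exact_dim (eta w) alpha ->
  0 < eps -> 0 < e0 -> e0 <= eps / 2 -> 0 < tau -> e0 + e0 + 3 * alpha * tau < eps ^+ 2 ->
  (0 < m)%N -> 0 < c -> 0 < theta -> (0 < alpha - e0 -> theta <= c) ->
  m%:R * (alpha - e0) <= (ln c - ln theta) / ln 2 ->
  (((A + A).+1 ^ 2)%:R + 1) * c <= tau / 2 -> Rad / rm <= A%:R ->
  (forall (w : nat -> I) (Nf : nat -> nat),
    (forall i, 2 ^- i <= contr r w (Nf i) /\ contr r w (Nf i).+1 < 2 ^- i) ->
    forall j M, (count (fun i => Nf i == j) (iota 0 M) <= L)%N) ->
  (forall (w : nat -> I) i N, 2 ^- i <= contr r w N -> (N <= C * i)%N) ->
  (forall v : nat -> I, ~ B v -> eta v (heavy v m theta) <= c ^+ 2) ->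
  0 <= lambda -> L%:R * lambda * C%:R <= tau / 4 ->
  (exists K : nat, forall n, visits R B n w <= lambda * n%:R + K%:R) ->
  exists n0, forall n, (n0 <= n)%N ->
    1 - eps < Pcomp (eta w) n (fun nu => `|Hm m nu - alpha| < eps).
Proof.
move=> dim_w eps0 e00 e0e tau0 small m0 c0 th0 thc Lamb Ac RA hL hC hB l0 Ltau [K hK].
have a0 : 0 <= alpha by exact: (alpha_ge0 rM_lt1 p_gt0 p_sum Rad_gt0 Rad_lt dim_w).
have m0' : 0 < m%:R :> R by rewrite ltr0n.
(* Truncation at 0 covers small [alpha], where nonnegativity of entropy is already the required
   lower bound. *)
pose beta := Num.max 0 (alpha - e0).
have b0 : 0 <= beta by rewrite /beta le_max lexx.
have ba : beta <= alpha by rewrite /beta ge_max a0 /=; lra.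
have ab : alpha - e0 <= beta by rewrite /beta le_max lexx orbT.
have [Nf hNf] := choice (scale_exists r_bounds rM_lt1 w).
have q0 i d : 0 <= mass w i d by exact: mass_ge0.
have h0 i d : 0 <= cell_ent w m i d.
  exact: (cell_ent_ge0 r_bounds rM_lt1 phi_unit p_gt0 p_sum Rad_gt0 Rad_closure).
have /choice[f hf] : forall i, exists def : int * int -> R,
    [/\ forall d, 0 <= def d,
        forall d, m%:R * beta * (mass w i d - def d) <= cell_ent w m i d &
        \sum_(d <- cells i) def d <= tau / 2 + \1_B (iter (Nf i) T w : Omega I)].
  move=> i; have [s1 s2] := hNf i.
  have [Bi|nBi] := pselect (B (iter (Nf i) T w)).
    (* At a bad scale the whole mass is declared deficient; its total 1 is the value of the
       indicator. *)
    exists (mass w i); split=> // [d|]; first by rewrite subrr mulr0.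
    rewrite (mass_sum r_bounds rM_lt1 phi_unit p_gt0 p_sum Rad_gt0 Rad_closure Rad_lt).
    by rewrite /indic mem_set // lerDr divr_ge0 // ltW.
  have [ae|ae] := leP (alpha - e0) 0.
    exists (fun=> 0); split=> // [d|]; first by rewrite /beta (max_idPl ae) mulr0 mul0r.
    by rewrite big1 // addr_ge0 // divr_ge0 // ltW.
  have bE : beta = alpha - e0 by rewrite /beta; apply/max_idPr/ltW.
  have sA : Rad * contr r w (Nf i) * 2 ^+ i <= A%:R.
    apply: le_trans RA; rewrite -mulrA ler_pM2l // -[leRHS]mul1r ler_pdivlMr //.
    rewrite mulrAC -ler_pdivlMr ?exprn_gt0 // mul1r; apply: ltW; apply: le_lt_trans s2.
    by rewrite contrSr ler_pM2l // (contr_gt0 r_bounds).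
  have [def [d1 d2 d3]] := cell_ent_lower r_bounds rM_lt1 phi_unit p_gt0 p_sum Rad_gt0
    Rad_closure K0 s1 sA th0 c0 (thc ae) (hB _ nBi).
  exists def; split=> // [d|].
    have [le|lt] := leP (mass w i d - def d) 0.
      by apply: le_trans (h0 i d); rewrite mulr_ge0_le0 // mulr_ge0.
    by apply: le_trans (d2 d); rewrite ler_pM2r // bE.
  by apply: (le_trans d3); apply: (le_trans Ac); rewrite lerDl.
have e02 : 0 < e0 / 2 by rewrite divr_gt0.
have [n1 _ hH] := entropy_upper r_bounds rM_lt1 phi_unit p_gt0 p_sum Rad_gt0 Rad_closure
  Rad_lt dim_w e02.
(* [X0] is the constant part of the deficit left by the visit bound and [X1] the cost of the [m]
   extra scales; [n2] and [n3] make them at most [tau / 4] and [e0 / 2] per scale. *)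
pose X0 : R := L%:R * (lambda + K%:R).
pose X1 : R := m%:R * (alpha + e0 / 2).
have [n2 hn2] : exists n2 : nat, 4 * X0 / tau <= n2%:R.
  by exists (Num.truncn (4 * X0 / tau)).+1; exact/ltW/truncnS_gt.
have [n3 hn3] : exists n3 : nat, 2 * X1 / e0 <= n3%:R.
  by exists (Num.truncn (2 * X1 / e0)).+1; exact/ltW/truncnS_gt.
exists (n1 + n2 + n3)%N => n hn.
have n1n : (n1 <= n)%N by rewrite -addnA in hn; exact: leq_trans (leq_addr _ _) hn.
have n2n : n2%:R <= n.+1%:R :> R.
  by rewrite ler_nat leqW // (leq_trans _ hn) // addnAC leq_addl.
have n3n : n3%:R <= n.+1%:R :> R by rewrite ler_nat leqW // (leq_trans _ hn) // leq_addl.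
have {hn2}X0n : 4 * X0 <= n.+1%:R * tau.
  by rewrite -ler_pdivrMr //; exact: le_trans n2n.
have {hn3}X1n : 2 * X1 <= n.+1%:R * e0.
  by rewrite -ler_pdivrMr //; exact: le_trans n3n.
have nS : n%:R <= n.+1%:R :> R by rewrite ler_nat.
rewrite (PcompE r_bounds rM_lt1 phi_unit p_gt0 p_sum Rad_gt0 Rad_closure Rad_lt _ _ _ _ m0).
have := @concentration R _ n cells (mass w) (fun i d => cell_ent w m i d / m%:R) f
  alpha beta e0 e0 tau eps eps0 b0 ba ab e0e q0 (fun i => let: And3 x _ _ := hf i in x).
have -> : \sum_(0 <= i < n.+1) \sum_(d <- cells i |
      `|cell_ent w m i d / m%:R - alpha * mass w i d| < eps * mass w i d) mass w i d =
    \sum_(0 <= i < n.+1) \sum_(d <- cells i | `|cell_ent w m i d - alpha * m%:R * mass w i d|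
      < eps * m%:R * mass w i d) mass w i d.
  apply: eq_bigr => i _; apply: eq_bigl => d.
  have -> : cell_ent w m i d - alpha * m%:R * mass w i d =
      (cell_ent w m i d / m%:R - alpha * mass w i d) * m%:R by field; rewrite gt_eqF.
  by rewrite normrM (gtr0_norm m0') mulrAC ltr_pM2r.
apply=> //.
- move=> i d; have [_ /(_ d) hd _] := hf i.
  by rewrite ler_pdivlMr // mulrC mulrA.
- by move=> i; exact: (mass_sum r_bounds rM_lt1 phi_unit p_gt0 p_sum Rad_gt0 Rad_closure).
- under eq_bigr do rewrite -mulr_suml.
  rewrite -mulr_suml ler_pdivrMr //; apply: (le_trans (cell_ent_total w n m)).
  apply: (@le_trans _ _ (\sum_(n.+1 <= i < n.+1 + m) (n.+1 + m)%:R * (alpha + e0 / 2))).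
    rewrite big_nat [leRHS]big_nat; apply: ler_sum => i /andP[i1 i2].
    apply: (le_trans (hH i _)); first exact: leq_trans n1n (ltnW i1).
    apply: ler_wpM2r; first lra.
    by rewrite ler_nat ltnW.
  rewrite sumr_const_nat addKn -[leLHS]mulr_natr; apply: ler_wpM2r; first exact: ltW.
  rewrite natrD mulrDl -/X1.
  by move: (n.+1%:R) X1 X1n => N X h; rewrite !mulrDr; lra.
- apply: (@le_trans _ _ (\sum_(0 <= i < n.+1) (tau / 2 + \1_B (iter (Nf i) T w : Omega I)))).
    by apply: ler_sum => i _; have [_ _] := hf i.
  rewrite big_split /= sumr_const_nat subn0.
  have hb : \sum_(0 <= i < n.+1) \1_B (iter (Nf i) T w : Omega I) <=
      L%:R * visits R B (C * n).+1 w.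
    apply: bad_scales_le; first exact: hL hNf.
    by move=> i; exact: hC (hNf i).1.
  have hv := ler_wpM2l (ler0n R L) (hK (C * n).+1).
  have {hb}hb := le_trans hb hv; rewrite -natr1 natrM in hb.
  have hx : L%:R * lambda * C%:R * n%:R <= tau / 4 * n.+1%:R.
    by apply: ler_pM => //; rewrite !mulr_ge0.
  apply: (le_trans (lerD (lexx _) hb)); rewrite -[_ *+ n.+1]mulr_natl.
  have -> : L%:R * (lambda * (C%:R * n%:R + 1) + K%:R) = L%:R * lambda * C%:R * n%:R + X0.
    by rewrite /X0; ring.
  by move: (n.+1%:R) X0 X0n (L%:R * lambda * C%:R * n%:R) hx => N X h Y; lra.
Qed.

Lemma measurable_heavy m (theta c : R) :
  measurable [set w : Omega I | c < eta w (heavy w m theta)].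
Proof.
have mf : measurable_fun [set: Omega I] (fun w : Omega I => eta w (heavy w m theta)).
  rewrite (_ : (fun w => _) = (fun w : Omega I =>
    \sum_(d <- cells m | theta < block_mass w m d) mass w m d)); last first.
    apply/funext => w.
    rewrite (eta_dcell r_bounds rM_lt1 phi_unit p_gt0 p_sum Rad_gt0 Rad_closure Rad_lt w m
      (fun d => theta < block_mass w m d)).
    by apply: eq_bigl => d; rewrite asboolb.
  apply: measurable_sum_lt => d; first exact: measurable_cst.
    by apply: measurable_sum => e; exact: (measurable_mass r_bounds rM_lt1 phi_unit p_gt0 p_sum
      Rad_gt0 Rad_closure I_fin).
  exact: (measurable_mass r_bounds rM_lt1 phi_unit p_gt0 p_sum Rad_gt0 Rad_closure I_fin).
have := mf measurableT _ (measurable_itv `]c, +oo[); rewrite setTI.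
rewrite (_ : _ @^-1` _ = [set w : Omega I | c < eta w (heavy w m theta)]) //.
by apply/seteqP; split=> w /=; rewrite in_itv /= andbT.
Qed.

End main.

Unset Implicit Arguments. Set Strict Implicit.

Theorem proposition3p10 (R : realType) (I : pointedType) (k : I -> nat) (r : I -> R)
  (phi : I -> R * R) (t : I -> nat -> R * R) (p : I -> nat -> R)
  (P : probability (Omega I) R) (alpha Rad : R) :
  finite_set [set: I] ->
  (* the planar model *)
  (forall i, 0 < r i < 1) ->
  (forall i, (phi i).1 ^+ 2 + (phi i).2 ^+ 2 = 1) ->
  (forall i j, (j < k i)%N -> 0 < p i j) ->
  (forall i, \sum_(j < k i) p i j = 1) ->
  (* Standing Assumption: P is T-invariant and ergodic *)
  (forall A : set (Omega I), measurable A -> P (@Tshift I @^-1` A) = P A) ->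
  (forall A : set (Omega I), measurable A -> @Tshift I @^-1` A = A ->
     P A = 0%E \/ P A = 1%E) ->
  (* (i) *)
  (exists i0 : I, (0 < P [set w : Omega I | w 0%N = i0])%E /\
     exists j1 j2, [/\ (j1 < k i0)%N, (j2 < k i0)%N & fij r phi t i0 j1 <> fij r phi t i0 j2]) ->
  (* (ii) *)
  (exists i1 : I, (0 < P [set w : Omega I | w 0%N = i1])%E /\ (phi i1).2 != 0) ->
  (* alpha = dim(Sigma): the a.s. exact dimension of eta^(w) *)
  {ae P, forall w : Omega I, exact_dim (etaw k r phi t p w) alpha} ->
  (* the fixed radius Rad *)
  0 < Rad ->
  (forall i j, (j < k i)%N ->
     closure (fij r phi t i j @` eball (0, 0) Rad) `<=` eball (0, 0) Rad) ->
  (forall i, 1 / 2 < 2 * Rad * r i) ->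
  forall eps : R, 0 < eps ->
  exists m0 : nat, forall m : nat, (m0 < m)%N ->
    (fun n : nat =>
       P [set w : Omega I |
          1 - eps < Pcomp (etaw k r phi t p (iter (nprime Rad r n w) (@Tshift I) w)) n
                          (fun nu => `| Hm m nu - alpha | < eps)])
    @ \oo --> 1%E.
Proof.
move=> I_fin r01 phi_unit p_gt0 p_sum P_inv P_erg _ _ dimP Rad_gt0 Rad_closure _ eps eps0.
have [rm [rM [rm0 rM1 rmM]]] : exists rm rM : R,
    [/\ 0 < rm, rM < 1 & forall i, rm <= r i <= rM].
  have /finite_seqP[s sE] := I_fin.
  have : exists rm rM : R, [/\ 0 < rm, rM < 1 & forall i, i \in s -> rm <= r i <= rM].
    (* Finiteness of [I] makes the contraction bounds uniform; for the empty list any [rm > 0] and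
       [rM < 1] will do. *)
    elim: s {sE} => [|a s [rm [rM [h1 h2 h3]]]]; first by exists 1, 0.
    have /andP[ra0 ra1] := r01 a.
    exists (Num.min rm (r a)), (Num.max rM (r a)).
    split; [by rewrite lt_min h1|by rewrite gt_max h2|move=> i].
    by rewrite inE ge_min le_max => /predU1P[->|/h3/andP[-> ->]]; rewrite ?lexx ?orbT.
  move=> [rm [rM [h1 h2 h3]]]; exists rm, rM; split=> // i; apply: h3.
  by have : [set: I] i by []; rewrite sE.
have r_ge i : rm <= r i by case/andP: (rmM i).
have r_bounds i : 0 < r i <= rM by case/andP: (rmM i) => _ ->; case/andP: (r01 i) => ->.
have [K0 Rad_lt] : exists K0 : nat, Rad < K0%:R.
  by exists (Num.truncn Rad).+1; exact: truncnS_gt.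
have a0 : 0 <= alpha.
  have [w dw] : exists w : Omega I, exact_dim (etaw k r phi t p w) alpha.
    apply: contrapT => /forallNP h; have [N [mN N0 hN]] := dimP.
    have : P [set: Omega I] = 0%E.
      by rewrite -N0; congr (P _); apply/seteqP; split=> // w _; apply: hN; exact: h.
    by rewrite probability_setT => /eqP; rewrite onee_eq0.
  exact: (alpha_ge0 rM1 p_gt0 p_sum Rad_gt0 Rad_lt dw).
have eps2 : 0 < eps ^+ 2 by rewrite exprn_gt0.
(* With [tau] below, [e0 + e0 + 3 * alpha * tau] is at most [5 / 8 * eps ^+ 2]; dividing by
   [alpha + 1] is safe when [alpha = 0]. *)
pose e0 := Num.min (eps / 2) (eps ^+ 2 / 8).
have e00 : 0 < e0 by rewrite lt_min !divr_gt0.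
have e0e : e0 <= eps / 2 by rewrite ge_min lexx.
have e0e' : e0 <= eps ^+ 2 / 8 by rewrite ge_min lexx orbT.
have a1 : 0 < alpha + 1 by lra.
pose tau := eps ^+ 2 / 8 / (alpha + 1).
have tau0 : 0 < tau by rewrite !divr_gt0.
have small : e0 + e0 + 3 * alpha * tau < eps ^+ 2.
  have : tau * (alpha + 1) = eps ^+ 2 / 8 by rewrite divfK ?gt_eqF.
  rewrite mulrDr mulr1 => h; have -> : 3 * alpha * tau = 3 * (tau * alpha) by ring.
  have key (X y e E : R) : X + y = E / 8 -> 0 < y -> e <= E / 8 -> 0 < E -> e + e + 3 * X < E.
    by move=> *; lra.
  exact: key h tau0 e0e' eps2.
have [A RA] : exists A : nat, Rad / rm <= A%:R.
  by exists (Num.truncn (Rad / rm)).+1; exact/ltW/truncnS_gt.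
have Q0 : 0 < ((A + A).+1 ^ 2)%:R + 1 :> R by rewrite ltr_wpDl.
pose c := tau / 2 / (((A + A).+1 ^ 2)%:R + 1).
have c0 : 0 < c by rewrite !divr_gt0.
have Ac : (((A + A).+1 ^ 2)%:R + 1) * c <= tau / 2.
  by rewrite /c mulrCA divff ?gt_eqF // mulr1.
have [L hL] := scale_window rm0 r_ge rM1.
have [C hC] := scale_linear r_bounds rM1 (fun=> point).
have LC0 : 0 < L%:R * C%:R + 1 :> R by rewrite ltr_wpDl // mulr_ge0.
pose lambda := tau / 4 / (L%:R * C%:R + 1).
have l0 : 0 < lambda by rewrite !divr_gt0.
have Ltau : L%:R * lambda * C%:R <= tau / 4.
  have <- : lambda * (L%:R * C%:R + 1) = tau / 4 by rewrite divfK ?gt_eqF.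
  have -> : L%:R * lambda * C%:R = lambda * (L%:R * C%:R) by ring.
  by rewrite ler_pM2l // lerDl.
(* Half of the margin [e0] goes to the local dimension; the other half, multiplied by [m], absorbs
   [- ln c / ln 2], which fixes [m2]. *)
pose theta (m : nat) : R := expR (- (m%:R * ln 2 * (alpha - e0 / 2))).
pose B m : set (Omega I) := [set w | c ^+ 2 < etaw k r phi t p w (heavy k r phi t p w m (theta m))].
have mB m : measurable (B m).
  exact: (measurable_heavy r_bounds rM1 phi_unit p_gt0 p_sum Rad_gt0 Rad_closure I_fin Rad_lt).
have e02 : 0 < e0 / 2 by rewrite divr_gt0.
have PB0 : P (B m) @[m --> \oo] --> 0%E.
  apply: ae_eventually_cvg0 => //; apply: filterS dimP => w dw.
  have := heavy_cvg0 r_bounds rM1 phi_unit p_gt0 p_sum Rad_gt0 Rad_closure Rad_lt dw e02.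
  move=> /cvgrPdist_lt/(_ (c ^+ 2) (exprn_gt0 2 c0))[n0 _ h]; exists n0 => n hn /=.
  apply/negP; rewrite -leNgt; apply: ltW; apply: le_lt_trans (h n hn).
  by rewrite sub0r normrN; exact: ler_norm.
have [m1 hm1] : exists m1 : nat, forall m, (m1 <= m)%N -> (P (B m) < lambda%:E)%E.
  have /fine_cvg/cvgrPdist_lt/(_ lambda l0)[m1 _ h] := PB0; exists m1 => m /h.
  rewrite /= sub0r normrN => /(le_lt_trans (ler_norm _)).
  by rewrite -lte_fin fineK // fin_num_measure.
have [m2 hm2] : exists m2 : nat, (- ln c / ln 2) / (e0 / 2) <= m2%:R.
  by exists (Num.truncn (- ln c / ln 2 / (e0 / 2))).+1; exact/ltW/truncnS_gt.
exists (m1 + m2)%N => m hm.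
have m0 : (0 < m)%N by exact: leq_ltn_trans hm.
have hc : - ln c / ln 2 <= m%:R * (e0 / 2).
  rewrite -ler_pdivrMr //; apply: (le_trans hm2); rewrite ler_nat.
  by apply: leq_trans (ltnW hm); exact: leq_addl.
have l2 := ln2_gt0 R.
have lnth : ln (theta m) / ln 2 = - (m%:R * (alpha - e0 / 2)).
  by rewrite /theta expRK; field; rewrite gt_eqF.
have Lamb : m%:R * (alpha - e0) <= (ln c - ln (theta m)) / ln 2.
  rewrite mulrBl lnth; move: hc; rewrite mulNr; move: (ln c / ln 2) => X.
  have -> : m%:R * (alpha - e0) = m%:R * (alpha - e0 / 2) - m%:R * (e0 / 2) by field.
  by move: (m%:R * (e0 / 2)) (m%:R * (alpha - e0 / 2)) => *; lra.
(* Positivity of the left side of [Lamb] forces [theta m] below [c]. *)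
have thc : 0 < alpha - e0 -> theta m <= c.
  move=> ae; rewrite -ler_ln ?posrE ?expR_gt0 // -subr_ge0.
  rewrite -(pmulr_lge0 _ (_ : 0 < (ln 2)^-1 :> R)) ?invr_gt0 //; apply: le_trans Lamb.
  by rewrite mulr_ge0 // ltW.
pose G n : set (Omega I) := [set w | 1 - eps <
  Pcomp (etaw k r phi t p w) n (fun nu => `|Hm m nu - alpha| < eps)].
have mG n : measurable (G n).
  have := measurable_Pcomp r_bounds rM1 phi_unit p_gt0 p_sum Rad_gt0 Rad_closure I_fin Rad_lt
    n alpha eps m0 measurableT (measurable_itv `]1 - eps, +oo[).
  rewrite setTI (_ : _ @^-1` _ = G n) //.
  by apply/seteqP; split=> w /=; rewrite in_itv /= andbT.
have GC0 : P (~` G n) @[n --> \oo] --> 0%E.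
  apply: ae_eventually_cvg0; first by move=> n; exact: measurableC.
  have vis := visits_bound I_fin P_inv P_erg (mB m)
    (hm1 m (leq_trans (leq_addr _ _) (ltnW hm))).
  apply: filterS2 dimP vis => w dw hv.
  have [|n0 h] := component_concentration r_bounds rM1 phi_unit p_gt0 p_sum Rad_gt0 Rad_closure
    rm0 r_ge Rad_lt dw eps0 e00 e0e tau0 small m0 c0 (expR_gt0 _) thc Lamb Ac RA hL hC _
    (ltW l0) Ltau hv.
    by move=> v /negP; rewrite -leNgt.
  by exists n0 => n /h Gn; exact.
have [K hK] := nprime_dominated I_fin P_inv rm0 r_ge r_bounds rM1 Rad_gt0.
pose D n : set (Omega I) := [set w | (~` G n) (iter (nprime Rad r n w) (@Tshift I) w)].
have mD n : measurable (D n) by have [] := hK n _ (measurableC (mG n)).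
have D0 : P (D n) @[n --> \oo] --> 0%E.
  have KG : (K%:R%:E * P (~` G n))%E @[n --> \oo] --> 0%E.
    by rewrite -[X in _ --> X](mule0 K%:R%:E); apply: cvgeZl.
  apply: (squeeze_cvge _ (cvg_cst 0%E) KG).
  by apply: nearW => n; rewrite measure_ge0 /=; have [] := hK n _ (measurableC (mG n)).
have -> : (fun n : nat => P [set w : Omega I |
    1 - eps < Pcomp (etaw k r phi t p (iter (nprime Rad r n w) (@Tshift I) w)) n
      (fun nu => `|Hm m nu - alpha| < eps)]) = (fun n => 1 - P (D n))%E.
  apply/funext => n; rewrite -probability_setC //; congr (P _).
  by apply/seteqP; split=> w /=; [move=> h; exact|move=> /contrapT].
rewrite -[X in _ --> X](sube0 1%E); apply: cvgeB => //; exact: cvg_cst.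
Qed.
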